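(* The following problem is decidable, i.e. there is an algorithm solving it. Input: a finitely presented $\mathbb{Z}[X^{\pm}]$-module $\mathcal{A}$ (given by a finite presentation) and two elements $\boldsymbol{f}_0, \boldsymbol{f}_1 \in \mathcal{A}$. Question: does there exist $z \in \mathbb{Z}$ such that $X^z \boldsymbol{f}_1 = \boldsymbol{f}_0$ in $\mathcal{A}$?
   Context: $\mathbb{Z}[X^{\pm}] = \mathbb{Z}[X, X^{-1}]$ is the ring of univariate Laurent polynomials with integer coefficients. A $\mathbb{Z}[X^{\pm}]$-module $\mathcal{A}$ is finitely presented if it can be written as a quotient $M/N$ of two finitely generated $\mathbb{Z}[X^{\pm}]$-submodules $N \subseteq M$ of $\mathbb{Z}[X^{\pm}]^D$ for some $D \in \mathbb{N}$; a finite presentation is such a pair $(M,N)$ given by finite lists of generators. Elements of $\mathcal{A}$ are represented by vectors in $M \subseteq \mathbb{Z}[X^{\pm}]^D$ (unique modulo $N$). *)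

(* Defs.v *)
From HB Require Import structures.
From mathcomp Require Import all_boot all_order all_algebra.
From mathcomp Require Import fraction boolp.

Set Implicit Arguments.
Unset Strict Implicit.
Unset Printing Implicit Defensive.

Import GRing.Theory.

(* General recursive functions in Kleene's sense: minimization [rec_mu] is
   applied only when a zero always exists, so every function here is total.
   Each function is specified pointwise by its defining equations, so [h] in
   [rec_prim] and [rec_mu] is unique up to extensional equality. *)
Inductive recursive : forall n, (n.-tuple nat -> nat) -> Prop :=
| rec_zero n : recursive (fun _ : n.-tuple nat => 0)
| rec_succ : recursive (fun v : 1.-tuple nat => (thead v).+1)
| rec_proj n (i : 'I_n) : recursive (fun v : n.-tuple nat => tnth v i)
| rec_comp m n (f : m.-tuple nat -> nat) (g : 'I_m -> n.-tuple nat -> nat) :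
    recursive f -> (forall i, recursive (g i)) ->
    recursive (fun v : n.-tuple nat => f [tuple g i v | i < m])
| rec_prim n (f : n.-tuple nat -> nat) (g : n.+2.-tuple nat -> nat)
    (h : n.+1.-tuple nat -> nat) :
    recursive f -> recursive g ->
    (forall v : n.-tuple nat, h [tuple of 0 :: v] = f v) ->
    (forall k (v : n.-tuple nat),
       h [tuple of k.+1 :: v] = g [tuple of k :: h [tuple of k :: v] :: v]) ->
    recursive h
| rec_mu n (f : n.+1.-tuple nat -> nat) (h : n.-tuple nat -> nat) :
    recursive f ->
    (forall v : n.-tuple nat, f [tuple of h v :: v] = 0) ->
    (forall (v : n.-tuple nat) k, k < h v -> f [tuple of k :: v] <> 0) ->
    recursive h.

(* Inputs are the [x : I] satisfying [valid], presented to the algorithm as the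
   number [code x]; nothing is required of the answer on any other number. *)
Definition decidable_problem (I : Type) (code : I -> nat)
    (valid question : I -> Prop) : Prop :=
  exists2 chi : 1.-tuple nat -> nat, recursive chi &
    forall x, valid x ->
      (question x -> chi [tuple code x] = 1) /\
      (~ question x -> chi [tuple code x] = 0).

Local Open Scope ring_scope.
Local Notation "p %:F" := (@tofrac _ p).

(* Z[X, X^-1] as a subring of the field Q(X) = Frac(Z[X]). *)
Definition laurent_pred : {pred {fraction {poly int}}} :=
  fun x => `[< exists (p : {poly int}) (n : nat), x = p%:F / 'X%:F ^+ n >].

Lemma laurent_subring : subring_closed laurent_pred.
Proof.
have X0 n : 'X%:F ^+ n != 0 :> {fraction {poly int}}.
  by rewrite expf_neq0 // tofrac_eq0 polyX_eq0.
split.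
- by apply/asboolP; exists 1, 0%N; rewrite expr0 divr1 tofrac1.
- move=> _ _ /asboolP[p [m ->]] /asboolP[q [n ->]]; apply/asboolP.
  exists (p * 'X ^+ n - q * 'X ^+ m), (m + n)%N.
  by rewrite tofracB !tofracM !tofracXn -mulNr addf_div // mulNr -exprD.
- move=> _ _ /asboolP[p [m ->]] /asboolP[q [n ->]]; apply/asboolP.
  by exists (p * q), (m + n)%N; rewrite tofracM exprD invfM mulrACA.
Qed.

HB.instance Definition _ :=
  GRing.isSubringClosed.Build {fraction {poly int}} laurent_pred laurent_subring.

Record laurent : predArgType := Laurent {
  laurent_val : {fraction {poly int}};
  _ : laurent_val \in laurent_pred }.

HB.instance Definition _ := [isSub for laurent_val].
HB.instance Definition _ := [Choice of laurent by <:].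
HB.instance Definition _ := [SubChoice_isSubComNzRing of laurent by <:].

Lemma laurent_expz (z : int) : 'X%:F ^ z \in laurent_pred.
Proof.
apply/asboolP; case: z => n.
  by exists ('X ^+ n), 0%N; rewrite expr0 divr1 tofracXn.
by exists 1, n.+1; rewrite tofrac1 div1r NegzE -exprnN.
Qed.

Definition lX (z : int) : laurent := Laurent (laurent_expz z).

Definition span D (gens : seq 'rV[laurent]_D) (v : 'rV[laurent]_D) : Prop :=
  exists c : 'I_(size gens) -> laurent, v = \sum_i c i *: gens`_i.

Definition eq_mod D (N : 'rV[laurent]_D -> Prop) (u v : 'rV[laurent]_D) : Prop :=
  N (u - v).

(* A list of pairs (c, e) stands for the sum of the c * X^e; exponents may
   repeat and coefficients may vanish. *)
Definition lpoly := seq (int * int).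

Definition lpoly_val (s : lpoly) : laurent := \sum_(t <- s) t.1%:~R * lX t.2.

Definition vec_val D (v : D.-tuple lpoly) : 'rV[laurent]_D :=
  \row_j lpoly_val (tnth v j).

(* Generators of M and N in Z[X, X^-1]^dim, and representatives of f_0, f_1. *)
Record input := Input {
  dim : nat;
  gensM : seq (dim.-tuple lpoly);
  gensN : seq (dim.-tuple lpoly);
  elt0 : dim.-tuple lpoly;
  elt1 : dim.-tuple lpoly }.

Definition subM (x : input) : 'rV[laurent]_(dim x) -> Prop :=
  span (map (@vec_val (dim x)) (gensM x)).

Definition subN (x : input) : 'rV[laurent]_(dim x) -> Prop :=
  span (map (@vec_val (dim x)) (gensN x)).

Arguments subM : clear implicits.
Arguments subN : clear implicits.

Definition valid_input (x : input) : Prop :=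
  [/\ forall v, subN x v -> subM x v,
      subM x (vec_val (elt0 x)) & subM x (vec_val (elt1 x))].

Definition in_shift_orbit (x : input) : Prop :=
  exists z : int,
    eq_mod (subN x) (lX z *: vec_val (elt1 x)) (vec_val (elt0 x)).

Local Close Scope ring_scope.

Definition code_int (z : int) : nat :=
  match z with Posz n => n.*2 | Negz n => n.*2.+1 end.

Definition code_seq T (c : T -> nat) (s : seq T) : nat :=
  CodeSeq.code (map c s).

Definition code_lpoly : lpoly -> nat :=
  code_seq (fun t => CodeSeq.code [:: code_int t.1; code_int t.2]).

Definition code_vec D (v : D.-tuple lpoly) : nat := code_seq code_lpoly v.

Definition code_input (x : input) : nat :=
  CodeSeq.code [:: dim x; code_seq (@code_vec (dim x)) (gensM x);
    code_seq (@code_vec (dim x)) (gensN x); code_vec (elt0 x); code_vec (elt1 x)].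

Lemma code_input_inj : injective code_input.
Proof.
have cI := can_inj CodeSeq.codeK.
have sI T (c : T -> nat) : injective c -> injective (code_seq c).
  by move=> ic s t /cI /(inj_map ic).
have zI : injective code_int.
  case=> m [] n /= e.
  - by congr Posz; apply: double_inj.
  - by move/(congr1 odd): e; rewrite /= !odd_double.
  - by move/(congr1 odd): e; rewrite /= !odd_double.
  - by congr Negz; apply: double_inj; case: e.
have lI : injective code_lpoly.
  by apply: sI => -[a b] [c d] /cI[/zI /= -> /zI /= ->].
have vI D : injective (@code_vec D) by move=> u v /(sI _ _ lI)/val_inj.
case=> D M N f g [D' M' N' f' g'] /cI /= [e].
by subst D'; move=> /(sI _ _ (@vI D)) -> /(sI _ _ (@vI D)) -> /vI -> /vI ->.
Qed.

(* Main.v *)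
Require Import Defs.
From mathcomp Require Import all_boot all_order all_algebra all_field.
From mathcomp Require Import fraction boolp functions.
From mathcomp Require Import zify ring lra.

(* Write the module as R^D / N with R = Z[X, X^-1]; the ambient submodule M plays
   no role. Solvable instances are recursively enumerable, so by Post's theorem
   it is enough that the unsolvable ones are too, i.e. that unsolvability has
   finite certificates.

   Non-membership of v in N: the vectors of N with exponents in a window [lo, hi]
   form a lattice L such that X^{+-1} u is in L as soon as u is in L and X^{+-1} u
   stays in the window. Conversely any lattice with this closure property that
   contains the generators contains all of N within the window, so a basis of L
   and a functional separating v from L form a certificate. The same works for
   v not in N + Z[X^-1] E.

   Bounding the exponents z with X^z f1 = f0: we may assume that f0 = g f1 and
   f1 = g' f0. Let I be the annihilator of f1.
   - If f1 is not in X^-1 Z[X^-1] f1, then the exponents of g and g' bound |z|.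
   - Otherwise I contains a monic polynomial, and over Q it is generated by a
     monic integer polynomial q with q(0) <> 0. A root x of q satisfies
     x^z = g(x). By Kronecker's theorem, either some root has |x| > 1, which is
     witnessed by a power sum exceeding the degree and bounds |z|;
     or all roots are roots of unity. In the latter case, q has a multiple root,
     and differentiating X^z = g there bounds |z|; or q divides some X^h - 1, and
     then (X^h - 1) f1 is a torsion element, so that f1 is periodic. *)

Set Implicit Arguments.
Unset Strict Implicit.
Unset Printing Implicit Defensive.

Import Order.TTheory GRing.Theory Num.Theory.

(** * Recursive functions on numbers *)

(** Certificates separate existence from checking: bases, pivots and bounds come from classical
    minimality and pigeonhole arguments, and computability concerns only the verification. Every
    certificate is an existential statement over coded data about conditions that can be tested,
    with bounded universal quantifiers allowed. Two kinds of facts resist this form. That [q]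
    divides every element of [I] over Q becomes finite because a monic element of [I] reduces all
    the others to bounded degree, where they lie in a window lattice. That a root is large or
    multiple must be stated without algebraic numbers: an integer power sum, read off a polynomial
    remainder, stands for the former, and an integer polynomial dividing both [q] and [X] times its
    derivative for the latter. Over Z the ideal [I] need not be principal, so in general only an
    integer multiple of [q] annihilates [f1]; this is the source of the torsion in the periodic
    case. *)

(* Tuples are handled through their underlying sequences, so that arities
   need not be computed inside types. *)
Definition recn n (F : seq nat -> nat) := recursive (fun v : n.-tuple nat => F v).

Lemma recn_ext n (F G : seq nat -> nat) :
  (forall v : n.-tuple nat, F v = G v) -> recn n F -> recn n G.
Proof. by rewrite /recn => e; congr (recursive _); apply: funext. Qed.

Lemma recn_proj n i : i < n -> recn n (nth 0 ^~ i).
Proof.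
move=> lt_in; have := rec_proj (Ordinal lt_in); rewrite /recn.
congr (recursive _); apply: funext => v; exact: tnth_nth.
Qed.

Lemma recn_comp n (F : seq nat -> nat) (Gs : seq (seq nat -> nat)) :
  recn (size Gs) F -> (forall i, i < size Gs -> recn n (nth (fun=> 0) Gs i)) ->
  recn n (fun s => F [seq G s | G <- Gs]).
Proof.
move=> rF rG; have := rec_comp rF (fun i : 'I_(size Gs) => rG i (ltn_ord i)).
congr (recursive _); apply: funext => v; congr F.
apply: (@eq_from_nth _ 0); rewrite ?size_map -?enumT ?size_enum_ord // => i lt_i.
rewrite (nth_map (fun=> 0)) // (nth_map (Ordinal lt_i)) ?size_enum_ord //.
by rewrite nth_enum_ord.
Qed.

Lemma recn_prim n (F G : seq nat -> nat) : recn n F -> recn n.+2 G ->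
  recn n.+1 (fun s => nat_rec (fun=> nat) (F (behead s))
                        (fun k r => G [:: k, r & behead s]) (head 0 s)).
Proof. by move=> rF rG; apply: rec_prim rF rG _ _. Qed.

Lemma recn_mu n (F H : seq nat -> nat) : recn n.+1 F ->
  (forall v : n.-tuple nat, F (H v :: v) = 0) ->
  (forall (v : n.-tuple nat) k, k < H v -> F (k :: v) <> 0) -> recn n H.
Proof. by move=> rF F0 Fn0; apply: rec_mu rF F0 Fn0. Qed.

Definition rec1 (f : nat -> nat) := recn 1 (fun s => f (nth 0 s 0)).
Definition rec2 (f : nat -> nat -> nat) := recn 2 (fun s => f (nth 0 s 0) (nth 0 s 1)).

Lemma recn_comp1 n f G : rec1 f -> recn n G -> recn n (fun s => f (G s)).
Proof. by move=> rf rG; apply: (@recn_comp n _ [:: G]) rf _ => -[]. Qed.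

Lemma recn_comp2 n f G H :
  rec2 f -> recn n G -> recn n H -> recn n (fun s => f (G s) (H s)).
Proof. by move=> rf rG rH; apply: (@recn_comp n _ [:: G; H]) rf _ => -[|[]]. Qed.

Lemma rec1_S : rec1 S.
Proof.
have := rec_succ; rewrite /rec1 /recn; congr (recursive _); apply: funext => v.
by rewrite /thead (tnth_nth 0).
Qed.

Lemma recn_const n c : recn n (fun=> c).
Proof. by elim: c => [|c IHc]; [exact: rec_zero | exact: recn_comp1 rec1_S IHc]. Qed.

Lemma rec2_prim f g :
  rec1 f -> recn 3 (fun s => g (nth 0 s 0) (nth 0 s 1) (nth 0 s 2)) ->
  rec2 (fun k x => nat_rec (fun=> nat) (f x) (fun i r => g i r x) k).
Proof.
move=> rf rg; apply: recn_ext (recn_prim rf rg) => v.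
by case/tupleP: v => k v; case/tupleP: v.
Qed.

Ltac rec_auto := repeat (first [exact: recn_proj | exact: recn_const
  | apply: recn_comp1 rec1_S _ ]).

Lemma rec2_add : rec2 addn.
Proof.
apply: recn_ext (@rec2_prim id (fun _ r _ => r.+1) _ _) => [v||]; try by rec_auto.
by elim: (nth 0 v 0) => //= k ->.
Qed.

Lemma rec2_mul : rec2 muln.
Proof.
apply: recn_ext (@rec2_prim (fun=> 0) (fun _ r x => x + r) _ _) => [v||].
- by elim: (nth 0 v 0) => //= k ->; rewrite mulSn.
- exact: recn_const.
- by apply: recn_comp2 rec2_add _ _; rec_auto.
Qed.

Lemma rec1_pred : rec1 predn.
Proof.
have r : rec2 (fun k _ => k.-1).
  apply: recn_ext (@rec2_prim (fun=> 0) (fun i _ _ => i) _ _) => [v||]; try by rec_auto.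
  by case: (nth 0 v 0).
apply: (recn_comp2 r) (recn_const 1 0); exact: recn_proj.
Qed.

Lemma rec2_sub : rec2 subn.
Proof.
have r : rec2 (fun k x => x - k).
  apply: recn_ext (@rec2_prim id (fun _ r _ => r.-1) _ _) => [v||].
  - by elim: (nth 0 v 0) => [|k] /=; rewrite ?subn0 // => ->; rewrite subnS.
  - by rec_auto.
  - by apply: recn_comp1 rec1_pred _; rec_auto.
by apply: (recn_comp2 r); rec_auto.
Qed.

Lemma rec2_eqn : rec2 (fun x y => x == y).
Proof.
have r : rec2 (fun x y => 1 - ((x - y) + (y - x))).
  apply: recn_comp2 rec2_sub _ _; rec_auto.
  by apply: recn_comp2 rec2_add _ _; apply: recn_comp2 rec2_sub _ _; rec_auto.
apply: recn_ext r => v; case: eqP => [->|ne]; first by rewrite subnn.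
by have := ne; lia.
Qed.

(** [CodeSeq.code (a :: s)] is [2 ^ a * (2 * CodeSeq.code s + 1)]. The predecessor turns this into a
    bijection between pairs and numbers, so the code of a nonempty list is the successor of the pair
    of its head and the code of its tail. *)
Definition npair a b := (2 ^ a * b.*2.+1).-1.
Definition nfst n := head 0 (CodeSeq.decode n.+1).
Definition nsnd n := CodeSeq.code (behead (CodeSeq.decode n.+1)).

Lemma npairS a b : (npair a b).+1 = 2 ^ a * b.*2.+1.
Proof. by rewrite prednK // muln_gt0 expn_gt0. Qed.

Lemma npair_code a s : (npair a (CodeSeq.code s)).+1 = CodeSeq.code (a :: s).
Proof. exact: npairS. Qed.

Lemma npairK a b : (nfst (npair a b) = a) * (nsnd (npair a b) = b).
Proof.
rewrite /nfst /nsnd -[b]CodeSeq.decodeK npair_code CodeSeq.codeK /=.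
by rewrite CodeSeq.decodeK.
Qed.

Lemma unpairK n : npair (nfst n) (nsnd n) = n.
Proof.
apply: succn_inj; rewrite npair_code /nfst.
have := CodeSeq.decodeK n.+1.
by case: (CodeSeq.decode n.+1) => [|a s].
Qed.

Lemma leq_npair a b : (a <= npair a b) && (b <= npair a b).
Proof.
have lt_a := ltn_expl a (isT : 1 < 2); have e := npairS a b.
by apply/andP; split; nia.
Qed.

Lemma rec2_npair : rec2 npair.
Proof.
have r2 : rec1 (expn 2).
  have r : rec2 (fun k _ => 2 ^ k).
    apply: recn_ext (@rec2_prim (fun=> 1) (fun _ r _ => r + r) _ _) => [v||].
    - by elim: (nth 0 v 0) => //= k ->; rewrite expnS mul2n addnn.
    - by rec_auto.
    - by apply: recn_comp2 rec2_add _ _; rec_auto.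
  by apply: (recn_comp2 r) (recn_const 1 0); rec_auto.
have r : rec2 (fun a b => (2 ^ a * (b + b).+1).-1).
  apply: recn_comp1 rec1_pred _; apply: recn_comp2 rec2_mul _ _.
    by apply: recn_comp1 r2 _; rec_auto.
  by apply: recn_comp1 rec1_S _; apply: recn_comp2 rec2_add _ _; rec_auto.
by apply: recn_ext r => v; rewrite addnn.
Qed.

Lemma rec1_nsnd_of f : rec1 f -> (forall n, npair (f n) (nsnd n) = n) -> rec1 nsnd.
Proof.
move=> rf fK.
have r : recn 2 (fun s => 1 - (npair (f (nth 0 s 1)) (nth 0 s 0) == nth 0 s 1)).
  apply: recn_comp2 rec2_sub _ _; first exact: recn_const.
  apply: recn_comp2 rec2_eqn _ _; last by rec_auto.
  apply: recn_comp2 rec2_npair _ _; last by rec_auto.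
  by apply: recn_comp1 rf _; rec_auto.
apply: recn_mu r _ _ => /= [v|v k lt_k]; first by rewrite fK eqxx.
case: eqP => // e; suff ek : k = nsnd (nth 0 v 0) by rewrite ek ltnn in lt_k.
by rewrite -e npairK.
Qed.

(** At a bound [m], a product over [b < m] that vanishes exactly when some such [b] has
    [npair a b = n]. Minimization handles one unknown, so the search for the first component hides
    the second one in this bounded search; [leq_npair] supplies the bound. *)
Definition unpair_test a n :=
  nat_rec (fun=> nat) 1 (fun b r => (1 - (npair a b == n)) * r).

Lemma rec1_nfst : rec1 nfst.
Proof.
have r : recn 3 (fun s => unpair_test (nth 0 s 1) (nth 0 s 2) (nth 0 s 0)).
  have rG : recn 4
      (fun s => (1 - (npair (nth 0 s 2) (nth 0 s 0) == nth 0 s 3)) * nth 0 s 1).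
    apply: recn_comp2 rec2_mul _ _; last by rec_auto.
    apply: recn_comp2 rec2_sub _ _; first exact: recn_const.
    apply: recn_comp2 rec2_eqn _ _; last by rec_auto.
    by apply: recn_comp2 rec2_npair _ _; rec_auto.
  apply: recn_ext (recn_prim (recn_const 2 1) rG) => v.
  by case/tupleP: v => k v; case/tupleP: v => a v; case/tupleP: v.
have r2 : recn 2 (fun s => unpair_test (nth 0 s 0) (nth 0 s 1) (nth 0 s 1).+1).
  apply: (@recn_comp 2 _ [:: fun s => (nth 0 s 1).+1; nth 0 ^~ 0; nth 0 ^~ 1] r).
  by move=> [|[|[|i]]] //= _; rec_auto.
apply: recn_mu r2 _ _ => /= v.
  set n := nth 0 v 0.
  suff H m : nsnd n < m -> unpair_test (nfst n) n m = 0.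
    apply: (H n.+1); rewrite ltnS -{2}(unpairK n).
    by case/andP: (leq_npair (nfst n) (nsnd n)).
  elim: m => //= m IH; rewrite ltnS leq_eqVlt => /predU1P[<-|/IH ->]; last by rewrite muln0.
  by rewrite unpairK eqxx.
move=> k lt_k; set n := nth 0 v 0 in lt_k *.
have ne t : npair k t != n.
  by apply: contraTneq lt_k => <-; rewrite npairK ltnn.
have F1 m : unpair_test k n m = 1 by elim: m => //= m ->; rewrite (negPf (ne _)).
by rewrite F1 (negPf (ne _)).
Qed.

Lemma rec1_nsnd : rec1 nsnd.
Proof. exact: rec1_nsnd_of rec1_nfst unpairK. Qed.

Lemma rec1_ext f g : f =1 g -> rec1 f -> rec1 g.
Proof. by move=> e; apply: recn_ext => v; apply: e. Qed.

Lemma rec1_comp f g : rec1 f -> rec1 g -> rec1 (f \o g).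
Proof. exact: recn_comp1. Qed.

Lemma rec1_comp2 f g h : rec2 f -> rec1 g -> rec1 h -> rec1 (fun n => f (g n) (h n)).
Proof. exact: recn_comp2. Qed.

Lemma rec1_const c : rec1 (fun=> c).
Proof. exact: recn_const. Qed.

Lemma rec1_id : rec1 id.
Proof. exact: recn_proj. Qed.

Lemma rec1_if (b f g : nat -> nat) : rec1 b -> rec1 f -> rec1 g ->
  rec1 (fun n => if b n != 0 then f n else g n).
Proof.
move=> rb rf rg; have rb0 := rec1_comp2 rec2_eqn rb (rec1_const 0).
have r1 := rec1_comp2 rec2_mul (rec1_comp2 rec2_sub (rec1_const 1) rb0) rf.
apply: rec1_ext (rec1_comp2 rec2_add r1 (rec1_comp2 rec2_mul rb0 rg)) => n /=.
by case: (b n) => [|m]; rewrite /= ?mul1n ?mul0n ?addn0 ?add0n.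
Qed.

Lemma rec1_nat_rec (f g m : nat -> nat) : rec1 f -> rec1 g -> rec1 m ->
  rec1 (fun n => nat_rec (fun=> nat) (f n) (fun i r => g (npair (npair n i) r)) (m n)).
Proof.
move=> rf rg rm.
have r2 : recn 3 (fun s => npair (nth 0 s 2) (nth 0 s 0)).
  by apply: recn_comp2 rec2_npair _ _; exact: recn_proj.
have r3 := recn_comp1 rg (recn_comp2 rec2_npair r2 (@recn_proj 3 1 isT)).
exact: rec1_comp2 (rec2_prim (g := fun i r x => g (npair (npair x i) r)) rf r3) rm rec1_id.
Qed.

Lemma rec1_odd : rec1 odd.
Proof.
have rg : rec1 (fun n => nsnd n == 0).
  exact: rec1_comp2 rec2_eqn rec1_nsnd (rec1_const 0).
apply: rec1_ext (rec1_nat_rec (rec1_const 0) rg rec1_id) => n /=.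
by elim: {2 3}n => //= k ->; rewrite npairK; case: (odd k).
Qed.

Lemma rec1_half : rec1 half.
Proof.
have rg : rec1 (fun n => odd (nsnd (nfst n)) + nsnd n).
  apply: rec1_comp2 rec2_add _ rec1_nsnd.
  exact: rec1_comp rec1_odd (rec1_comp rec1_nsnd rec1_nfst).
apply: rec1_ext (rec1_nat_rec (rec1_const 0) rg rec1_id) => n /=.
by elim: {3 4}n => //= k ->; rewrite !npairK uphalf_half.
Qed.

(** Primitive recursion runs for a number of steps fixed in advance; the code of a list is at least
    its length and serves as that number. The state pairs the accumulator with the code of the rest
    and stays put once the rest is empty; the predecessor in [step] undoes the successor in
    [npair_code]. *)
Lemma rec1_foldl (a g s : nat -> nat) : rec1 a -> rec1 g -> rec1 s ->
  rec1 (fun n => foldl (fun r b => g (npair (npair n r) b)) (a n) (CodeSeq.decode (s n))).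
Proof.
move=> ra rg rs.
pose step x := let n := nfst (nfst x) in let st := nsnd x in
  if nsnd st != 0 then
    npair (g (npair (npair n (nfst st)) (nfst (nsnd st).-1))) (nsnd (nsnd st).-1)
  else st.
have r1 := rec1_comp rec1_nfst rec1_nsnd; have r2 := rec1_comp rec1_nsnd rec1_nsnd.
have r3 := rec1_comp rec1_pred r2.
have rstep : rec1 step.
  apply: rec1_if r2 _ rec1_nsnd.
  apply: rec1_comp2 rec2_npair _ (rec1_comp rec1_nsnd r3).
  apply: rec1_comp rg _; apply: rec1_comp2 rec2_npair _ (rec1_comp rec1_nfst r3).
  exact: rec1_comp2 rec2_npair (rec1_comp rec1_nfst rec1_nfst) r1.
have r0 := rec1_comp2 rec2_npair ra rs.
apply: rec1_ext (rec1_comp rec1_nfst (rec1_nat_rec r0 rstep rs)) => n /=.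
pose G r b := g (npair (npair n r) b); rewrite -/G; set c := s n; set x := a n.
have H m l y : nat_rec (fun=> nat) (npair y (CodeSeq.code l))
    (fun i r => step (npair (npair n i) r)) m
    = npair (foldl G y (take m l)) (CodeSeq.code (drop m l)).
  elim: m => [|m IH]; rewrite ?take0 ?drop0 //= {}IH /step !npairK.
  case: (ltnP m (size l)) => [lt_m|le_m]; last first.
    by rewrite !drop_oversize ?take_oversize //= ltnW.
  rewrite (drop_nth 0 lt_m) -npair_code /= !npairK (take_nth 0 lt_m).
  by rewrite -cats1 foldl_cat.
rewrite -{1}[c]CodeSeq.decodeK H npairK take_oversize //.
rewrite -{2}[c]CodeSeq.decodeK; elim: (CodeSeq.decode c) => //= b l IH.
apply: leq_trans (_ : (CodeSeq.code l).+1 <= _) => //; rewrite -npairS ltnS.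
by case/andP: (leq_npair b (CodeSeq.code l)).
Qed.

Lemma rec1_cons f g : rec1 f -> rec1 g ->
  rec1 (fun n => CodeSeq.code (f n :: CodeSeq.decode (g n))).
Proof.
move=> rf rg; apply: rec1_ext (rec1_comp rec1_S (rec1_comp2 rec2_npair rf rg)) => n /=.
by rewrite npairS CodeSeq.decodeK.
Qed.

Lemma rec1_rev : rec1 (fun n => CodeSeq.code (rev (CodeSeq.decode n))).
Proof.
have := rec1_foldl (rec1_const 0)
  (rec1_comp rec1_S (rec1_comp2 rec2_npair rec1_nsnd (rec1_comp rec1_nsnd rec1_nfst))) rec1_id.
apply: rec1_ext => n /=; rewrite -[0]/(CodeSeq.code [::]) /rev.
elim: (CodeSeq.decode _) [::] => //= b l IH t; by rewrite !npairK npair_code IH.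
Qed.

Lemma rec1_map f : rec1 f -> rec1 (fun n => CodeSeq.code (map f (CodeSeq.decode n))).
Proof.
move=> rf; have := rec1_foldl (rec1_const 0) (rec1_comp rec1_S (rec1_comp2 rec2_npair
  (rec1_comp rf rec1_nsnd) (rec1_comp rec1_nsnd rec1_nfst))) rec1_id.
move/(rec1_comp rec1_rev); apply: rec1_ext => n /=; rewrite -[0]/(CodeSeq.code [::]).
rewrite -[map f _]cat0s -[[::] in RHS]/(rev [::]).
elim: (CodeSeq.decode n) [::] => [|b l IH] t; first by rewrite CodeSeq.codeK cats0.
by rewrite /= !npairK npair_code IH rev_cons cat_rcons.
Qed.

(** * Computable functions between encoded types *)

(* [dec] is total but need not be injective. *)
Class Enc (A : Type) := MkEnc {
  enc : A -> nat; dec : nat -> A; encK : cancel enc dec;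
  rec1_encdec : rec1 (fun n => enc (dec n)) }.

Definition comput {A B} {eA : Enc A} {eB : Enc B} (f : A -> B) :=
  rec1 (fun n => enc (f (dec n))).

Instance enc_nat : Enc nat := @MkEnc nat id id (fun=> erefl) rec1_id.

Lemma enc_boolK : cancel nat_of_bool (fun n => n != 0).
Proof. by case. Qed.
Lemma enc_bool_rec : rec1 (fun n => n != 0).
Proof. by apply: rec1_ext (rec1_if rec1_id (rec1_const 1) (rec1_const 0)) => -[]. Qed.
Instance enc_bool : Enc bool := MkEnc enc_boolK enc_bool_rec.

Definition dec_int n : int := if odd n then Negz n./2 else Posz n./2.
Lemma enc_intK : cancel code_int dec_int.
Proof. by case=> n; rewrite /dec_int /code_int /= ?odd_double /= ?uphalf_double ?doubleK. Qed.
Lemma dec_intK : cancel dec_int code_int.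
Proof.
move=> n; rewrite /dec_int; case: ifP => o /=; rewrite -[RHS]odd_double_half o //.
Qed.
Instance enc_int : Enc int.
Proof. by apply: (MkEnc enc_intK); apply: rec1_ext rec1_id => n; rewrite dec_intK. Defined.

Lemma enc_prodK {A B} {eA : Enc A} {eB : Enc B} :
  cancel (fun x : A * B => npair (enc x.1) (enc x.2))
    (fun n => (dec (nfst n), dec (nsnd n))).
Proof. by case=> a b; rewrite !npairK (encK (Enc:=eA)) (encK (Enc:=eB)). Qed.
Instance enc_prod {A B} {eA : Enc A} {eB : Enc B} : Enc (A * B).
Proof.
apply: (MkEnc enc_prodK) => /=; apply: rec1_comp2 rec2_npair _ _.
  exact: rec1_comp rec1_encdec rec1_nfst.
exact: rec1_comp rec1_encdec rec1_nsnd.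
Defined.

Lemma enc_seqK {A} {eA : Enc A} : cancel (fun s : seq A => CodeSeq.code (map enc s))
  (fun n => map dec (CodeSeq.decode n)).
Proof. by move=> s; rewrite CodeSeq.codeK (mapK encK). Qed.
Instance enc_seq {A} {eA : Enc A} : Enc (seq A).
Proof.
apply: (MkEnc enc_seqK); apply: rec1_ext (rec1_map rec1_encdec) => n.
by rewrite -map_comp.
Defined.

Lemma rec1E {A B} {eA : Enc A} {eB : Enc B} (f : A -> B) :
  comput f -> rec1 (fun n => enc (f (dec n))).
Proof. by []. Qed.

Section Comput.
Context {E A B C : Type} {eE : Enc E} {eA : Enc A} {eB : Enc B} {eC : Enc C}.

Lemma comput_ext (f g : A -> B) : f =1 g -> comput f -> comput g.
Proof. by move=> e; apply: rec1_ext => n; rewrite e. Qed.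

Lemma comput_comp (f : A -> B) (g : E -> A) : comput f -> comput g -> comput (fun e => f (g e)).
Proof.
move=> rf rg; apply: rec1_ext (rec1_comp (rec1E rf) (rec1E rg)) => n /=.
by rewrite (encK (Enc:=eA)).
Qed.

Lemma comput_id : comput (fun x : A => x).
Proof. exact: rec1_encdec. Qed.

Lemma comput_const (b : B) : comput (fun _ : A => b).
Proof. exact: rec1_const. Qed.

Lemma comput_pair (f : E -> A) (g : E -> B) :
  comput f -> comput g -> comput (fun e => (f e, g e)).
Proof. exact: rec1_comp2 rec2_npair. Qed.

Lemma comput_fst (f : E -> A * B) : comput f -> comput (fun e => (f e).1).
Proof. by move=> rf; apply: rec1_ext (rec1_comp rec1_nfst (rec1E rf)) => n /=; rewrite npairK. Qed.

Lemma comput_snd (f : E -> A * B) : comput f -> comput (fun e => (f e).2).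
Proof. by move=> rf; apply: rec1_ext (rec1_comp rec1_nsnd (rec1E rf)) => n /=; rewrite npairK. Qed.

Lemma comput_nat2 f (g h : E -> nat) :
  rec2 f -> comput g -> comput h -> comput (fun e => f (g e) (h e)).
Proof. exact: rec1_comp2. Qed.

Lemma comput_if (b : E -> bool) (f g : E -> A) :
  comput b -> comput f -> comput g -> comput (fun e => if b e then f e else g e).
Proof.
move=> rb rf rg; apply: rec1_ext (rec1_if (rec1E rb) (rec1E rf) (rec1E rg)) => n /=.
by case: (b _).
Qed.

Lemma comput_iteri (a : E -> C) (f : E -> nat -> C -> C) (m : E -> nat) :
  comput a -> comput (fun x : E * nat * C => f x.1.1 x.1.2 x.2) -> comput m ->
  comput (fun e => iteri (m e) (f e) (a e)).
Proof.
move=> ra rf rm; apply: rec1_ext (rec1_nat_rec (rec1E ra) (rec1E rf) (rec1E rm)) => n /=.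
by elim: (m _) => //= k ->; rewrite !npairK (encK (Enc:=eC)).
Qed.

Lemma comput_foldl (a : E -> C) (f : E -> C -> B -> C) (s : E -> seq B) :
  comput a -> comput (fun x : E * C * B => f x.1.1 x.1.2 x.2) -> comput s ->
  comput (fun e => foldl (f e) (a e) (s e)).
Proof.
move=> ra rf rs; apply: rec1_ext (rec1_foldl (rec1E ra) (rec1E rf) (rec1E rs)) => n /=.
rewrite CodeSeq.codeK; elim: (s _) (a _) => //= b l IH c.
by rewrite !npairK (encK (Enc:=eC)) (encK (Enc:=eB)) IH.
Qed.

Lemma comput_cons (f : E -> A) (g : E -> seq A) :
  comput f -> comput g -> comput (fun e => f e :: g e).
Proof.
move=> rf rg; apply: rec1_ext (rec1_cons (rec1E rf) (rec1E rg)) => n /=.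
by rewrite CodeSeq.codeK.
Qed.

Lemma comput_rev (s : E -> seq A) : comput s -> comput (fun e => rev (s e)).
Proof.
move=> rs; apply: rec1_ext (rec1_comp rec1_rev (rec1E rs)) => n /=.
by rewrite CodeSeq.codeK map_rev.
Qed.

End Comput.

Lemma comput_comp2 {D E A B} {eD : Enc D} {eE : Enc E} {eA : Enc A} {eB : Enc B}
  (f : E -> A -> B) (g : D -> E) (h : D -> A) :
  comput (fun x => f x.1 x.2) -> comput g -> comput h -> comput (fun d => f (g d) (h d)).
Proof. by move=> rf rg rh; apply: (comput_comp rf (comput_pair rg rh)). Qed.

Section ComputOps.
Context {E A B : Type} {eE : Enc E} {eA : Enc A} {eB : Enc B}.
Implicit Types (b c : E -> bool) (m n : E -> nat).

Lemma comput_and b c : comput b -> comput c -> comput (fun e => b e && c e).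
Proof. by move=> rb rc; apply: (comput_if rb rc (comput_const false)). Qed.

Lemma comput_not b : comput b -> comput (fun e => ~~ b e).
Proof. by move=> rb; apply: (comput_if rb (comput_const false) (comput_const true)). Qed.

Lemma comput_eqn m n : comput m -> comput n -> comput (fun e => m e == n e).
Proof. exact: rec1_comp2 rec2_eqn. Qed.

Lemma comput_addn m n : comput m -> comput n -> comput (fun e => m e + n e).
Proof. exact: comput_nat2 rec2_add. Qed.

Lemma comput_muln m n : comput m -> comput n -> comput (fun e => m e * n e).
Proof. exact: comput_nat2 rec2_mul. Qed.

Lemma comput_subn m n : comput m -> comput n -> comput (fun e => m e - n e).
Proof. exact: comput_nat2 rec2_sub. Qed.

Lemma comput_S m : comput m -> comput (fun e => (m e).+1).
Proof. by move=> rm; apply: (rec1_comp rec1_S (rec1E rm)). Qed.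

Lemma comput_leq m n : comput m -> comput n -> comput (fun e => m e <= n e).
Proof. by move=> rm rn; apply: (comput_eqn (comput_subn rm rn) (comput_const 0)). Qed.

End ComputOps.

Section ComputSeq.
Context {E A B : Type} {eE : Enc E} {eA : Enc A} {eB : Enc B}.
Implicit Types (m n : E -> nat).

Lemma comput_expn m n : comput m -> comput n -> comput (fun e => m e ^ n e).
Proof.
move=> rm rn.
have r : comput (fun e => iteri (n e) (fun _ r => m e * r) 1).
  apply: (comput_iteri (f := fun e _ r => m e * r)) (comput_const 1) _ rn.
  apply: comput_muln; last by apply: comput_snd; apply: comput_id.
  by apply: (comput_comp rm); do 2!apply: comput_fst; apply: comput_id.
by apply: comput_ext r => e; elim: (n e) => //= k ->; rewrite expnS.
Qed.

Lemma comput_size (s : E -> seq A) : comput s -> comput (fun e => size (s e)).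
Proof.
move=> rs; have r : comput (fun e => foldl (fun k _ => k.+1) 0 (s e)).
  apply: (comput_foldl (f := fun _ k _ => k.+1)) (comput_const 0) _ rs.
  by apply: comput_S; apply: comput_snd; apply: comput_fst; apply: comput_id.
apply: comput_ext r => e; rewrite -[RHS]addn0.
by elim: (s e) 0 => //= _ l IH k; rewrite IH addnS addSn.
Qed.

Lemma comput_map (f : E -> A -> B) (s : E -> seq A) :
  comput (fun x : E * A => f x.1 x.2) -> comput s -> comput (fun e => [seq f e a | a <- s e]).
Proof.
move=> rf rs; have r : comput (fun e => rev (foldl (fun r a => f e a :: r) [::] (s e))).
  apply: comput_rev; apply: (comput_foldl (f := fun e r a => f e a :: r)) rs.
    exact: comput_const.
  apply: comput_cons; last by apply: comput_snd; apply: comput_fst; apply: comput_id.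
  apply: (comput_comp2 rf); last by apply: comput_snd; apply: comput_id.
  by do 2!apply: comput_fst; apply: comput_id.
apply: comput_ext r => e; rewrite -[RHS]cat0s -[[::] in RHS]/(rev [::]).
elim: (s e) [::] => [|a l IH] t /=; first by rewrite cats0.
by rewrite IH rev_cons cat_rcons.
Qed.

Lemma comput_cat (s t : E -> seq A) : comput s -> comput t -> comput (fun e => s e ++ t e).
Proof.
move=> rs rt; have r : comput (fun e => foldl (fun r a => a :: r) (t e) (rev (s e))).
  apply: (comput_foldl (f := fun _ r a => a :: r)) rt _ (comput_rev rs).
  apply: comput_cons; first by apply: comput_snd; apply: comput_id.
  by apply: comput_snd; apply: comput_fst; apply: comput_id.
apply: comput_ext r => e; rewrite -[in RHS](revK (s e)).
by elim: (rev (s e)) (t e) => //= a l IH u; rewrite IH rev_cons cat_rcons.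
Qed.

Lemma comput_all (p : E -> A -> bool) (s : E -> seq A) :
  comput (fun x : E * A => p x.1 x.2) -> comput s -> comput (fun e => all (p e) (s e)).
Proof.
move=> rp rs; have r : comput (fun e => foldl (fun r a => r && p e a) true (s e)).
  apply: (comput_foldl (f := fun e r a => r && p e a)) (comput_const true) _ rs.
  apply: comput_and; first by apply: comput_snd; apply: comput_fst; apply: comput_id.
  apply: (comput_comp2 rp); last by apply: comput_snd; apply: comput_id.
  by do 2!apply: comput_fst; apply: comput_id.
apply: comput_ext r => e; rewrite -[RHS]andTb.
by elim: (s e) true => //= [|a l IH] b; rewrite ?andbT // IH andbA.
Qed.

Lemma comput_iota m n : comput m -> comput n -> comput (fun e => iota (m e) (n e)).
Proof.
move=> rm rn; have r : comput (fun e => rev (iteri (n e) (fun k r => (m e + k) :: r) [::])).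
  apply: comput_rev; apply: (comput_iteri (f := fun e k r => (m e + k) :: r)) rn.
    exact: comput_const.
  apply: comput_cons; last by apply: comput_snd; apply: comput_id.
  apply: comput_addn; last by apply: comput_snd; apply: comput_fst; apply: comput_id.
  by apply: (comput_comp rm); do 2!apply: comput_fst; apply: comput_id.
apply: comput_ext r => e; elim: (n e) => //= k IH.
by rewrite rev_cons IH -[RHS]/(iota (m e) k.+1) -(addn1 k) iotaD cats1.
Qed.

Lemma comput_nth (x0 : A) (s : E -> seq A) n :
  comput s -> comput n -> comput (fun e => nth x0 (s e) (n e)).
Proof.
move=> rs rn; have r : comput (fun e =>
    (foldl (fun st a => (st.1.+1, if st.1 == n e then a else st.2)) (0, x0) (s e)).2).
  apply: comput_snd; apply: (comput_foldl
    (f := fun e st a => (st.1.+1, if st.1 == n e then a else st.2))) rs.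
    exact: comput_const.
  have r0 : comput (fun x : E * (nat * A) * A => x.1.2).
    by apply: comput_snd; apply: comput_fst; apply: comput_id.
  apply: comput_pair; first by apply: comput_S; apply: comput_fst.
  apply: comput_if; last by apply: comput_snd.
    apply: comput_eqn; first by apply: comput_fst.
    by apply: (comput_comp rn); do 2!apply: comput_fst; apply: comput_id.
  by apply: comput_snd; apply: comput_id.
apply: comput_ext r => e; set k := n e.
pose step (st : nat * A) a := (st.1.+1, if st.1 == k then a else st.2).
rewrite -/step; have H l i y : snd (foldl step (i, y) l) = if i <= k then nth y l (k - i) else y.
  elim: l i y => [|a l IH] i y /=; first by rewrite nth_nil if_same.
  rewrite {}IH /=; case: ltngtP => //= [lt_ik|->]; last by rewrite subnn.
  by rewrite -[k - i]prednK ?subn_gt0 //= subnS.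
by rewrite H subn0.
Qed.

End ComputSeq.

Lemma comput_flatten {E A} {eE : Enc E} {eA : Enc A} (s : E -> seq (seq A)) :
  comput s -> comput (fun e => flatten (s e)).
Proof.
move=> rs; have r : comput (fun e => foldl (fun r a => r ++ a) [::] (s e)).
  apply: (comput_foldl (f := fun _ r a => r ++ a)) rs; first exact: comput_const.
  apply: comput_cat; last by apply: comput_snd; apply: comput_id.
  by apply: comput_snd; apply: comput_fst; apply: comput_id.
apply: comput_ext r => e; rewrite -[RHS]cat0s.
by elim: (s e) [::] => [|a l IH] u /=; rewrite ?cats0 // IH catA.
Qed.

Lemma comput_eq {E} {A : eqType} {eE : Enc E} {eA : Enc A} (f g : E -> A) :
  comput f -> comput g -> comput (fun e => f e == g e).
Proof.
move=> rf rg; have r := rec1_comp2 rec2_eqn (rec1E rf) (rec1E rg).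
by apply: rec1_ext r => n /=; rewrite (inj_eq (can_inj encK)).
Qed.

(** An integer is the difference of these two numbers, so integer arithmetic reduces to sums and
    products of numbers followed by [comput_sub_Posz]. *)
Definition int_pos (z : int) : nat := if z is Posz n then n else 0.
Definition int_neg (z : int) : nat := if z is Negz n then n.+1 else 0.

Section ComputInt.
Context {E : Type} {eE : Enc E}.
Implicit Types (f g : E -> int) (m : E -> nat).

Lemma comput_int_pos f : comput f -> comput (fun e => int_pos (f e)).
Proof.
apply: comput_comp; have r := rec1_if rec1_odd (rec1_const 0) rec1_half.
by apply: rec1_ext r => n /=; rewrite /dec_int; case: (odd n).
Qed.

Lemma comput_int_neg f : comput f -> comput (fun e => int_neg (f e)).
Proof.
apply: comput_comp; have r := rec1_if rec1_odd (rec1_comp rec1_S rec1_half) (rec1_const 0).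
by apply: rec1_ext r => n /=; rewrite /dec_int; case: (odd n).
Qed.

Lemma comput_Posz m : comput m -> comput (fun e => Posz (m e)).
Proof.
move=> rm; apply: rec1_ext (rec1_comp2 rec2_add (rec1E rm) (rec1E rm)) => n /=.
by rewrite addnn.
Qed.

Lemma comput_Negz m : comput m -> comput (fun e => Negz (m e)).
Proof.
move=> rm; have r := rec1_comp rec1_S (rec1_comp2 rec2_add (rec1E rm) (rec1E rm)).
by apply: rec1_ext r => n /=; rewrite addnn.
Qed.

Lemma comput_sub_Posz (m n : E -> nat) :
  comput m -> comput n -> comput (fun e => (Posz (m e) - Posz (n e))%R).
Proof.
move=> rm rn; have r : comput (fun e => if n e <= m e then Posz (m e - n e)
    else Negz (n e - m e - 1)).
  apply: comput_if; first exact: comput_leq.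
    by apply: comput_Posz; apply: comput_subn.
  apply: comput_Negz; apply: comput_subn; last exact: comput_const.
  exact: comput_subn.
by apply: comput_ext r => e; case: leqP => ?; lia.
Qed.

Lemma comput_absz f : comput f -> comput (fun e => `|f e|%N).
Proof.
move=> rf; have r := comput_addn (comput_int_pos rf) (comput_int_neg rf).
by apply: comput_ext r => e; case: (f e) => n /=; lia.
Qed.

Lemma comput_addz f g : comput f -> comput g -> comput (fun e => (f e + g e)%R).
Proof.
move=> rf rg; have r := comput_sub_Posz
  (comput_addn (comput_int_pos rf) (comput_int_pos rg))
  (comput_addn (comput_int_neg rf) (comput_int_neg rg)).
by apply: comput_ext r => e; case: (f e) (g e) => n [] k /=; lia.
Qed.

Lemma comput_oppz f : comput f -> comput (fun e => (- f e)%R).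
Proof.
move=> rf; have r := comput_sub_Posz (comput_int_neg rf) (comput_int_pos rf).
by apply: comput_ext r => e; case: (f e) => n /=; lia.
Qed.

Lemma comput_mulz f g : comput f -> comput g -> comput (fun e => (f e * g e)%R).
Proof.
move=> rf rg; have [pf nf] := (comput_int_pos rf, comput_int_neg rf).
have [pg ng] := (comput_int_pos rg, comput_int_neg rg).
have r := comput_sub_Posz
  (comput_addn (comput_muln pf pg) (comput_muln nf ng))
  (comput_addn (comput_muln pf ng) (comput_muln nf pg)).
by apply: comput_ext r => e; case: (f e) (g e) => n [] k /=; rewrite ?NegzE; lia.
Qed.

Lemma comput_lez f g : comput f -> comput g -> comput (fun e => (f e <= g e)%R).
Proof.
move=> rf rg; have r := comput_leq
  (comput_addn (comput_int_pos rf) (comput_int_neg rg))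
  (comput_addn (comput_int_pos rg) (comput_int_neg rf)).
by apply: comput_ext r => e; case: (f e) (g e) => n [] k /=; lia.
Qed.

End ComputInt.

Section ComputIntOps.
Context {E : Type} {eE : Enc E}.

Lemma comput_sumz {A} {eA : Enc A} (h : E -> A -> int) (s : E -> seq A) :
  comput (fun x : E * A => h x.1 x.2) -> comput s ->
  comput (fun e => (\sum_(a <- s e) h e a)%R).
Proof.
move=> rh rs; have r : comput (fun e => foldl (fun r a => (r + h e a)%R) 0%R (s e)).
  apply: (comput_foldl (f := fun e r a => (r + h e a)%R)) (comput_const _) _ rs.
  apply: comput_addz; first by apply: comput_snd; apply: comput_fst; apply: comput_id.
  apply: (comput_comp2 rh); last by apply: comput_snd; apply: comput_id.
  by do 2!apply: comput_fst; apply: comput_id.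
apply: comput_ext r => e.
have H l (c : int) : foldl (fun r a => (r + h e a)%R) c l = (c + \sum_(a <- l) h e a)%R.
  by elim: l c => [|a l IH] c; rewrite ?big_nil ?addr0 //= big_cons IH addrA.
by rewrite H add0r.
Qed.

End ComputIntOps.

Ltac comput_step := first
  [ assumption | exact: comput_id | exact: comput_const
  | apply: comput_fst | apply: comput_snd | apply: comput_pair
  | apply: comput_and | apply: comput_not | apply: comput_if
  | apply: comput_addn | apply: comput_muln | apply: comput_subn | apply: comput_expn
  | apply: comput_S | apply: comput_leq
  | apply: comput_Posz | apply: comput_absz | apply: comput_addz | apply: comput_oppz
  | apply: comput_mulz | apply: comput_lez | apply: comput_sumz
  | apply: comput_size | apply: comput_map | apply: comput_cat | apply: comput_all
  | apply: comput_iota | apply: comput_nth | apply: comput_flatten | apply: comput_cons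
  | apply: comput_eq ].
Ltac comput_auto := repeat comput_step.

(** * Recursively enumerable predicates *)

Definition re {A} {eA : Enc A} (P : A -> Prop) :=
  exists2 f : A * nat -> bool, comput f & forall a, P a <-> exists n, f (a, n).

Section Re.
Context {A B C : Type} {eA : Enc A} {eB : Enc B} {eC : Enc C}.

Lemma re_ext (P Q : A -> Prop) : (forall a, P a <-> Q a) -> re P -> re Q.
Proof. by move=> e [f rf fP]; exists f => // a; rewrite -e. Qed.

Lemma re_comput (p : A -> bool) : comput p -> re p.
Proof.
move=> rp; exists (fun x => p x.1) => [|a]; last by split=> [pa|[]]; [exists 0|].
by apply: (comput_comp rp); comput_auto.
Qed.

Lemma re_comp (P : A -> Prop) (g : B -> A) : comput g -> re P -> re (fun b => P (g b)).
Proof.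
move=> rg [f rf fP]; exists (fun x => f (g x.1, x.2)) => [|b]; last exact: fP.
by apply: (comput_comp rf); comput_auto; apply: (comput_comp rg); comput_auto.
Qed.

Lemma re_and (P Q : A -> Prop) : re P -> re Q -> re (fun a => P a /\ Q a).
Proof.
move=> [f rf fP] [g rg gQ].
exists (fun x => f (x.1, (dec x.2 : nat * nat).1) &&
    g (x.1, (dec x.2 : nat * nat).2)) => [|a].
  have rd : comput (fun x : A * nat => dec x.2 : nat * nat).
    by apply: (@comput_comp _ nat _ _ _ _ dec); [exact: rec1_encdec|comput_auto].
  by comput_auto; [apply: (comput_comp rf)|apply: (comput_comp rg)]; comput_auto.
split=> [[/fP[m fm] /gQ[n gn]]|[n /andP[/= fm gn]]]; last first.
  by split; [apply/fP|apply/gQ]; eexists; eauto.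
by exists (enc (m, n)); rewrite (encK (m, n)) fm.
Qed.

Lemma re_or (P Q : A -> Prop) : re P -> re Q -> re (fun a => P a \/ Q a).
Proof.
move=> [f rf fP] [g rg gQ].
exists (fun x => ~~ (~~ f x && ~~ g x)) => [|a]; first by comput_auto; assumption.
rewrite fP gQ; split=> [[[n h]|[n h]]|[n]].
- by exists n; rewrite h.
- by exists n; rewrite h andbF.
by rewrite negb_and !negbK => /orP[]; [left|right]; exists n.
Qed.

Lemma re_ex (P : A -> B -> Prop) :
  re (fun x : A * B => P x.1 x.2) -> re (fun a => exists b, P a b).
Proof.
move=> [f rf fP]; pose d := @dec _ (@enc_prod _ _ enc_nat enc_nat).
exists (fun x => f ((x.1, dec (d x.2).1), (d x.2).2)) => [|a].
  have rd : comput (fun x : A * nat => d x.2).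
    by apply: (@comput_comp _ nat _ _ _ _ d); [exact: rec1_encdec|comput_auto].
  apply: (comput_comp rf); comput_auto => //.
  by apply: (@comput_comp _ nat _ _ _ _ dec); [exact: rec1_encdec|comput_auto; exact: rd].
split=> [[b /(fP (a, b))[n fn]]|[n /= fn]].
  by exists (enc (enc b, n)); rewrite /d (encK (enc b, n)) /= encK.
by exists (dec (d n).1); apply/(fP (a, _)); exists (d n).2.
Qed.

(** The witnesses for the finitely many [i] are packed into the code of one list, which turns the
    bounded universal quantifier into a single existential one. *)
Lemma re_all (P : A -> nat -> Prop) (m : A -> nat) : comput m ->
  re (fun x : A * nat => P x.1 x.2) -> re (fun a => forall i, i < m a -> P a i).
Proof.
move=> rm [f rf fP].
exists (fun x => all (fun i => f ((x.1, i), nth 0 (dec x.2) i)) (iota 0 (m x.1))) => [|a].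
  apply: (comput_all (p := fun x i => f ((x.1, i), nth 0 (dec x.2) i))).
    have rd : comput (fun x : A * nat * nat => dec x.1.2 : seq nat).
      by apply: (@comput_comp _ nat _ _ _ _ dec); [exact: rec1_encdec|comput_auto].
    by apply: (comput_comp rf); comput_auto.
  apply: comput_iota; first exact: comput_const.
  by apply: (comput_comp rm); comput_auto.
split=> [H|[n /allP H] i lt_im]; last first.
  by apply/(fP (a, i)); exists (nth 0 (dec n) i); apply: H; rewrite mem_iota.
have /choice[g gP] : forall i, exists n, i < m a -> f ((a, i), n).
  move=> i; case: (ltnP i (m a)) => [lt_i|_]; last by exists 0.
  by have /(fP (a, i))[n fn] := H i lt_i; exists n.
exists (enc (mkseq g (m a))); rewrite (encK (mkseq g (m a))).
by apply/allP=> i; rewrite mem_iota => /= lt_i; rewrite nth_mkseq // gP.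
Qed.

End Re.

(* Post's theorem, with the answer found by minimization. *)
Lemma re_decidable (P Q : nat -> Prop) : re P -> re Q ->
  (forall n, P n \/ Q n) -> (forall n, P n -> ~ Q n) ->
  exists2 chi, rec1 chi & forall n, (P n -> chi n = 1) /\ (~ P n -> chi n = 0).
Proof.
move=> [f rf fP] [g rg gQ] PQ PnQ.
have ex n : exists k, f (n, k) || g (n, k).
  by case: (PQ n) => [/fP[k h]|/gQ[k h]]; exists k; rewrite h ?orbT.
pose h n := ex_minn (ex n).
have rh : rec1 h.
  have r : recn 2 (fun s => (~~ f (nth 0 s 1, nth 0 s 0) && ~~ g (nth 0 s 1, nth 0 s 0))).
    have r2 := recn_comp2 rec2_npair (@recn_proj 2 1 isT) (@recn_proj 2 0 isT).
    have rr : comput (fun x : nat * nat => ~~ f x && ~~ g x) by comput_auto; assumption.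
    by apply: recn_ext (recn_comp1 (rec1E rr) r2) => v /=; rewrite !npairK.
  apply: recn_mu r _ _ => /= [v|v k lt_k]; rewrite -negb_or.
    by rewrite /h; case: ex_minnP => k ->.
  move: lt_k; rewrite /h; case: ex_minnP => m _ min_m lt_k.
  by case: (boolP (_ || _)) => // /min_m; rewrite leqNgt lt_k.
exists (fun n => f (n, h n)) => [|n].
  have r := rec1_comp2 rec2_npair rec1_id rh.
  by apply: rec1_ext (rec1_comp (rec1E rf) r) => n /=; rewrite !npairK.
rewrite /h; case: ex_minnP => k fg _; split=> [Pn|nP].
  case/orP: fg => [->//|gk]; case: (PnQ n Pn); apply/gQ; by exists k.
by case E: (f (n, k)) => //; case: nP; apply/fP; exists k.
Qed.

Local Open Scope ring_scope.

(** * Sparse vectors *)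

(* [(c, (e, j))] stands for [c * X^e] times the [j]-th basis vector. *)
Notation pos := (int * nat)%type.
Notation svec := (seq (int * (int * nat))).
Notation vec := (int * nat -> int).

Definition sh (k : int) (u : vec) : vec := fun p => u (p.1 - k, p.2).

Definition cf (s : svec) : vec := fun p => \sum_(t <- s) if t.2 == p then t.1 else 0.

Definition scl (c k : int) (s : svec) : svec :=
  [seq (c * t.1, (t.2.1 + k, t.2.2)) | t <- s].

(* The combination [\sum c * X^k * G`_i] over the [(c, (k, i))] in [w]. *)
Definition comb (G : seq svec) (w : svec) : svec :=
  flatten [seq scl t.1 t.2.1 (nth [::] G t.2.2) | t <- w].

Lemma mulzfE (u : vec) c p : (u *~ c) p = u p * c.
Proof. by case: c => n; rewrite /intmul natmulfctE -mulrzz. Qed.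

Lemma sh0v u : sh 0 u = u.
Proof. by apply: funext => -[e j]; rewrite /sh subr0. Qed.

Lemma sh_sh k l u : sh k (sh l u) = sh (k + l) u.
Proof. by apply: funext => -[e j]; rewrite /sh /= opprD addrA. Qed.

Lemma eq_sh k l u : k = l -> sh k u = sh l u.
Proof. by move->. Qed.

Lemma shB k u v : sh k (u - v) = sh k u - sh k v.
Proof. by []. Qed.

Lemma shD k u v : sh k (u + v) = sh k u + sh k v.
Proof. by []. Qed.

Lemma sh_mulz k u c : sh k (u *~ c) = sh k u *~ c.
Proof. by apply: funext => p; rewrite mulzfE /sh mulzfE. Qed.

Lemma sh_eq0 k u : (sh k u = 0) <-> (u = 0).
Proof.
split=> [e|->] //; rewrite -[u]sh0v -(addNr k) -sh_sh e.
by apply: funext.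
Qed.

Lemma cf_nil : cf [::] = 0.
Proof. by apply: funext => p; rewrite /cf big_nil. Qed.

Lemma cf_cat s t : cf (s ++ t) = cf s + cf t.
Proof. by apply: funext => p; rewrite /cf big_cat. Qed.

Lemma cf_cons t s : cf (t :: s) = cf [:: t] + cf s.
Proof. exact: (cf_cat [:: t]). Qed.

Lemma cf_scl c k s : cf (scl c k s) = sh k (cf s) *~ c.
Proof.
apply: funext => -[e j]; rewrite mulzfE /sh /cf big_map mulr_suml.
apply: eq_bigr => -[a [e' j']] _ /=; rewrite !xpair_eqE.
have -> : (e' + k == e) = (e' == e - k) by apply/eqP/eqP; lia.
by case: ifP; rewrite ?mul0r // mulrC.
Qed.

Lemma comb_cons G t w : comb G (t :: w) = scl t.1 t.2.1 (nth [::] G t.2.2) ++ comb G w.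
Proof. by []. Qed.

Lemma comb_cat G w w' : comb G (w ++ w') = comb G w ++ comb G w'.
Proof. by rewrite /comb map_cat flatten_cat. Qed.

Lemma cf_comb_scl G c k w : cf (comb G (scl c k w)) = sh k (cf (comb G w)) *~ c.
Proof.
elim: w => [|t w IH]; first by rewrite cf_nil (sh_eq0 k 0).2 // mul0rz.
rewrite comb_cons cf_cat shD mulrzDl -IH /= comb_cons cf_cat; congr (_ + _).
by rewrite !cf_scl /= addrC -sh_sh sh_mulz mulrC mulrzA.
Qed.

(** * Subgroups and spans *)

Definition sg (S : vec -> Prop) := S 0 /\ forall u v, S u -> S v -> S (u - v).

Section Subgroup.
Variables (S : vec -> Prop) (sgS : sg S).

Lemma sgN u : S u -> S (- u).
Proof. by move=> Su; rewrite -sub0r; apply: sgS.2 => //; apply: sgS.1. Qed.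

Lemma sgD u v : S u -> S v -> S (u + v).
Proof. by move=> Su Sv; rewrite -[v]opprK; apply: sgS.2 => //; apply: sgN. Qed.

Lemma sgZ u c : S u -> S (u *~ c).
Proof.
have H n v : S v -> S (v *+ n).
  move=> Sv; elim: n => [|n IH]; first by rewrite mulr0n; apply: sgS.1.
  by rewrite mulrS; apply: sgD.
by move=> Su; case: c => n; [apply: H | rewrite NegzE mulrNz; apply: sgN; apply: H].
Qed.

End Subgroup.

(** The predicate [K] on the exponents of the multipliers selects the scalars: all exponents give
    Z[X, X^-1], the exponent 0 alone gives Z, and nonpositive exponents give Z[X^-1]. *)
Definition lspan (K : pred int) (G : seq svec) (u : vec) :=
  exists2 w, all (fun t => K t.2.1) w & u = cf (comb G w).
Notation rspan := (lspan predT).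
Notation zspan := (lspan (pred1 0)).
Notation nspan := (lspan (fun k => k <= 0)).

Section Span.
Variables (K : pred int) (G : seq svec).

Lemma span_sg : sg (lspan K G).
Proof.
split=> [|u v [w Kw ->] [w' Kw' ->]]; first by exists [::] => //; rewrite cf_nil.
exists (w ++ scl (-1) 0 w').
  by rewrite all_cat Kw all_map /=; apply: sub_all Kw' => t /=; rewrite addr0.
by rewrite comb_cat cf_cat cf_comb_scl sh0v mulrNz.
Qed.

Lemma span_gen k b : K k -> b \in G -> lspan K G (sh k (cf b)).
Proof.
move=> Kk bG; exists [:: (1, (k, index b G))]; first by rewrite /= Kk.
by rewrite comb_cons cats0 cf_scl nth_index.
Qed.

Lemma span_min (S : vec -> Prop) : sg S ->
  (forall k b, K k -> b \in G -> S (sh k (cf b))) -> forall u, lspan K G u -> S u.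
Proof.
move=> sgS SG u [w Kw ->]; elim: w Kw => [_|[c [k i]] w IH /= /andP[Kk Kw]].
  by rewrite cf_nil; apply: sgS.1.
rewrite comb_cons cf_cat; apply: sgD (IH Kw) => //; rewrite cf_scl; apply: sgZ => //=.
case: (ltnP i (size G)) => [lt_i|le_i]; first by apply: SG; rewrite ?mem_nth.
by rewrite nth_default // cf_nil (sh_eq0 k 0).2 //; apply: sgS.1.
Qed.

End Span.

Lemma span_sub (K K' : pred int) (G G' : seq svec) :
  (forall k b, K k -> b \in G -> lspan K' G' (sh k (cf b))) ->
  forall u, lspan K G u -> lspan K' G' u.
Proof. by apply: span_min; apply: span_sg. Qed.

Lemma span_sh (K : pred int) G k u :
  (forall l, K l -> K (k + l)) -> lspan K G u -> lspan K G (sh k u).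
Proof.
move=> KD; apply: (@span_min _ _ (fun u => lspan K G (sh k u))).
  split=> [|v v']; first by rewrite (sh_eq0 k 0).2 //; apply: (span_sg K G).1.
  by rewrite shB; apply: (span_sg K G).2.
by move=> l b Kl bG; rewrite sh_sh; apply: span_gen; first exact: KD.
Qed.

Lemma zspan_gen G b : b \in G -> zspan G (cf b).
Proof. by move=> bG; rewrite -[cf b]sh0v; apply: span_gen => /=. Qed.

Lemma zspan_min G (S : vec -> Prop) : sg S -> (forall b, b \in G -> S (cf b)) ->
  forall u, zspan G u -> S u.
Proof. by move=> sgS SG; apply: span_min => // k b /eqP -> bG; rewrite sh0v; apply: SG. Qed.

(** * Additive functionals and equality of sparse vectors *)

Definition lin (A : zmodType) (phi : pos -> A) (s : svec) : A := \sum_(t <- s) phi t.2 *~ t.1.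

Section Lin.
Variables (A : zmodType) (phi : pos -> A).

Lemma lin_nil : lin phi [::] = 0.
Proof. exact: big_nil. Qed.

Lemma lin_cat s t : lin phi (s ++ t) = lin phi s + lin phi t.
Proof. exact: big_cat. Qed.

Lemma lin_cons t s : lin phi (t :: s) = phi t.2 *~ t.1 + lin phi s.
Proof. exact: big_cons. Qed.

Lemma linE s (r : seq pos) : uniq r -> {subset map snd s <= r} ->
  lin phi s = \sum_(p <- r) phi p *~ cf s p.
Proof.
move=> ur; elim: s => [|[c q] s IH] sub.
  by rewrite lin_nil big1 // => p _; rewrite cf_nil mulr0z.
rewrite lin_cons IH; last by move=> p ps; apply: sub; rewrite inE ps orbT.
under [RHS]eq_bigr => p _ do rewrite cf_cons mulrzDr.
rewrite big_split /=; congr (_ + _).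
have qr : q \in r by apply: sub; rewrite inE eqxx.
rewrite (bigD1_seq q) //= /cf big_seq1 eqxx big1 ?addr0 // => p /negPf np.
by rewrite big_seq1 /= eq_sym np mulr0z.
Qed.

(** Grouping the entries by position shows that [lin] sees only the coefficients, hence is well
    defined on vectors. It is used with Laurent monomials as [phi], in [value]. *)
Lemma lin_ext s t : cf s = cf t -> lin phi s = lin phi t.
Proof.
move=> e; pose r := undup (map snd (s ++ t)).
have sub u : {subset u <= s ++ t} -> {subset map snd u <= r}.
  by move=> h p /mapP[x /h xu ->]; rewrite mem_undup map_f.
rewrite !(@linE _ r) ?undup_uniq ?e //; apply: sub => x; rewrite mem_cat => ->//.
by rewrite orbT.
Qed.

End Lin.

(** Both coefficient functions vanish off the listed positions, so finitely many comparisons decide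
    their equality. *)
Definition eqv (s t : svec) := all (fun q => cf s q.2 == cf t q.2) (s ++ t).

Lemma cf_notin s p : p \notin map snd s -> cf s p = 0.
Proof.
move=> ns; rewrite /cf big_seq big1 // => t ts.
by case: eqP => // e; rewrite -e map_f in ns.
Qed.

Lemma eqvP s t : reflect (cf s = cf t) (eqv s t).
Proof.
apply: (iffP allP) => [H|-> //]; apply: funext => p.
case: (boolP (p \in map snd (s ++ t))) => [/mapP[q qst ->]|]; first exact/eqP/H.
by rewrite map_cat mem_cat negb_or => /andP[ns nt]; rewrite !cf_notin.
Qed.

(** * Computability of the operations on sparse vectors *)

Section SvecComput.
Context {E : Type} {eE : Enc E}.

Lemma comput_cf (s : E -> svec) (p : E -> pos) :
  comput s -> comput p -> comput (fun e => cf (s e) (p e)).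
Proof.
move=> rs rp; rewrite /cf.
apply: (comput_sumz (h := fun e t => if t.2 == p e then t.1 else 0)) rs.
by have rp' := comput_comp rp (comput_fst comput_id); comput_auto.
Qed.

Lemma comput_scl (c k : E -> int) (s : E -> svec) :
  comput c -> comput k -> comput s -> comput (fun e => scl (c e) (k e) (s e)).
Proof.
move=> rc rk rs; rewrite /scl.
apply: (comput_map (f := fun e t => (c e * t.1, (t.2.1 + k e, t.2.2)))) rs.
have rc' := comput_comp rc (comput_fst comput_id).
by have rk' := comput_comp rk (comput_fst comput_id); comput_auto.
Qed.

End SvecComput.

Section SvecComputOps.
Context {E : Type} {eE : Enc E}.

Lemma comput_comb (G : E -> seq svec) (w : E -> svec) :
  comput G -> comput w -> comput (fun e => comb (G e) (w e)).
Proof.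
move=> rG rw; rewrite /comb; apply: comput_flatten.
apply: (comput_map (f := fun e t => scl t.1 t.2.1 (nth [::] (G e) t.2.2))) rw.
have rG' := comput_comp rG (comput_fst comput_id).
by apply: comput_scl; comput_auto.
Qed.

Lemma comput_eqv (s t : E -> svec) :
  comput s -> comput t -> comput (fun e => eqv (s e) (t e)).
Proof.
move=> rs rt; rewrite /eqv.
apply: (comput_all (p := fun e q => cf (s e) q.2 == cf (t e) q.2)); last by comput_auto.
have rs' := comput_comp rs (comput_fst comput_id).
have rt' := comput_comp rt (comput_fst comput_id).
by apply: comput_eq; apply: comput_cf => //; comput_auto.
Qed.

End SvecComputOps.

(** * Triangular bases of lattices *)

(** Echelon form over Z: [x.1] is the pivot position of [x.2], and all later vectors vanish there.
    It is a boolean because certificates have it checked. *)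
Definition tri (B : seq (pos * svec)) :=
  all (fun i => let x := nth (0, 0%N, [::]) B i in (cf x.2 x.1 != 0) &&
    all (fun j => (j <= i)%N || (cf (nth (0, 0%N, [::]) B j).2 x.1 == 0)) (iota 0 (size B)))
  (iota 0 (size B)).

Lemma triP B : reflect (forall i, (i < size B)%N ->
    let x := nth (0, 0%N, [::]) B i in cf x.2 x.1 != 0 /\
    forall j, (i < j < size B)%N -> cf (nth (0, 0%N, [::]) B j).2 x.1 = 0) (tri B).
Proof.
apply: (iffP allP) => H i.
  move=> lt_i; have := H i; rewrite mem_iota lt_i => /(_ isT)/= /andP[-> /allP Hj].
  split=> // j /andP[lt_ij lt_j]; have := Hj j; rewrite mem_iota lt_j => /(_ isT).
  by rewrite leqNgt lt_ij => /eqP.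
rewrite mem_iota => lt_i; have [nz Hj] := H i lt_i; rewrite /= nz.
apply/allP => j; rewrite mem_iota => lt_j.
by case: leqP => //= lt_ij; apply/eqP/Hj; rewrite lt_ij.
Qed.

Lemma tri_cons x B : tri (x :: B) <->
  [/\ cf x.2 x.1 != 0, forall y, y \in B -> cf y.2 x.1 = 0 & tri B].
Proof.
split=> [/triP H|[nz H /triP HB]].
  split; first by have [] := H 0%N isT.
    move=> y /(nthP (0, 0%N, [::]))[j lt_j <-]; have [_ H0] := H 0%N isT.
    exact: (H0 j.+1).
  apply/triP => i lt_i; have [//|nz Hj] := H i.+1; split=> // j ij; exact: (Hj j.+1).
apply/triP => -[_|i lt_i] /=; first by split=> // -[|j] //= lt_j; apply: H; rewrite mem_nth.
by have [nzi Hj] := HB i lt_i; split=> // -[|j] //=; apply: Hj.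
Qed.

Lemma zspan_consE b B u : zspan (b :: B) u -> exists c u', u = cf b *~ c + u' /\ zspan B u'.
Proof.
apply: (@zspan_min _ (fun u => exists c u', u = cf b *~ c + u' /\ zspan B u')).
  split=> [|_ _ [c [u' [-> Bu]]] [d [v' [-> Bv]]]].
    by exists 0, 0; rewrite mulr0z addr0; split=> //; apply: (span_sg _ B).1.
  exists (c - d), (u' - v'); split; last exact: (span_sg _ B).2.
  by rewrite mulrzBr opprD addrACA.
move=> y; rewrite inE => /predU1P[->|yB].
  by exists 1, 0; rewrite addr0; split=> //; apply: (span_sg _ B).1.
by exists 0, (cf y); rewrite mulr0z add0r; split=> //; apply: zspan_gen.
Qed.

(** At the pivot of the first vector all other generators vanish, so a combination that is zero
    there does not involve that vector. Induction strips off all of [B1]. *)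
Lemma tri_zspan (Z : pred pos) B1 B2 u : tri B1 -> (forall x, x \in B1 -> Z x.1) ->
  (forall b p, b \in B2 -> Z p -> cf b p = 0) ->
  zspan (map snd B1 ++ B2) u -> (forall p, Z p -> u p = 0) -> zspan B2 u.
Proof.
move=> + + Z2; elim: B1 u => [|x B1 IH] u //= /tri_cons[nz x0 tB] ZB.
move=> /zspan_consE[c [u' [-> Bu]]] u0.
have Zx : Z x.1 by apply: ZB; rewrite inE eqxx.
have u'0 : u' x.1 = 0.
  have sg0 : sg (fun v => v x.1 = 0) by split=> // v w; rewrite -[(v - w) _]/(v _ - w _) => -> ->.
  apply: (zspan_min sg0) Bu => b; rewrite mem_cat => /orP[/mapP[y yB ->]|b2]; first exact: x0.
  exact: Z2.
have c0 : c = 0.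
  have := u0 _ Zx; rewrite -[(_ + _) _]/(_ _ + _ _) u'0 addr0 mulzfE => /eqP.
  by rewrite mulf_eq0 (negPf nz) => /eqP.
rewrite c0 mulr0z add0r in u0 *; apply: IH => // y yB; apply: ZB; by rewrite inE yB orbT.
Qed.

(** The values at [p] form a subgroup of Z, generated by any nonzero value of least absolute value,
    since a nonzero Euclidean remainder would be smaller still. *)
Lemma pivot (L : vec -> Prop) p : sg L -> (exists2 l, L l & l p != 0) ->
  exists b, [/\ L b, b p != 0 & forall l, L l -> exists k, l p = k * b p].
Proof.
move=> sgL [l0 Ll0 nz0].
pose Q n := `[< exists l, [/\ L l, l p != 0 & `|l p|%N = n] >].
have exQ : exists n, Q n by exists `|l0 p|%N; apply/asboolP; exists l0.
case: (ex_minnP exQ) => m /asboolP[b [Lb nzb <-]] min_b; exists b; split=> // l Ll.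
exists (l p %/ b p)%Z; have e := divz_eq (l p) (b p).
suff -> : l p = (l p %/ b p)%Z * b p + 0 by rewrite addr0 mulzK.
rewrite {1}e; congr (_ + _); apply/eqP; apply: contraTT isT => nzr.
have /min_b : Q `|(l p %% b p)%Z|%N.
  apply/asboolP; exists (l - b *~ (l p %/ b p)%Z); split.
  - by apply: sgL.2 => //; apply: sgZ.
  - by rewrite -[(_ - _) _]/(_ _ - _ _) mulzfE mulrC {1}e addrC addKr.
  - by rewrite -[(_ - _) _]/(_ _ - _ _) mulzfE mulrC {1}e addrC addKr.
have := ltz_mod (l p) nzb; have := modz_ge0 (l p) nzb; lia.
Qed.

(** Checks such as [in_win] inspect the entries of the list itself, so the vectors of a certificate
    must not list positions whose total coefficient is zero. *)
Definition nf (s : svec) : svec :=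
  [seq (cf s p, p) | p <- undup (map snd s) & cf s p != 0].

Lemma cf_nf s : cf (nf s) = cf s.
Proof.
apply: funext => p; rewrite {1}/cf big_map big_filter big_mkcond /=.
case: (boolP (p \in undup (map snd s))) => ps.
  rewrite (bigD1_seq p) ?undup_uniq //= eqxx big1 => [|q /negPf ->]; last by rewrite if_same.
  by rewrite addr0; case: eqP.
rewrite big_seq big1 => [|q qs]; first by rewrite cf_notin // -mem_undup.
by case: (q =P p) => [e|]; [rewrite -e qs in ps|rewrite if_same].
Qed.

Lemma mem_nf s t : t \in nf s -> cf s t.2 != 0.
Proof. by case/mapP=> p; rewrite mem_filter => /andP[nz _] ->. Qed.

(** Elimination one position at a time: a multiple of the pivot clears the coordinate [p], and the
    elements of [L] vanishing at [p] form a subgroup to which induction applies. *)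
Lemma tri_basis (S : seq pos) (L : vec -> Prop) : sg L -> (forall l, L l -> exists s, l = cf s) ->
  exists B : seq (pos * svec), [/\ tri B,
    forall x, x \in B -> x.1 \in S /\ L (cf x.2) &
    forall l, L l -> exists2 c, zspan (map snd B) c & forall p, p \in S -> (l - c) p = 0].
Proof.
elim: S L => [|p S IH] L sgL finL.
  by exists [::]; split=> // l _; exists 0 => //; apply: (span_sg _ [::]).1.
case: (EM (exists2 l, L l & l p != 0)) => [/(pivot sgL)[b [Lb nzb bdvd]]|no].
  pose L' l := L l /\ l p = 0.
  have sgL' : sg L'.
    split=> [|u v [Lu u0] [Lv v0]]; first by split=> //; apply: sgL.1.
    by split; [apply: sgL.2 | rewrite -[(_ - _) _]/(_ _ - _ _) u0 v0].
  have [l [] /finL//|B [tB SB genB]] := IH L' sgL'.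
  have [s es] := finL b Lb.
  exists ((p, s) :: B); split.
  - by apply/tri_cons; split; rewrite -?es // => y /SB[_ []].
  - move=> x; rewrite inE => /predU1P[->|/SB[xS [Lx _]]]; rewrite inE ?eqxx ?xS ?orbT //.
    by rewrite -es.
  move=> l Ll; have [k ek] := bdvd l Ll.
  have Ll' : L' (l - b *~ k).
    split; first by apply: sgL.2 => //; apply: sgZ.
    by rewrite -[(_ - _) _]/(_ _ - _ _) mulzfE ek mulrC subrr.
  have [c Bc c0] := genB _ Ll'; exists (b *~ k + c).
    have sgB := span_sg (pred1 0) (map snd ((p, s) :: B)); apply: (sgD sgB).
      by rewrite es; apply: (sgZ sgB); apply: zspan_gen; rewrite inE eqxx.
    apply: (@zspan_min (map snd B)) Bc => // y yB; apply: zspan_gen; by rewrite inE yB orbT.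
  move=> q; rewrite inE opprD addrA => /predU1P[->|/c0 //].
  have c'0 : c p = 0.
    have sg0 : sg (fun v => v p = 0) by split=> // v w; rewrite -[(v - w) _]/(v _ - w _) => -> ->.
    by apply: (zspan_min sg0) Bc => _ /mapP[y /SB[_ [_ ?]] ->].
  by rewrite -[(_ - _) _]/(_ _ - _ _) Ll'.2 c'0.
have [//|//|B [tB SB genB]] := IH L.
exists B; split=> // [x /SB[xS Lx]|l Ll]; first by rewrite inE xS orbT.
have [c Bc c0] := genB l Ll; exists c => // q; rewrite inE => /predU1P[->|/c0 //].
have Lp0 v : L v -> v p = 0.
  by move=> Lv; apply/eqP; apply: contra_notT no => nz; exists v.
apply: Lp0; apply: sgL.2 => //; apply: (zspan_min sgL) Bc => _ /mapP[y /SB[_ Ly] -> //].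
Qed.

(** Two eliminations: the first has its pivots in [S1], the second treats the elements of [L] that
    vanish on [S1]. By [tri_zspan], [B2] then spans exactly these elements. *)
Lemma split_basis (S1 S2 : seq pos) (L : vec -> Prop) : sg L ->
  (forall l, L l -> exists s, l = cf s) ->
  (forall l p, L l -> p \notin S1 -> p \notin S2 -> l p = 0) ->
  exists B1 B2, [/\ tri B1, forall x, x \in B1 -> x.1 \in S1,
    forall b p, b \in B2 -> p \in S1 -> cf b p = 0,
    forall b, b \in map snd B1 ++ B2 -> L (cf b) /\ forall t, t \in b -> cf b t.2 != 0 &
    forall l, L l -> zspan (map snd B1 ++ B2) l].
Proof.
move=> sgL finL suppL; have [B [tB SB genB]] := tri_basis S1 sgL finL.
pose L2 l := L l /\ forall p, p \in S1 -> l p = 0.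
have sgL2 : sg L2.
  split=> [|u v [Lu u0] [Lv v0]]; first by split=> //; apply: sgL.1.
  by split=> [|p pS]; [apply: sgL.2 | rewrite -[(_ - _) _]/(_ _ - _ _) u0 ?v0].
have [l [] /finL//|C [tC SC genC]] := tri_basis (S1 ++ S2) sgL2.
pose B1 := [seq (x.1, nf x.2) | x <- B]; pose B2 := [seq nf x.2 | x <- C].
have B1E : map snd B1 = [seq nf x.2 | x <- B] by rewrite -map_comp.
have sgB := span_sg (pred1 0) (map snd B1 ++ B2).
exists B1, B2; split.
- rewrite /B1 {genB B1E sgB B1}; elim: B tB SB => //= x B IH /tri_cons[nz x0 tB] SB.
  apply/tri_cons; split; rewrite /= ?cf_nf //.
    by move=> _ /mapP[y yB ->]; rewrite cf_nf; apply: x0.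
  by apply: IH => // y yB; apply: SB; rewrite inE yB orbT.
- by move=> _ /mapP[x /SB[xS _] ->].
- by move=> _ p /mapP[x /SC[_ [_ x0]] ->] pS; rewrite cf_nf x0.
- rewrite B1E => b; rewrite mem_cat => /orP[] /mapP[x xB ->]; rewrite cf_nf.
    by split; [case: (SB x xB) | move=> t /mem_nf].
  by split; [case: (SC x xB) => _ [] | move=> t /mem_nf].
move=> l Ll; have [c Bc c0] := genB l Ll.
have Lc : L c by apply: (zspan_min sgL) Bc => _ /mapP[y /SB[_ Ly] -> //].
have [d Cd d0] := genC (l - c) (conj (sgL.2 _ _ Ll Lc) c0).
have Ld : L d by apply: (zspan_min sgL) Cd => _ /mapP[y /SC[_ [Ly _]] -> //].
have -> : l = c + d.
  apply: funext => p; apply/eqP; rewrite -subr_eq0 opprD addrA; apply/eqP.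
  case: (boolP (p \in S1 ++ S2)) => [/d0 //|]; rewrite mem_cat negb_or => /andP[n1 n2].
  by apply: (suppL (l - c - d)) => //; do !apply: sgL.2 => //.
apply: (sgD sgB).
  apply: (zspan_min sgB) Bc => _ /mapP[y yB ->]; rewrite -cf_nf; apply: zspan_gen.
  by rewrite B1E mem_cat (map_f (fun x => nf x.2)).
apply: (zspan_min sgB) Cd => _ /mapP[y yB ->]; rewrite -cf_nf; apply: zspan_gen.
by rewrite mem_cat (map_f (fun x => nf x.2) yB) orbT.
Qed.

(** * Separating a vector from a lattice *)

Definition dotp (psi : svec) (u : vec) : int := \sum_(t <- psi) t.1 * u t.2.

Lemma dotp_cons t psi u : dotp (t :: psi) u = t.1 * u t.2 + dotp psi u.
Proof. exact: big_cons. Qed.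

Lemma dotpB psi u v : dotp psi (u - v) = dotp psi u - dotp psi v.
Proof. by rewrite /dotp -sumrB; apply: eq_bigr => t _; rewrite -[(u - v) _]/(_ - _) mulrBr. Qed.

Lemma dotpZ psi u c : dotp psi (u *~ c) = dotp psi u * c.
Proof. by rewrite /dotp mulr_suml; apply: eq_bigr => t _; rewrite mulzfE mulrA. Qed.

Lemma dotp_scl c psi u : dotp (scl c 0 psi) u = c * dotp psi u.
Proof.
rewrite /dotp big_map mulr_sumr; apply: eq_bigr => -[a [e j]] _ /=.
by rewrite addr0 mulrA.
Qed.

(** The vectors supported on [S] modulo [L] form a finitely generated abelian group, where a nonzero
    element survives in some cyclic quotient Z/m. The value [m = 0] stands for the quotient Z. *)
Lemma separation (S : seq pos) (L : vec -> Prop) v : sg L ->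
  (forall l p, L l -> p \notin S -> l p = 0) -> (forall p, p \notin S -> v p = 0) -> ~ L v ->
  exists psi m, (forall l, L l -> (m %| dotp psi l)%Z) /\ ~~ (m %| dotp psi v)%Z.
Proof.
elim: S L v => [|p S IH] L v sgL suppL suppv nLv.
  by case: nLv; have -> : v = 0 by [apply: funext => p; apply: suppv]; apply: sgL.1.
have e1 u : dotp [:: (1, p)] u = u p by rewrite dotp_cons /dotp big_nil addr0 mul1r.
case: (EM (exists2 l, L l & l p != 0)) => [/(pivot sgL)[b [Lb nzb bdvd]]|no]; last first.
  have Lp0 l : L l -> l p = 0.
    by move=> Ll; apply/eqP; apply: contra_notT no => nz; exists l.
  case: (eqVneq (v p) 0) => [vp0|nz]; last first.
    by exists [:: (1, p)], 0; split=> [l /Lp0|]; rewrite e1 ?dvd0z // => ->.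
  apply: (IH L v) => // [l q Ll|q] qS.
    by case: (eqVneq q p) => [->|nqp]; [apply: Lp0 | apply: suppL; rewrite // inE (negPf nqp)].
  by case: (eqVneq q p) => [->|nqp] //; apply: suppv; rewrite inE (negPf nqp).
case: (boolP (b p %| v p)%Z) => [/dvdzP[c ec]|ndvd]; last first.
  exists [:: (1, p)], (b p); rewrite e1; split=> // l /bdvd[k ek]; rewrite e1 ek.
  exact: dvdz_mull.
pose L' l := L l /\ l p = 0.
have sgL' : sg L'.
  split=> [|u w [Lu u0] [Lw w0]]; first by split=> //; apply: sgL.1.
  by split; [apply: sgL.2 | rewrite -[(_ - _) _]/(_ _ - _ _) u0 w0].
have [||||psi [m [mL mv]]] := IH L' (v - b *~ c) => //.
- move=> l q [Ll l0] qS; case: (eqVneq q p) => [-> //|nqp].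
  by apply: suppL; rewrite // inE (negPf nqp).
- move=> q qS; rewrite -[(_ - _) _]/(_ _ - _ _) mulzfE.
  case: (eqVneq q p) => [->|nqp]; first by rewrite ec mulrC subrr.
  by rewrite suppv ?(suppL b) ?mul0r ?subr0 // inE (negPf nqp).
- case=> Lvb _; apply: nLv; rewrite -(subrK (b *~ c) v); apply: sgD => //; exact: sgZ.
(* Mapping [l] to the value of [psi] at [l - (l p / b p) b] involves the denominator [b p], which is
   cleared by scaling both the functional and the modulus by [b p]. *)
have red l k : l p = k * b p -> dotp ((- dotp psi b, p) :: scl (b p) 0 psi) l
    = b p * dotp psi (l - b *~ k).
  by move=> ek; rewrite dotp_cons dotp_scl dotpB dotpZ /= ek; ring.
exists ((- dotp psi b, p) :: scl (b p) 0 psi), (b p * m); split=> [l Ll|].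
  have [k ek] := bdvd l Ll; rewrite (red l k) //; apply: dvdz_mul => //; apply: mL; split.
    by apply: sgL.2 => //; apply: sgZ.
  by rewrite -[(_ - _) _]/(_ _ - _ _) mulzfE ek mulrC subrr.
by rewrite (red v c) // dvdz_mul2l.
Qed.

(** * Windows of exponents *)

Definition below (hi : int) (u : vec) := forall (e : int) j, hi < e -> u (e, j) = 0.
Definition above (lo : int) (u : vec) := forall (e : int) j, e < lo -> u (e, j) = 0.

Lemma vecB (u v : vec) p : (u - v) p = u p - v p. Proof. by []. Qed.
Lemma vecN (u : vec) p : (- u) p = - u p. Proof. by []. Qed.
Lemma vecD (u v : vec) p : (u + v) p = u p + v p. Proof. by []. Qed.

Lemma below_sg hi : sg (below hi).
Proof. by split=> // u v u0 v0 e j lt; rewrite vecB u0 ?v0. Qed.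

Lemma above_sg lo : sg (above lo).
Proof. by split=> // u v u0 v0 e j lt; rewrite vecB u0 ?v0. Qed.

Lemma sgI S T : sg S -> sg T -> sg (fun u => S u /\ T u).
Proof.
move=> sgS sgT; split=> [|u v [Su Tu] [Sv Tv]]; first by split; [apply: sgS.1|apply: sgT.1].
by split; [apply: sgS.2|apply: sgT.2].
Qed.

Lemma sg_sh k S : sg S -> sg (fun u => S (sh k u)).
Proof.
move=> sgS; split=> [|u v Su Sv]; first by rewrite (sh_eq0 k 0).2 //; apply: sgS.1.
by rewrite shB; apply: sgS.2.
Qed.

(* [downs L] is the Z[X^-1]-module generated by [L]. *)
Fixpoint down (L : vec -> Prop) (m : nat) (u : vec) : Prop :=
  if m is m'.+1 then exists l q, [/\ L l, down L m' q & u = l + sh (- 1) q] else L u.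
Definition downs L u := exists m, down L m u.

Section Downs.
Variables (L : vec -> Prop) (sgL : sg L).

Lemma down_sg m : sg (down L m).
Proof.
elim: m => //= m [IH0 IHB]; split=> [|_ _ [l [q [Ll dq ->]]] [l' [q' [Ll' dq' ->]]]].
  by exists 0, 0; split=> //; apply: sgL.1.
exists (l - l'), (q - q'); split; [exact: sgL.2|exact: IHB|].
by rewrite shB opprD addrACA.
Qed.

Lemma downS m u : down L m u -> down L m.+1 u.
Proof.
elim: m u => [|m IH] u.
  by move=> Lu; exists u, 0; split=> //; [apply: sgL.1 | rewrite (sh_eq0 _ 0).2 // addr0].
by move=> [l [q [Ll /IH dq ->]]]; exists l, q.
Qed.

Lemma down_leq m n u : (m <= n)%N -> down L m u -> down L n u.
Proof. by move=> /subnK <-; elim: (n - m)%N => // k IH /IH /downS. Qed.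

Lemma downs_sg : sg (downs L).
Proof.
split=> [|u v [m du] [n dv]]; first by exists 0%N; apply: sgL.1.
exists (maxn m n); apply: (down_sg _).2.
  exact: down_leq (leq_maxl _ _) du.
exact: down_leq (leq_maxr _ _) dv.
Qed.

Lemma downs_sub u : L u -> downs L u.
Proof. by exists 0%N. Qed.

Lemma downs_sh k u : downs L u -> downs L (sh (- k%:Z) u).
Proof.
move=> du; elim: k => [|k [m dk]]; first by rewrite oppr0 sh0v.
exists m.+1, 0, (sh (- k%:Z) u); split=> //; first exact: sgL.1.
by rewrite add0r sh_sh; apply: eq_sh; lia.
Qed.

Lemma downs_split u : downs L u -> exists l q, [/\ L l, downs L q & u = l + sh (- 1) q].
Proof.
move=> [m /downS /= [l [q [Ll dq ->]]]]; exists l, q; split=> //; by exists m.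
Qed.

Lemma downs_below hi : (forall l, L l -> below hi l) -> forall u, downs L u -> below hi u.
Proof.
move=> Lhi u [m]; elim: m u => [|m IH] u /=; first exact: Lhi.
move=> [l [q [/Lhi l0 /IH q0 ->]]] e j lt.
by rewrite vecD l0 // add0r /sh /= q0 //; lia.
Qed.

(* Leading terms that stick out of the window are pushed back into it. *)
Lemma downs_up hi : (forall l, L l -> below hi l) ->
  (forall l, L l -> (forall j, l (hi, j) = 0) -> L (sh 1 l)) ->
  forall (b : nat) u, downs L u -> below hi (sh b%:Z u) -> downs L (sh b%:Z u).
Proof.
move=> Lhi Lup; elim=> [|b IH] u du; first by rewrite sh0v.
have [l [q [Ll dq eu]]] := downs_split du => b0.
(* [sh (- 1) q] vanishes at exponent [hi] because [q] is below [hi]; so does [u], since the shift by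
   [b.+1] would carry a coefficient there out of the window. *)
have l0 j : l (hi, j) = 0.
  have q0 := downs_below Lhi dq; have := b0 (hi + b.+1%:Z) j; rewrite eu /sh vecD /=.
  have -> : hi + b.+1%:Z - b.+1%:Z = hi by lia.
  by rewrite q0 ?addr0; [apply; lia | lia].
have e : sh b.+1%:Z u = sh b%:Z (sh 1 l + q).
  by rewrite eu !shD !sh_sh; congr (_ + _); apply: eq_sh; lia.
rewrite e in b0 *; apply: IH => //; apply: sgD; [exact: downs_sg| |exact: dq].
by apply: downs_sub; apply: Lup.
Qed.

(** In [u = l + sh (- 1) q] neither [u] nor [l] reaches below [lo], so [q] vanishes at [lo] and
    below. By induction [q] lies in [L], and vanishing at [lo] it may be shifted down within [L]. *)
Lemma down_above lo : (forall l, L l -> above lo l) ->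
  (forall l, L l -> (forall j, l (lo, j) = 0) -> L (sh (- 1) l)) ->
  forall u, downs L u -> above lo u -> L u.
Proof.
move=> Llo Ldn u [m]; elim: m u => //= m IH _ [l [q [Ll dq ->]]] u0.
have q0 e j : e <= lo -> q (e, j) = 0.
  move=> le_e; have := u0 (e - 1) j; rewrite vecD Llo //; last by lia.
  by rewrite add0r /sh /= opprK subrK; apply; lia.
apply: sgD => //; apply: Ldn => // [|j]; last by apply: q0.
by apply: IH => // e j lt_e; apply: q0; lia.
Qed.

End Downs.

Lemma downs_mono (L L' : vec -> Prop) : (forall l, L l -> L' l) ->
  forall u, downs L u -> downs L' u.
Proof.
move=> sub u [m du]; exists m; elim: m u du => [|m IH] u /=; first exact: sub.
by move=> [l [q [/sub ? /IH ? ->]]]; exists l, q.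
Qed.

(** * Certified lattices *)

Definition in_win (lo hi : int) (s : svec) := all (fun t => (lo <= t.2.1) && (t.2.1 <= hi)) s.

Lemma above_in_win lo hi s : in_win lo hi s -> above lo (cf s).
Proof.
move=> /allP w e j lt; apply: cf_notin; apply/mapP=> -[t /w/andP[le _] et].
by move: le; rewrite -et /=; lia.
Qed.

Lemma below_in_win lo hi s : in_win lo hi s -> below hi (cf s).
Proof.
move=> /allP w e j lt; apply: cf_notin; apply/mapP=> -[t /w/andP[_ le] et].
by move: le; rewrite -et /=; lia.
Qed.

Lemma cf_shE k b : sh k (cf b) = cf (scl 1 k b).
Proof. by rewrite cf_scl. Qed.

(* [tri] makes the elements of the lattice that vanish at exponent [a] the
   combinations of [B2], so the last condition says that those elements may be
   shifted by [d]. *)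
Definition lattice_cert (lo hi d a : int) (B1 : seq (pos * svec)) (B2 : seq svec) : Prop :=
  (tri B1 && all (fun x => x.1.1 == a) B1 && all (all (fun t => t.2.1 != a)) B2 &&
   all (in_win lo hi) (map snd B1 ++ B2)) /\
  forall b, b \in B2 -> zspan (map snd B1 ++ B2) (cf (scl 1 d b)).

Lemma lattice_cert_sh lo hi d a B1 B2 u : lattice_cert lo hi d a B1 B2 ->
  zspan (map snd B1 ++ B2) u -> (forall j, u (a, j) = 0) ->
  zspan (map snd B1 ++ B2) (sh d u).
Proof.
move=> [/andP[/andP[/andP[tB /allP aB1] /allP aB2] _] shB2] Bu u0.
have : zspan B2 u.
  apply: (@tri_zspan (fun p => p.1 == a) B1 B2) => // [b p /aB2/allP nb /eqP pa|[e j] /eqP /= ->//].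
  apply: cf_notin; apply/mapP => -[t /nb tb ep]; by rewrite -ep pa eqxx in tb.
apply: (@zspan_min B2 (fun v => zspan (map snd B1 ++ B2) (sh d v))).
  by apply: sg_sh; apply: span_sg.
by move=> b /shB2; rewrite cf_shE.
Qed.

Lemma lattice_cert_win lo hi d a B1 B2 u : lattice_cert lo hi d a B1 B2 ->
  zspan (map snd B1 ++ B2) u -> above lo u /\ below hi u.
Proof.
move=> [/andP[_ /allP w] _]; apply: (@zspan_min _ (fun u => above lo u /\ below hi u)) => [|b /w].
  exact: sgI (above_sg lo) (below_sg hi).
by move=> wb; split; [apply: above_in_win wb | apply: below_in_win wb].
Qed.

Definition grid (lo hi : int) (D : nat) : seq pos :=
  [seq (lo + i%:Z, j) | i <- iota 0 `|hi - lo|.+1, j <- iota 0 D].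

Lemma mem_grid lo hi D e j : lo <= e -> e <= hi -> (j < D)%N -> (e, j) \in grid lo hi D.
Proof.
move=> le1 le2 lt_j; apply/allpairsP; exists (`|e - lo|%N, j); rewrite !mem_iota /=.
by split; try lia; rewrite gez0_abs ?subr_ge0 // addrCA subrr addr0.
Qed.

Lemma gridP lo hi D p : p \in grid lo hi D -> lo <= hi -> lo <= p.1 /\ p.1 <= hi.
Proof. by move=> /allpairsP[[i j] [+ _ ->]]; rewrite mem_iota /=; lia. Qed.

(** Elimination with all pivots of the first part at exponent [a] makes [B2] vanish there, and the
    closure hypothesis then lets each member of [B2] be shifted by [d] inside [L]. *)
Lemma lattice_cert_ex (lo hi d a : int) (D : nat) (L : vec -> Prop) :
  lo <= hi -> lo <= a -> a <= hi -> sg L ->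
  (forall l, L l -> exists s, l = cf s) ->
  (forall l, L l -> above lo l /\ below hi l) ->
  (forall l e j, L l -> (D <= j)%N -> l (e, j) = 0) ->
  (forall l, L l -> (forall j, l (a, j) = 0) -> L (sh d l)) ->
  exists B1 B2, [/\ lattice_cert lo hi d a B1 B2,
    forall b, b \in map snd B1 ++ B2 -> L (cf b) &
    forall l, L l -> zspan (map snd B1 ++ B2) l].
Proof.
move=> lohi loa ahi sgL finL winL idxL shL.
have [||B1 [B2 [tB SB1 SB2 LB genB]]] := @split_basis (grid a a D) (grid lo hi D) L sgL => //.
  move=> l [e j] Ll _ ng; have [al bl] := winL l Ll.
  case: (ltP e lo) => [/al //|le1]; case: (ltP hi e) => [/bl //|le2].
  case: (leqP D j) => [/(idxL l e j Ll) //|lt_j].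
  by rewrite mem_grid in ng.
have winB b : b \in map snd B1 ++ B2 -> in_win lo hi b.
  move=> /LB[Lb nzb]; have [al bl] := winL _ Lb; apply/allP => -[c [e j]] /nzb /= nz.
  rewrite !leNgt; apply/andP; split; apply: contraNN nz => lt; apply/eqP; [exact: al|exact: bl].
exists B1, B2; split=> // [|b /LB[]//]; split.
  rewrite tB /=; apply/andP; split; last by apply/allP.
  apply/andP; split; first by apply/allP => x /SB1/gridP /= h; apply/eqP; lia.
  apply/allP => b b2; apply/allP => -[c [e j]] /= tb.
  have [Lb /(_ _ tb) /= nz] : L (cf b) /\ forall t, t \in b -> cf b t.2 != 0.
    by apply: LB; rewrite mem_cat b2 orbT.
  apply: contraNneq nz => ->; case: (leqP D j) => [/(idxL _ a j Lb)->//|lt_j].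
  by rewrite (SB2 b) ?mem_grid.
move=> b b2; rewrite -cf_shE; have [Lb _] : L (cf b) /\ forall t, t \in b -> cf b t.2 != 0.
  by apply: LB; rewrite mem_cat b2 orbT.
apply: genB; apply: shL => // j; case: (leqP D j) => [/(idxL _ a j Lb)->//|lt_j].
by rewrite (SB2 b) ?mem_grid.
Qed.

(* The lattice spanned by the first basis is closed under shifting up, its
   overlattice [B'] under shifting down. *)
Definition window_cert (G E : seq svec) lo hi (B1' : seq (pos * svec)) B2' : Prop :=
  exists B1 B2, (lattice_cert lo hi 1 hi B1 B2 /\ lattice_cert lo hi (- 1) lo B1' B2') /\
    ((forall g, g \in G -> zspan (map snd B1 ++ B2) (cf g)) /\
     (forall b, b \in map snd B1 ++ B2 -> zspan (map snd B1' ++ B2') (cf b))) /\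
    forall g, g \in E -> zspan (map snd B1' ++ B2') (cf g).

(** The span of [G] is closed under both shifts, but adding the Z[X^-1]-span of [E] in general
    destroys closure under [X]; hence one lattice for each direction. Since [y] stays below [hi], so
    does [u]. As [u] is a shift of an element of [downs L], [downs_up] puts it in [downs L] itself.
    The sum then lies in [downs L'] and stays above [lo], so [down_above] applies. *)
Lemma window_cert_sound G E lo hi B1' B2' u y : window_cert G E lo hi B1' B2' ->
  rspan G u -> nspan E y -> above lo (u + y) -> below hi (u + y) ->
  zspan (map snd B1' ++ B2') (u + y).
Proof.
move=> [B1 [B2 [[C C'] [[GB BB'] EB']]]] Gu Ey lo0 hi0.
set L := zspan (map snd B1 ++ B2) in GB; set L' := zspan (map snd B1' ++ B2') in EB' *.
have sgL : sg L by apply: span_sg.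
have sgL' : sg L' by apply: span_sg.
have LL' l : L l -> L' l by apply: zspan_min.
have Ly : downs L' y.
  apply: (span_min (downs_sg sgL')) Ey => k b le_k /EB' Lb.
  have -> : k = - `|k|%N%:Z by lia.
  by apply: downs_sh => //; apply: downs_sub.
have [b [v [dv ev]]] : exists (b : nat) v, downs L v /\ u = sh b%:Z v.
  apply: (@span_min predT G (fun u => exists (b : nat) v, downs L v /\ u = sh b%:Z v)) Gu.
    split=> [|_ _ [m [v [dv ->]]] [n [w [dw ->]]]].
      by exists 0%N, 0; split; [apply: (downs_sg sgL).1 | rewrite sh0v].
    exists (maxn m n), (sh (- (maxn m n - m)%N%:Z) v - sh (- (maxn m n - n)%N%:Z) w); split.
      by apply: (downs_sg sgL).2; apply: downs_sh.
    by rewrite shB !sh_sh; congr (_ - _); apply: eq_sh; lia.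
  move=> k g _ /GB Lg; case: (leP 0 k) => [le0k|lt].
    by exists `|k|%N, (cf g); split; [apply: downs_sub | apply: eq_sh; lia].
  exists 0%N, (sh (- `|k|%N%:Z) (cf g)); split; last by rewrite sh0v; apply: eq_sh; lia.
  by apply: downs_sh => //; apply: downs_sub.
have bu : below hi u.
  rewrite -(addrK y u); apply: (below_sg hi).2 => //.
  by apply: downs_below Ly => l /(lattice_cert_win C')[].
have du : downs L u.
  rewrite ev in bu *; apply: (@downs_up L sgL hi) => // l; first by case/(lattice_cert_win C).
  exact: lattice_cert_sh C.
apply: (@down_above L' sgL' lo) => // [l|l|].
- by case/(lattice_cert_win C').
- exact: lattice_cert_sh C'.
by apply: sgD Ly; [exact: downs_sg | exact: downs_mono du].
Qed.

(** With [E] empty this is membership in the module of relations; with [E] consisting of X^-1 f,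
    membership of [f] itself yields a monic annihilator, see [monic_ann]. *)
Definition inmod (G E : seq svec) (v : vec) := exists u y, [/\ rspan G u, nspan E y & v = u + y].

Lemma inmod_sg G E : sg (inmod G E).
Proof.
split=> [|_ _ [u [y [Gu Ey ->]]] [u' [y' [Gu' Ey' ->]]]].
  by exists 0, 0; split; [apply: (span_sg _ _).1 | apply: (span_sg _ _).1 | rewrite addr0].
by exists (u - u'), (y - y'); split;
  [apply: (span_sg _ _).2 | apply: (span_sg _ _).2 | rewrite opprD addrACA].
Qed.

Lemma inmod_nil G u : inmod G [::] u <-> rspan G u.
Proof.
split=> [[v [y [Gv [w _ ->] ->]]]|Gu].
  have -> : cf (comb [::] w) = 0.
    elim: w => [|t w IH]; rewrite ?cf_nil // comb_cons cf_cat IH addr0 nth_nil.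
    by rewrite cf_scl cf_nil (sh_eq0 _ 0).2 // mul0rz.
  by rewrite addr0.
by exists u, 0; split=> //; [apply: (span_sg _ _).1 | rewrite addr0].
Qed.

Lemma inmod_cf G E v : inmod G E v -> exists s, v = cf s.
Proof.
by move=> [_ [_ [[w _ ->] [w' _ ->] ->]]]; exists (comb G w ++ comb E w'); rewrite cf_cat.
Qed.

Lemma inmod_idx (G E : seq svec) (D : nat) (v : vec) :
  (forall (g : svec) t, g \in G ++ E -> t \in g -> (t.2.2 < D)%N) -> inmod G E v ->
  forall e j, (D <= j)%N -> v (e, j) = 0.
Proof.
move=> GD; set S := fun v : vec => forall e j, (D <= j)%N -> v (e, j) = 0.
have sgS : sg S by split=> // u w u0 w0 e j le; rewrite vecB u0 ?w0.
have SG k g : g \in G ++ E -> S (sh k (cf g)).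
  move=> gG e j le; rewrite /sh; apply: cf_notin; apply/mapP => -[t tg /= ej].
  by have := GD g t gG tg; rewrite -ej /= ltnNge le.
move=> [u [y [Gu Ey ->]]]; apply: (sgD sgS).
  by apply: (span_min sgS) Gu => k b _ bG; apply: SG; rewrite mem_cat bG.
by apply: (span_min sgS) Ey => k b _ bG; apply: SG; rewrite mem_cat bG orbT.
Qed.

Lemma bound_seq (f : int * pos -> nat) (ss : seq svec) :
  exists D : nat, forall (g : svec) t, g \in ss -> t \in g -> (f t <= D)%N.
Proof.
exists (\max_(g <- ss) \max_(t <- g) f t)%N => g t gs tg.
apply: leq_trans (@leq_bigmax_seq _ g xpredT f _ tg isT) _.
exact: (@leq_bigmax_seq _ ss xpredT (fun g : svec => \max_(t <- g) f t)%N _ gs isT).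
Qed.

Lemma idx_bound (ss : seq svec) :
  exists D, forall (g : svec) t, g \in ss -> t \in g -> (t.2.2 < D)%N.
Proof. by have [D le_D] := bound_seq (fun t => t.2.2) ss; exists D.+1. Qed.

Lemma exp_bound (ss : seq svec) : exists n : nat, forall g, g \in ss -> in_win (- n%:Z) n g.
Proof.
have [D le_D] := bound_seq (fun t => `|t.2.1|%N) ss; exists D => g gs.
by apply/allP => -[c [e j]] tg; have := le_D g _ gs tg; rewrite /=; lia.
Qed.

(** The lattices are the full intersections of the two modules with the window, so the required
    closure under shifts that stay in the window is inherited from the modules. *)
Lemma window_cert_ex (G E : seq svec) (lo hi : int) : lo <= hi -> all (in_win lo hi) (G ++ E) ->
  exists B1 B2, window_cert G E lo hi B1 B2 /\
    forall b, b \in map snd B1 ++ B2 -> inmod G E (cf b).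
Proof.
move=> lohi /allP winGE; have [D GD] := idx_bound (G ++ E).
have hl : lo <= lo /\ hi <= hi by [].
pose L u := rspan G u /\ (above lo u /\ below hi u).
pose L' u := inmod G E u /\ (above lo u /\ below hi u).
have sgw := sgI (above_sg lo) (below_sg hi).
have sgL : sg L := sgI (span_sg predT G) sgw.
have sgL' : sg L' := sgI (inmod_sg G E) sgw.
have rm u : rspan G u -> inmod G E u.
  by exists u, 0; split=> //; [apply: (span_sg _ _).1 | rewrite addr0].
have nm u : nspan E u -> inmod G E u.
  by exists 0, u; split=> //; [apply: (span_sg _ _).1 | rewrite add0r].
have [|||||||B1 [B2 [C LB genB]]] := @lattice_cert_ex lo hi 1 hi D L lohi => //.
- by move=> l [/rm/inmod_cf].
- by move=> l [].
- by move=> l e j [/rm Gl _]; apply: (inmod_idx GD Gl).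
- move=> l [Gl [al bl]] l0; split; first exact: span_sh.
  split=> e j lt; rewrite /sh /=; first by rewrite al //; lia.
  by case: (e - 1 =P hi) => [->|ne]; [apply: l0 | rewrite bl //; lia].
have [|||||||B1' [B2' [C' LB' genB']]] := @lattice_cert_ex lo hi (- 1) lo D L' lohi => //.
- by move=> l [/inmod_cf].
- by move=> l [].
- by move=> l e j [Gl _]; apply: (inmod_idx GD Gl).
- move=> l [[u [y [Gu Ey el]]] [al bl]] l0; split.
    exists (sh (- 1) u), (sh (- 1) y); split; first exact: span_sh.
      by apply: span_sh => // k /= ?; lia.
    by rewrite el.
  split=> e j lt; rewrite /sh /=; last by rewrite bl //; lia.
  by case: (e - -1 =P lo) => [->|ne]; [apply: l0 | rewrite al //; lia].
have wG g : g \in G ++ E -> above lo (cf g) /\ below hi (cf g).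
  by move=> /winGE w; split; [apply: above_in_win w | apply: below_in_win w].
exists B1', B2'; split=> [|b /LB'[]//]; exists B1, B2; split=> //; split; [split|].
- move=> g gG; apply: genB; split; last by apply: wG; rewrite mem_cat gG.
  by rewrite -[cf g]sh0v; apply: span_gen.
- by move=> b /LB[/rm mb wb]; apply: genB'.
- move=> g gE; apply: genB'; split; last by apply: wG; rewrite mem_cat gE orbT.
  by apply: nm; rewrite -[cf g]sh0v; apply: span_gen.
Qed.

(** * Non-membership is recursively enumerable *)

Definition nonmem_cert (G E : seq svec) (v : svec) : Prop :=
  exists lo hi B1 B2 psi m, [/\ window_cert G E lo hi B1 B2, in_win lo hi v,
    forall b, b \in map snd B1 ++ B2 -> (m %| dotp psi (cf b))%Z &
    ~~ (m %| dotp psi (cf v))%Z].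

Lemma nonmem_certP G E v : nonmem_cert G E v <-> ~ inmod G E (cf v).
Proof.
split=> [[lo [hi [B1 [B2 [psi [m [C wv dB dv]]]]]]] [u [y [Gu Ey ev]]]|nm].
  have Bv : zspan (map snd B1 ++ B2) (cf v).
    rewrite ev; apply: window_cert_sound C Gu Ey _ _; rewrite -ev.
      exact: above_in_win wv.
    exact: below_in_win wv.
  move/negP: dv; apply; apply: (@zspan_min _ (fun u => (m %| dotp psi u)%Z)) Bv => //.
  split=> [|w w' h h']; last by rewrite dotpB rpredB.
  by rewrite /dotp big1 ?dvdz0 // => t _; rewrite mulr0.
have [n wn] := exp_bound (v :: G ++ E); pose hi := n%:Z; pose lo := - n%:Z.
have lohi : lo <= hi by rewrite /lo /hi; lia.
have wv : in_win lo hi v by apply: wn; rewrite inE eqxx.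
have [|B1 [B2 [C mB]]] := @window_cert_ex G E lo hi lohi.
  by apply/allP => g gG; apply: wn; rewrite inE gG orbT.
have [D vD] := idx_bound (v :: G ++ E).
have GD g t : g \in G ++ E -> t \in g -> (t.2.2 < D)%N.
  by move=> gG; apply: vD; rewrite inE gG orbT.
pose L := zspan (map snd B1 ++ B2).
have L_mem u : L u -> inmod G E u by apply: (zspan_min (inmod_sg G E)).
have [||||psi [m [dL dv]]] := @separation (grid lo hi D) L (cf v).
- exact: span_sg.
- move=> l [e j] Ll ng; have [_ [_ [[_ C'] _]]] := C.
  have [al bl] := lattice_cert_win C' Ll.
  case: (ltP e lo) => [/al //|le1]; case: (ltP hi e) => [/bl //|le2].
  case: (leqP D j) => [/(inmod_idx GD (L_mem _ Ll)) //|lt_j].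
  by rewrite mem_grid in ng.
- move=> [e j] ng; case: (ltP e lo) => [/(above_in_win wv) //|le1].
  case: (ltP hi e) => [/(below_in_win wv) //|le2].
  case: (leqP D j) => [le_Dj|lt_j]; last by rewrite mem_grid in ng.
  apply: cf_notin; apply/mapP => -[t tv ej]; have := vD v t.
  by rewrite inE eqxx tv -ej /= ltnNge le_Dj => /(_ isT isT).
- by move=> /L_mem.
by exists lo, hi, B1, B2, psi, m; split=> // b bB; apply: dL; apply: zspan_gen.
Qed.

(** * The action of integer polynomials on vectors *)

Definition pact (p : {poly int}) (u : vec) : vec := \sum_(i < size p) sh i%:Z u *~ p`_i.

Lemma pactE n (p : {poly int}) u : (size p <= n)%N ->
  pact p u = \sum_(i < n) sh i%:Z u *~ p`_i.
Proof.
move=> le_n; rewrite /pact (big_ord_widen n (fun i : nat => sh i%:Z u *~ p`_i) le_n) big_mkcond /=.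
by apply: eq_bigr => i _; case: ltnP => // le_i; rewrite nth_default // mulr0z.
Qed.

Lemma pactD p q u : pact (p + q) u = pact p u + pact q u.
Proof.
pose n := maxn (size p) (size q).
rewrite !(@pactE n) ?size_polyD ?leq_maxl ?leq_maxr // -big_split.
by apply: eq_bigr => i _; rewrite coefD mulrzDr.
Qed.

Lemma pact0 u : pact 0 u = 0.
Proof. by rewrite /pact size_poly0 big_ord0. Qed.

Lemma pactN p u : pact (- p) u = - pact p u.
Proof. by apply/eqP; rewrite -addr_eq0 -pactD addNr pact0. Qed.

Lemma pactB p q u : pact (p - q) u = pact p u - pact q u.
Proof. by rewrite pactD pactN. Qed.

Lemma pactZ c p u : pact (c *: p) u = pact p u *~ c.
Proof.
rewrite (@pactE (size p)) ?size_scale_leq // /pact.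
rewrite mulrz_suml; apply: eq_bigr => i _.
by rewrite coefZ mulrC mulrzA.
Qed.

Lemma pact_sum I (r : seq I) (P : pred I) (F : I -> {poly int}) u :
  pact (\sum_(i <- r | P i) F i) u = \sum_(i <- r | P i) pact (F i) u.
Proof. by elim/big_rec2: _ => [|i y x _ <-]; [exact: pact0 | rewrite pactD]. Qed.

Lemma pactXn n u : pact 'X^n u = sh n%:Z u.
Proof.
rewrite /pact size_polyXn big_ord_recr /= coefXn eqxx big1 ?add0r // => i _.
by rewrite coefXn ltn_eqF // mulr0z.
Qed.

Lemma pact1 u : pact 1 u = u.
Proof. by rewrite -[1]/('X^0 : {poly int}) pactXn sh0v. Qed.

Lemma pact_shift p n u : pact ('X^n * p) u = sh n%:Z (pact p u).
Proof.
have sh_sum (F : 'I_(size p) -> vec) k : sh k (\sum_i F i) = \sum_i sh k (F i).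
  by elim/big_rec2: _ => [|i y x _ <-]; [apply/(sh_eq0 _ 0) | rewrite shD].
rewrite [pact p u]/pact sh_sum [in LHS](_ : p = \sum_(i < size p) p`_i *: 'X^i); last first.
  by rewrite -[LHS]coefK poly_def.
rewrite mulr_sumr pact_sum; apply: eq_bigr => i _.
by rewrite -scalerAr -exprD pactZ pactXn sh_mulz sh_sh PoszD.
Qed.

Lemma pactM p q u : pact (p * q) u = pact p (pact q u).
Proof.
rewrite [in LHS](_ : p = \sum_(i < size p) p`_i *: 'X^i); last first.
  by rewrite -[LHS]coefK poly_def.
rewrite mulr_suml pact_sum; apply: eq_bigr => i _.
by rewrite -scalerAl pactZ pact_shift.
Qed.

Lemma pactDr p u v : pact p (u + v) = pact p u + pact p v.
Proof. by rewrite /pact -big_split; apply: eq_bigr => i _; rewrite shD mulrzDl. Qed.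

(* Coefficient lists are read as sparse vectors along the basis vector [0]. *)
Definition psv (s : seq int) : svec := [seq (s`_i, (i%:Z, 0%N)) | i <- iota 0 (size s)].

Notation e0 := [:: (1, (0, 0%N))].

Lemma comb_psv g (s : seq int) : cf (comb [:: g] (psv s)) = pact (Poly s) (cf g).
Proof.
rewrite (@pactE (size s)) ?size_Poly //.
rewrite -(big_mkord xpredT (fun i : nat => sh i%:Z (cf g) *~ (Poly s)`_i)).
rewrite /psv /index_iota subn0; elim: (iota _ _) => [|i r IH]; first by rewrite big_nil cf_nil.
by rewrite big_cons -IH /= comb_cons cf_cat cf_scl /= coef_Poly.
Qed.

Lemma cf_psv (s : seq int) : cf (psv s) = pact (Poly s) (cf e0).
Proof.
rewrite -comb_psv; congr cf; rewrite /psv.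
elim: (iota _ _) => //= i r IH; rewrite comb_cons -IH /scl /= ?mulr1 ?add0r //.
Qed.

Lemma cf_e0 e j : cf e0 (e, j) = ((e == 0) && (j == 0%N))%:Z.
Proof. by rewrite /cf big_seq1 xpair_eqE eq_sym [(_ == j)%N]eq_sym; case: ifP. Qed.

Lemma vec_sum I (r : seq I) (P : pred I) (F : I -> vec) p :
  (\sum_(i <- r | P i) F i) p = \sum_(i <- r | P i) F i p.
Proof. by elim/big_rec2: _ => [|i y x _ <-]. Qed.

Lemma pact_e0 p e j :
  pact p (cf e0) (e, j) = if (0 <= e) && (j == 0%N) then p`_`|e|%N else 0.
Proof.
rewrite /pact vec_sum; case: ifP => [/andP[le0e /eqP->]|ne]; last first.
  rewrite big1 // => i _; rewrite mulzfE /sh cf_e0 /=.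
  case: andP => [[/eqP ei /eqP ej]|_]; last by rewrite mul0r.
  by move: ne; rewrite ej eqxx andbT; lia.
under eq_bigr => i _ do rewrite mulzfE /sh cf_e0 eqxx andbT /=.
case: (ltnP `|e|%N (size p)) => [lt_e|le_e].
  rewrite (bigD1 (Ordinal lt_e)) //= big1 => [|i /negP ne].
    by rewrite addr0 gez0_abs // subrr eqxx mul1r.
  case: eqP => [ei|]; rewrite ?mul0r //; case: ne; apply/eqP/val_inj => /=; lia.
rewrite nth_default // big1 // => i _; case: eqP => [ei|]; rewrite ?mul0r //.
by move: le_e; rewrite (subr0_eq ei) absz_nat leqNgt ltn_ord.
Qed.

Lemma pact_e0_inj : injective (pact^~ (cf e0)).
Proof.
move=> p q e; apply/polyP => i; have := congr1 (fun u : vec => u (i%:Z, 0%N)) e.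
by rewrite !pact_e0.
Qed.

(* Evaluation of the index-[0] part of a sparse vector as a polynomial, after a
   shift by [n] that makes its exponents nonnegative. *)
Definition topoly (n : nat) (w : svec) : {poly int} :=
  \sum_(t <- w | t.2.2 == 0%N) t.1 *: 'X^(`|t.2.1 + n%:Z|).

Lemma pact_topoly n w (g : svec) : in_win (- n%:Z) n w ->
  pact (topoly n w) (cf g) = sh n%:Z (cf (comb [:: g] w)).
Proof.
rewrite /topoly; elim: w => [|[c [e j]] w IH] /=.
  by rewrite big_nil pact0 cf_nil (sh_eq0 _ 0).2.
move=> /andP[/andP[le1 le2] /IH {}IH]; rewrite big_cons comb_cons cf_cat shD -IH /= cf_scl.
case: j => [|j] /=; last by rewrite nth_nil cf_nil (sh_eq0 e 0).2 // mul0rz (sh_eq0 _ 0).2 // add0r.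
rewrite pactD pactZ pactXn sh_mulz sh_sh; congr (_ *~ _ + _); apply: eq_sh; lia.
Qed.

(** * Annihilators *)

Definition ann (G : seq svec) (f : svec) (p : {poly int}) := rspan G (pact p (cf f)).

Section Ann.
Variables (G : seq svec) (f : svec).

Lemma annB p q : ann G f p -> ann G f q -> ann G f (p - q).
Proof. by rewrite /ann pactB; apply: (span_sg _ _).2. Qed.

Lemma rspan_pact p u : rspan G u -> rspan G (pact p u).
Proof.
move=> Gu; rewrite /pact; apply: big_ind => [|v w|i _]; first exact: (span_sg _ _).1.
  by apply: sgD; apply: span_sg.
by apply: sgZ; [apply: span_sg | apply: span_sh].
Qed.

Lemma annM p q : ann G f q -> ann G f (p * q).
Proof. by rewrite /ann pactM; apply: rspan_pact. Qed.

Lemma annXn n p : ann G f ('X^n * p) -> ann G f p.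
Proof.
rewrite /ann pact_shift => /(@span_sh predT G (- n%:Z)).
by rewrite sh_sh addNr sh0v; apply.
Qed.

Lemma ann_mod p q : ann G f q -> q \is monic -> ann G f p -> ann G f (Pdiv.Ring.rmodp p q).
Proof.
move=> aq mq ap.
have -> : Pdiv.Ring.rmodp p q = p - Pdiv.Ring.rdivp p q * q.
  by rewrite {2}(Pdiv.RingMonic.rdivp_eq mq p) addrC addKr.
by apply: annB => //; apply: annM.
Qed.

End Ann.

(* Adjoining a formal copy of the ring along [f] turns relations on [f] into
   elements supported on the new basis vector [0]. *)
Definition up (s : svec) : svec := [seq (t.1, (t.2.1, t.2.2.+1)) | t <- s].
Definition graph (G : seq svec) (f : svec) := ((1, (0, 0%N)) :: up f) :: map up G.

Definition upv (u : vec) : vec := fun p => if p.2 is j.+1 then u (p.1, j) else 0.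

Lemma cf_up s : cf (up s) = upv (cf s).
Proof.
apply: funext => -[e [|j]]; rewrite /upv /cf big_map /=.
  by rewrite big1 // => t _; rewrite xpair_eqE andbF.
by apply: eq_bigr => -[c [e' j']] _ /=; rewrite !xpair_eqE eqSS.
Qed.

Lemma upvB u v : upv (u - v) = upv u - upv v.
Proof. by apply: funext => -[e [|j]]. Qed.
Lemma upvD u v : upv (u + v) = upv u + upv v.
Proof. by apply: funext => -[e [|j]]. Qed.
Lemma upv_sh k u : upv (sh k u) = sh k (upv u).
Proof. by apply: funext => -[e [|j]]. Qed.
Lemma upvZ u c : upv (u *~ c) = upv u *~ c.
Proof. by apply: funext => -[e [|j]]; rewrite mulzfE /upv /= ?mul0r ?mulzfE. Qed.
Lemma upv0 : upv 0 = 0.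
Proof. by apply: funext => -[e [|j]]. Qed.

Lemma upv_pact p u : upv (pact p u) = pact p (upv u).
Proof.
rewrite /pact; elim/big_rec2: _ => [|i y x _ <-]; first exact: upv0.
by rewrite upvD upvZ upv_sh.
Qed.

Lemma cf_graph f : cf ((1, (0, 0%N)) :: up f) = cf e0 + upv (cf f).
Proof. by rewrite cf_cons cf_up. Qed.

Lemma rspan_graph G f p : ann G f p -> rspan (graph G f) (pact p (cf e0)).
Proof.
move=> ap.
have : rspan (graph G f) (pact p (cf e0 + upv (cf f))).
  rewrite -cf_graph; apply: rspan_pact; rewrite -[cf _]sh0v; apply: span_gen => //.
  by rewrite inE eqxx.
have : rspan (graph G f) (upv (pact p (cf f))).
  apply: (@span_min predT G (fun u => rspan (graph G f) (upv u))) ap.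
    split=> [|u v Gu Gv]; first by rewrite upv0; apply: (span_sg _ _).1.
    by rewrite upvB; apply: (span_sg _ _).2.
  move=> k b _ bG; rewrite upv_sh -cf_up; apply: span_gen => //.
  by rewrite inE map_f ?orbT.
rewrite pactDr upv_pact => h1 /(fun h => (span_sg _ _).2 _ _ h h1); by rewrite addrK.
Qed.

(** Every element of the graph module has the form [(w, w f - v)] with [v] in the span of [G]. If
    the second part vanishes, then [w f = v], so [w] annihilates [f] modulo that span. *)
Lemma graph_rspan G f u : rspan (graph G f) u -> (forall e j, u (e, j.+1) = 0) ->
  exists w, u = cf (comb [:: e0] w) /\ rspan G (cf (comb [:: f] w)).
Proof.
pose S u := exists w v, u = cf (comb [:: e0] w) + upv (cf (comb [:: f] w) - v) /\ rspan G v.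
have S_graph : rspan (graph G f) u -> S u.
  apply: span_min.
    split=> [|_ _ [w [v [-> Gv]]] [w' [v' [-> Gv']]]].
      by exists [::], 0; rewrite !cf_nil subrr upv0 addr0; split=> //; apply: (span_sg _ _).1.
    exists (w ++ scl (-1) 0 w'), (v - v'); split; last exact: (span_sg _ _).2.
    rewrite !comb_cat !cf_cat !cf_comb_scl !sh0v !mulrNz !mulr1z.
    by apply: funext => -[e [|j]]; rewrite !(vecD, vecN) /upv /= ?(vecD, vecN); ring.
  move=> k b _; rewrite inE => /predU1P[->|/mapP[g gG ->]].
    exists [:: (1, (k, 0%N))], 0; rewrite !comb_cons !cats0 !cf_scl !mulr1z subr0.
    by rewrite cf_graph shD upv_sh; split=> //; apply: (span_sg _ _).1.
  exists [::], (- sh k (cf g)); rewrite !cf_nil add0r sub0r opprK upv_sh cf_up; split=> //.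
  by apply: sgN; [apply: span_sg | apply: span_gen].
move=> /S_graph[w [v [-> Gv]]] u0; exists w.
have c0 e j : cf (comb [:: e0] w) (e, j.+1) = 0.
  apply: cf_notin; apply/mapP => -[t]; elim: w {u0} => //= -[c [k [|i]]] w IH; rewrite comb_cons.
    by rewrite mem_cat => /orP[|/IH//]; rewrite inE => /eqP ->.
  by rewrite /= nth_nil.
have -> : cf (comb [:: f] w) = v.
  apply: funext => -[e j]; have := u0 e j; rewrite vecD c0 add0r /upv /= vecB => /eqP.
  by rewrite subr_eq0 => /eqP.
by rewrite subrr upv0 addr0.
Qed.

(* Divisibility of [p] by [q] in the ring of rational Laurent polynomials. *)
Definition qdvd (q p : {poly int}) := exists m n b, m != 0 /\ m *: ('X^n * p) = b * q.

(** The quotient [b] may have negative exponents, which replaces the factor ['X^n] of [qdvd]. *)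
Definition qdvs (q : seq int) (c : svec) : Prop :=
  exists m b, (m != 0) && eqv (scl m 0 c) (comb [:: psv q] b).

Definition qdvv (q : seq int) (u : vec) : Prop :=
  exists m b, m != 0 /\ u *~ m = cf (comb [:: psv q] b).

Lemma qdvs_qdvv q c : qdvs q c -> qdvv q (cf c).
Proof. by move=> [m [b /andP[nz /eqvP e]]]; exists m, b; rewrite -e cf_scl sh0v. Qed.

Lemma qdvv_sg q : sg (qdvv q).
Proof.
split=> [|u v [m [b [nzm eb]]] [m' [b' [nzm' eb']]]].
  by exists 1, [::]; rewrite cf_nil mul0rz.
exists (m * m'), (scl m' 0 b ++ scl (- m) 0 b'); split; first by rewrite mulf_neq0.
rewrite comb_cat cf_cat !cf_comb_scl !sh0v mulrzBl -eb -eb' !mulrzA.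
by rewrite mulrNz -!mulrzA [m' * m]mulrC.
Qed.

Lemma qdvv_qdvd q p : qdvv q (pact p (cf e0)) -> qdvd (Poly q) p.
Proof.
move=> [m [b [nz e]]]; have [n wn] := exp_bound [:: b]; have wb := wn b (mem_head _ _).
exists m, n, (topoly n b); split=> //; apply: pact_e0_inj.
by rewrite pactM -cf_psv pact_topoly // pactZ pact_shift -e sh_mulz.
Qed.

Lemma qdvd_qdvv q p : qdvd (Poly q) p -> qdvv q (pact p (cf e0)).
Proof.
move=> [m [n [b [nz e]]]]; exists m, (scl 1 (- n%:Z) (psv b)); split=> //.
rewrite cf_comb_scl mulr1z comb_psv polyseqK cf_psv -pactM -e pactZ pact_shift.
by rewrite sh_mulz sh_sh addNr sh0v.
Qed.

Lemma qdvdMDl q s p r : qdvd q p -> qdvd q r -> qdvd q (s * p + r).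
Proof.
move=> [m [n [b [nz e]]]] [m' [n' [b' [nz' e']]]].
exists (m * m'), (n + n')%N, (m' *: ('X^n' * (s * b)) + m *: ('X^n * b')).
split; first by rewrite mulf_neq0.
rewrite mulrDl -!scalerAl -!mulrA -e -e' -!mul_polyC rmorphM /= exprD; ring.
Qed.

(* [P] is the list of the coefficients of a monic polynomial but the leading one. *)
Definition ann_cert (G : seq svec) (f : svec) (q : seq int) : Prop :=
  exists lo hi B1 B2 C1 C2 P, window_cert (graph G f) [::] lo hi B1 B2 /\
  ((tri C1 && all (fun x => x.1.2 != 0%N) C1 && all (all (fun t => t.2.2 == 0%N)) C2 &&
    (lo <= 0) && ((size P)%:Z <= hi + 1)) /\
  ((forall b, b \in map snd B1 ++ B2 -> zspan (map snd C1 ++ C2) (cf b)) /\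
  ((forall c, c \in psv (rcons P 1) :: C2 -> qdvs q c) /\
  rspan G (cf (comb [:: f] (psv (rcons P 1))))))).

Lemma Poly_rcons1 (P : seq int) : Poly (rcons P 1) = rcons P 1 :> seq int.
Proof. by rewrite (@PolyK _ 0) // last_rcons. Qed.

Lemma Poly_rcons1_monic (P : seq int) : Poly (rcons P 1) \is monic.
Proof. by rewrite monicE lead_coefE Poly_rcons1 size_rcons nth_rcons ltnn eqxx. Qed.

Lemma monic_rcons (M : {poly int}) :
  M \is monic -> exists P : seq int, M = rcons P 1 :> seq int.
Proof.
rewrite monicE lead_coefE; case: (lastP M) => [|P c]; first by rewrite nth_nil.
by rewrite size_rcons nth_rcons ltnn eqxx => /eqP ->; exists P.
Qed.

(** Division by the monic annihilator leaves a remainder [r] whose exponents are below [size P],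
    hence at most [hi]. As an element of the graph module inside the window it lies in the lattice,
    and since it is supported on index [0] it is a combination of [C2], whose members are divisible
    by [q] over Q. *)
Lemma ann_cert_sound G f q : ann_cert G f q -> forall p, ann G f p -> qdvd (Poly q) p.
Proof.
move=> [lo [hi [B1 [B2 [C1 [C2 [P [W]]]]]]]].
move=> [/andP[/andP[/andP[/andP[tC /allP idxC1] /allP idxC2] lo0] hiP]] [BC [dC aP]] p ap.
set M := Poly (rcons P 1); have mM : M \is monic by apply: Poly_rcons1_monic.
have aM : ann G f M by rewrite /ann -comb_psv.
rewrite (Pdiv.RingMonic.rdivp_eq mM p); set r := Pdiv.Ring.rmodp p M.
apply: qdvdMDl; first by apply: qdvv_qdvd; rewrite -cf_psv; apply/qdvs_qdvv/dC/mem_head.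
have sr : (size r <= size P)%N.
  have := Pdiv.Ring.ltn_rmodp p M; rewrite monic_neq0 // -/r => lt_r.
  by move: lt_r; rewrite [size M](congr1 size (Poly_rcons1 P)) size_rcons ltnS.
have ar : ann G f r by apply: ann_mod.
apply: qdvv_qdvd; set u := pact r (cf e0).
have Bu : zspan (map snd B1 ++ B2) u.
  rewrite -[u]addr0; apply: window_cert_sound W _ _ _ _.
  - exact: rspan_graph.
  - exact: (span_sg _ _).1.
  - rewrite addr0 => e j lt_e; rewrite /u pact_e0; case: ifP => // /andP[le_e _]; lia.
  rewrite addr0 => e j lt_e; rewrite /u pact_e0; case: ifP => // /andP[le_e _].
  by rewrite nth_default //; apply: leq_trans sr _; move: hiP lt_e le_e; clear; lia.
have Cu : zspan (map snd C1 ++ C2) u by apply: zspan_min Bu; [apply: span_sg | exact: BC].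
have {}Cu : zspan C2 u.
  apply: (@tri_zspan (fun p => p.2 != 0%N) C1) => // [b [e j] /idxC2/allP b0 /= nj|[e j] /= nj].
    by apply: cf_notin; apply/mapP => -[t /b0 /eqP + ej]; move: nj; rewrite -ej /= => /eqP.
  by rewrite /u pact_e0 (negPf nj) andbF.
apply: (zspan_min (qdvv_sg q)) Cu => b bC; apply: qdvs_qdvv; apply: dC.
by rewrite inE bC orbT.
Qed.

(** The window is widened by [size P] so as to hold all remainders modulo [M]. Elimination with
    pivots at nonzero indices leaves [C2] on index [0]; by [graph_rspan] its members are
    annihilators up to a power of [X], so the divisibility hypothesis applies to them. *)
Lemma ann_cert_complete G f q (M : {poly int}) : M \is monic -> ann G f M ->
  (forall p, ann G f p -> qdvd (Poly q) p) -> ann_cert G f q.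
Proof.
move=> mM aM dI.
have [P eP] := monic_rcons mM.
have PM : Poly (rcons P 1) = M by rewrite -eP polyseqK.
have [n wn] := exp_bound (graph G f).
pose lo := - (n + size P)%N%:Z; pose hi := (n + size P)%N%:Z.
have lohi : lo <= hi by rewrite /lo /hi; lia.
have [|B1 [B2 [W mB]]] := @window_cert_ex (graph G f) [::] lo hi lohi.
  rewrite cats0; apply/allP => g /wn; apply: sub_all => t /= /andP[le1 le2].
  by rewrite /lo /hi; lia.
pose L := zspan (map snd B1 ++ B2).
have L_rspan u : L u -> rspan (graph G f) u.
  apply: zspan_min; first exact: span_sg.
  by move=> b /mB/inmod_nil.
have [D GD] := idx_bound (graph G f).
pose S1 := [seq p <- grid lo hi D | p.2 != 0%N].
have suppL l p : L l -> p \notin grid lo hi D -> l p = 0.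
  case: p => e j Ll ng; have [_ [_ [[_ C'] _]]] := W.
  have [al bl] := lattice_cert_win C' Ll.
  case: (ltP e lo) => [/al //|le1]; case: (ltP hi e) => [/bl //|le2].
  case: (leqP D j) => [le_Dj|lt_j]; last by rewrite mem_grid in ng.
  apply: (@inmod_idx (graph G f) [::] D); rewrite ?cats0 //.
  by exists l, 0; split; [apply: L_rspan | apply: (span_sg _ _).1 | rewrite addr0].
have [|||C1 [C2 [tC SC1 SC2 LC genC]]] := @split_basis S1 (grid lo hi D) L.
- exact: span_sg.
- by move=> l [w _ ->]; exists (comb (map snd B1 ++ B2) w).
- by move=> l p Ll _; apply: suppL.
exists lo, hi, B1, B2, C1, C2, P; split=> //.
have idx2 c t : c \in C2 -> t \in c -> t.2.2 == 0%N.
  move=> cC tc; have [Lc /(_ t tc) nz] : L (cf c) /\ forall t, t \in c -> cf c t.2 != 0.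
    by apply: LC; rewrite mem_cat cC orbT.
  apply: contraNT nz => nj; apply/eqP.
  case: (boolP (t.2 \in grid lo hi D)) => [tg|/(suppL _ _ Lc) //].
  by apply: SC2 => //; rewrite mem_filter nj.
split.
  rewrite tC /=; apply/andP; split; last by rewrite /hi; lia.
  apply/andP; split; last by rewrite /lo; lia.
  apply/andP; split; first by apply/allP => x /SC1; rewrite mem_filter => /andP[].
  by apply/allP => c cC; apply/allP => t; apply: idx2.
split=> [b bB|]; first by apply: genC; apply: zspan_gen.
split; last by rewrite comb_psv PM.
have qdvvs c : qdvv q (cf c) -> qdvs q c.
  move=> [m [b [nz e]]]; exists m, b; rewrite nz; apply/eqvP.
  by rewrite cf_scl sh0v.
move=> c; rewrite inE => /predU1P[->|cC].
  by apply: qdvvs; rewrite cf_psv PM; apply/qdvd_qdvv/dI.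
apply: qdvvs; have [Lc _] : L (cf c) /\ forall t, t \in c -> cf c t.2 != 0.
  by apply: LC; rewrite mem_cat cC orbT.
have [|w [ew aw]] := graph_rspan (L_rspan _ Lc).
  move=> e j; apply: cf_notin; apply/mapP => -[t tc ej].
  by have := idx2 c t cC tc; rewrite -ej.
have [k wk] := exp_bound [:: w]; have {}wk := wk w (mem_head _ _).
have /dI/qdvd_qdvv[m [b [nz e]]] : ann G f (topoly k w).
  by rewrite /ann pact_topoly //; apply: span_sh.
exists m, (scl 1 (- k%:Z) b); split=> //.
rewrite cf_comb_scl mulr1z -e pact_topoly // sh_mulz sh_sh addNr sh0v ew //.
Qed.

(** * Roots of integer polynomials *)

Notation pC p := (map_poly (intr : int -> algC) p).

(** On [{poly int}] the relation [%|] comes from pseudo-division: it allows a nonzero integer factor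
    on the dividend, and so means divisibility over Q. *)
Lemma pC_root_dvdp (r p : {poly int}) x : r %| p -> root (pC r) x -> root (pC p) x.
Proof.
case/Pdiv.Idomain.dvdpP=> -[c b] /= nz e /rootP rx.
have := congr1 (fun p => (pC p).[x]) e; rewrite rmorphM /= hornerM rx mulr0.
rewrite -mul_polyC rmorphM /= map_polyC hornerM hornerC => /eqP.
by rewrite mulf_eq0 intr_eq0 (negPf nz).
Qed.

Lemma pC_size (p : {poly int}) : size (pC p) = size p.
Proof. by apply: size_map_inj_poly => //; apply: intr_inj. Qed.

(** Pseudo-division stays over Z. Its remainder is divisible by [q] over [algC] yet shorter than
    [q], hence zero. *)
Lemma pC_dvdp (q p : {poly int}) : q != 0 -> pC q %| pC p -> q %| p.
Proof.
move=> nzq; have := Pdiv.Idomain.divp_eq p q; set c := lead_coef q ^+ _; set r := p %% q => e.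
have nzc : c != 0 by rewrite expf_neq0 // lead_coef_eq0.
have sr : (size r < size q)%N by rewrite ltn_modp.
move=> qp; apply/Pdiv.Idomain.dvdpP; exists (c, p %/ q) => //=; rewrite e.
suff -> : r = 0 by rewrite addr0.
have : pC q %| pC r.
  have -> : pC r = c%:~R *: pC p - pC (p %/ q) * pC q.
    by rewrite -rmorphM /= -map_polyZ e rmorphD /= addrC addKr.
  by rewrite dvdp_sub ?dvdp_mulIr // dvdpZr // intr_eq0.
apply: contraTeq => nzr; apply: contraL sr => /dvdp_leq.
by rewrite -size_poly_eq0 !pC_size size_poly_eq0 -leqNgt; apply.
Qed.

Lemma monic_roots (q : {poly int}) : q \is monic ->
  {rs : seq algC | pC q = \prod_(x <- rs) ('X - x%:P) & size q = (size rs).+1}.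
Proof.
move=> mq; have [rs e] := closed_field_poly_normal (pC q).
have lc : lead_coef (pC q) = 1.
  by apply/monicP; apply: monic_map.
rewrite lc scale1r in e; exists rs => //.
by rewrite -pC_size e size_prod_XsubC.
Qed.

(** For the product Q of the factors [X - x], the derivative is the sum of the Q/(X - x), and [X^k]
    is congruent to [x^k] modulo [X - x]. So the remainder of [X^k Q'] modulo Q is the sum of the
    [x^k Q/(X - x)], each quotient being monic of degree [size rs - 1]. The induction adds one root
    at a time. *)
Lemma power_sum_division (F : fieldType) (rs : seq F) k :
  exists B R : {poly F}, [/\ 'X^k * (\prod_(x <- rs) ('X - x%:P))^`() =
    B * \prod_(x <- rs) ('X - x%:P) + R, (size R <= size rs)%N &
    R`_(size rs).-1 = \sum_(x <- rs) x ^+ k].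
Proof.
elim: rs => [|x s [B [R [e sR cR]]]].
  by exists 0, 0; rewrite !big_nil -polyC1 derivC mulr0 mul0r addr0 size_poly0 coef0.
rewrite !big_cons; set Q := \prod_(y <- s) _ in e *.
have [T eT] : exists T, 'X^k = ('X - x%:P) * T + (x ^+ k)%:P.
  have /factor_theorem[T eT] : root ('X^k - (x ^+ k)%:P) x.
    by rewrite rootE !hornerE subrr.
  by exists T; rewrite mulrC -eT subrK.
exists (B + T), ((x ^+ k) *: Q + ('X - x%:P) * R); split.
- rewrite derivM derivXsubC mul1r mulrDr mulrCA e {1}eT -mul_polyC; ring.
- rewrite (leq_trans (size_polyD _ _)) // geq_max; apply/andP; split.
    by rewrite (leq_trans (size_scale_leq _ _)) // size_prod_XsubC.
  case: (eqVneq R 0) => [->|nz]; first by rewrite mulr0 size_poly0.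
  by rewrite size_proper_mul ?lead_coefXsubC ?mul1r ?lead_coef_eq0 // size_XsubC.
rewrite coefD coefZ /=; congr (_ + _).
  have -> : Q`_(size s) = lead_coef Q by rewrite lead_coefE size_prod_XsubC.
  by rewrite (monicP _) ?mulr1 // monic_prod_XsubC.
rewrite mulrBl coefB coefXM mul_polyC coefZ [R`_(size s)]nth_default // mulr0 subr0.
by case: (s) cR => [|y t] //= _; rewrite big_nil.
Qed.

Lemma division_unique (F : fieldType) (q b r b' r' : {poly F}) :
  b * q + r = b' * q + r' -> (size r < size q)%N -> (size r' < size q)%N -> r = r'.
Proof.
move=> e sr sr'; have := congr1 (fun p : {poly F} => p %% q) e.
by rewrite /= !modpD !modp_mull !add0r !modp_small.
Qed.

Lemma power_sum (q b r : {poly int}) rs k : pC q = \prod_(x <- rs) ('X - x%:P) ->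
  'X^k * q^`() = b * q + r -> (size r <= size rs)%N ->
  (r`_(size rs).-1)%:~R = \sum_(x <- rs) x ^+ k.
Proof.
move=> eq e sr; have [B [R [eR sR <-]]] := power_sum_division rs k.
rewrite -coef_map /=; suff -> : pC r = R by [].
apply: (@division_unique _ (pC q) (pC b) _ B).
- have := congr1 (fun p => pC p) e.
  rewrite rmorphM /= map_polyXn -deriv_map rmorphD rmorphM /= => <-.
  by rewrite eq eR.
- by rewrite eq size_prod_XsubC ltnS pC_size.
by rewrite eq size_prod_XsubC ltnS.
Qed.

Lemma bernoulli (R : numDomainType) (x : R) n : 0 <= x -> 1 + x *+ n <= (1 + x) ^+ n.
Proof.
move=> x0; elim: n => [|n IH]; first by rewrite addr0.
have x1 : 0 <= 1 + x by rewrite addr_ge0.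
rewrite exprS; apply: le_trans (ler_wpM2l x1 IH).
rewrite mulrDr mulr1 mulrDl mul1r mulrS addrA lerD2l lerDl.
by rewrite mulr_ge0 // mulrn_wge0.
Qed.

(** [(1 + 1/d)^j <= x^(Kj) <= H^K], and Bernoulli's inequality bounds the left side from below by
    [1 + j/d]. *)
Lemma power_growth (x : algC) (d K H j : nat) : (0 < d)%N -> 0 <= x ->
  1 + d%:R^-1 <= x ^+ K -> x ^+ j <= H%:R -> (j <= d * H ^ K)%N.
Proof.
move=> d0 x0 xK xj; have dp : 0 < d%:R :> algC by rewrite ltr0n.
have h1 : 1 + d%:R^-1 *+ j <= (H ^ K)%:R :> algC.
  apply: le_trans (bernoulli _ _) _; first by rewrite invr_ge0 ltW.
  have h0 : 0 <= 1 + d%:R^-1 :> algC by rewrite addr_ge0 // invr_ge0 ltW.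
  apply: le_trans (_ : (x ^+ K) ^+ j <= _).
    by apply: lerXn2r; rewrite ?nnegrE // exprn_ge0.
  by rewrite exprAC natrX; apply: lerXn2r; rewrite ?nnegrE ?exprn_ge0 ?ler0n.
have : d%:R^-1 *+ j <= (H ^ K)%:R :> algC by apply: le_trans h1; rewrite lerDr.
by rewrite -[X in X <= _]mulr_natl ler_pdivrMr // -natrM ler_nat mulnC.
Qed.

(** If every [|x|^K] were below [1 + 1/d] with [d = size rs], the sum would be below [d + 1] in
    absolute value, whereas the integer [|c|] is at least [d + 1]. *)
Lemma large_power_sum (rs : seq algC) K (c : int) : (size rs < `|c|)%N ->
  c%:~R = \sum_(x <- rs) x ^+ K ->
  exists2 x, x \in rs & 1 + (size rs)%:R^-1 <= `|x| ^+ K.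
Proof.
move=> lt_c ec; apply/hasP; apply: contraT => /hasPn small; exfalso.
have rs0 : (0 < size rs)%N.
  by case: rs ec lt_c {small} => // /eqP; rewrite big_nil intr_eq0 => /eqP ->.
have h1 : `|c|%:R <= \sum_(x <- rs) `|x| ^+ K :> algC.
  have -> : `|c|%:R = `|c%:~R| :> algC by rewrite -intr_norm -abszE.
  rewrite ec; apply: le_trans (ler_norm_sum _ _ _) _.
  by apply: ler_sum => x _; rewrite normrX.
have h2 : \sum_(x <- rs) `|x| ^+ K < \sum_(x <- rs) (1 + (size rs)%:R^-1).
  have lt x : x \in rs -> `|x| ^+ K < 1 + (size rs)%:R^-1.
    move=> /small; rewrite real_leNgt ?negbK //; last by rewrite realX ?normr_real.
    by rewrite realD ?realV ?realn ?real1.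
  rewrite [X in X < _](big_nth 0) [X in _ < X](big_nth 0); apply: ltr_sum_nat => // i /andP[_ lt_i].
  by apply: lt; rewrite mem_nth.
have := le_lt_trans h1 h2; rewrite big_const_seq count_predT iter_addr_0.
rewrite mulrnDl -[_^-1 *+ _]mulr_natl divff ?pnatr_eq0 -?lt0n // natr1 ltr_nat ltnS.
by rewrite leqNgt lt_c.
Qed.

Lemma pigeonhole (T : finType) (f : nat -> T) : exists i j, (i < j)%N /\ f i = f j.
Proof.
pose g (i : 'I_#|T|.+1) := f i.
case: (boolP (injectiveb g)) => [/injectiveP/leq_card|/injectivePn[i [j ne e]]].
  by rewrite card_ord ltnn.
have {}ne : (i : nat) != j by [].
by case: (ltngtP i j) ne => // lt _; [exists i, j|exists j, i].
Qed.

(** A Vandermonde argument that tolerates repetitions: pairing the weights with a polynomial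
    vanishing at all values of [rs] other than [y] leaves [w y] times a nonzero value times the
    multiplicity of [y]. *)
Lemma vanishing_sum (rs : seq algC) (w : algC -> algC) :
  (forall j, (j < size rs)%N -> \sum_(x <- rs) w x * x ^+ j = 0) ->
  forall x, x \in rs -> w x = 0.
Proof.
move=> w0 y yrs.
have pw (a : {poly algC}) : (size a <= size rs)%N -> \sum_(x <- rs) w x * a.[x] = 0.
  move=> sa; under eq_bigr => x _ do rewrite (horner_coef_wide _ sa) mulr_sumr.
  rewrite exchange_big big1 //= => i _.
  under eq_bigr => x _ do rewrite mulrCA.
  by rewrite -mulr_sumr w0 ?mulr0.
pose u := rem y (undup rs); pose a := \prod_(x <- u) ('X - x%:P).
have uu : uniq u by rewrite rem_uniq ?undup_uniq.
have memu x : (x \in u) = (x != y) && (x \in rs).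
  by rewrite mem_rem_uniq ?undup_uniq // inE mem_undup.
have sa : (size a <= size rs)%N.
  rewrite size_prod_XsubC size_rem ?mem_undup // prednK ?size_undup //.
  by case: (undup rs) (mem_undup rs y) => //; rewrite yrs.
have ay : a.[y] != 0 by rewrite -rootE root_prod_XsubC memu eqxx.
have := pw a sa; rewrite big_seq (eq_bigr (fun x => if x == y then w y * a.[y] else 0)).
  rewrite -big_seq -big_mkcond big_const_seq iter_addr_0 => /eqP.
  rewrite mulrn_eq0 mulf_eq0 (negPf ay) orbF => /orP[|/eqP//].
  by rewrite -leqn0 leqNgt -has_count has_pred1 yrs.
move=> x xrs; case: eqP => [->//|/eqP ne].
have /rootP-> : root a x by rewrite root_prod_XsubC memu ne.
by rewrite mulr0.
Qed.

(* Bounded power sums take finitely many values, hence repeat. *)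
Lemma kronecker (q : {poly int}) : q \is monic -> q`_0 != 0 ->
  (exists k b r, [/\ 'X^k * ('X * q^`()) = b * q + r, (size r < size q)%N &
     ((size q).-1 < `|(r`_(size q).-2)%R|)%N]) \/
  (exists2 h, (0 < h)%N & forall x, root (pC q) x -> x ^+ h = 1).
Proof.
move=> mq q0; set goal1 := (X in X \/ _); case: (EM goal1) => [?|no]; [by left|right].
have [rs eq sq] := monic_roots mq; set d := size rs in sq.
pose r k := Pdiv.Ring.rmodp ('X^k * ('X * q^`())) q.
have er k : 'X^k * ('X * q^`()) = Pdiv.Ring.rdivp ('X^k * ('X * q^`())) q * q + r k.
  exact: Pdiv.RingMonic.rdivp_eq.
have sr k : (size (r k) < size q)%N by rewrite Pdiv.Ring.ltn_rmodp monic_neq0.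
pose T k := (r k)`_d.-1.
have Tle k : (`|T k| <= d)%N.
  rewrite leqNgt; apply/negP => lt_d; apply: no; exists k.
  exists (Pdiv.Ring.rdivp ('X^k * ('X * q^`())) q), (r k).
  by split; [exact: er | exact: sr | rewrite sq].
have TE k : (T k)%:~R = \sum_(x <- rs) x ^+ k.+1.
  apply: (power_sum eq (b := Pdiv.Ring.rdivp ('X^k * ('X * q^`())) q)).
    by rewrite exprSr -mulrA; exact: er.
  by have := sr k; rewrite sq ltnS.
(* Blocks of [d] consecutive power sums, each in [[-d, d]] and moved to [[0, 2d]], take finitely
   many values. *)
have [i [j [lt_ij e]]] := pigeonhole
  (fun k => [ffun m : 'I_d => inord `|T (k + m)%N + d| : 'I_(d + d).+1]).
have Tij m : (m < d)%N -> T (i + m)%N = T (j + m)%N.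
  move=> lt_m; have := congr1 (fun f : {ffun 'I_d -> 'I_(d + d).+1} => val (f (Ordinal lt_m))) e.
  rewrite !ffunE /= !inordK; have := Tle (i + m)%N; have := Tle (j + m)%N; lia.
exists (j - i)%N; first by rewrite subn_gt0.
move=> x; rewrite eq root_prod_XsubC => xrs.
have nzx : x != 0.
  apply: contraNneq q0 => x0; have : root (pC q) 0 by rewrite eq root_prod_XsubC -x0.
  by rewrite rootE horner_coef0 coef_map /= intr_eq0.
(* Equality of the blocks at [i] and [j] says that these weights are orthogonal to the powers [x^m]
   with [m < d]. As [x] is nonzero, a vanishing weight gives [x^(j-i) = 1]. *)
have := @vanishing_sum rs (fun x => x ^+ i.+1 * (x ^+ (j - i) - 1)) _ x xrs.
move=> /(_ _)/eqP; rewrite mulf_eq0 expf_eq0 (negPf nzx) andbF subr_eq0.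
move=> H; apply/eqP; apply: H => m lt_m.
rewrite (eq_bigr (fun x => x ^+ (j + m).+1 - x ^+ (i + m).+1)) => [|y _].
  by rewrite sumrB -!TE (Tij m lt_m) subrr.
rewrite mulrBr mulr1 mulrBl -!exprD; congr (_ ^+ _ - _ ^+ _); lia.
Qed.

(** * Minimal integer polynomials, multiple roots and monic associates *)

Lemma int_root_minimal (x : algC) (p : {poly int}) : p != 0 -> root (pC p) x ->
  exists r : {poly int}, [/\ (1 < size r)%N, root (pC r) x &
    forall s : {poly int}, root (pC s) x -> r %| s].
Proof.
move=> nzp px.
pose Q n := `[< exists r : {poly int}, [/\ r != 0, root (pC r) x & size r = n] >].
have exQ : exists n, Q n by exists (size p); apply/asboolP; exists p.
case: (ex_minnP exQ) => m /asboolP[r [nzr rx <-]] min_r; exists r; split=> //.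
  rewrite ltnNge; apply: contra nzr => /size1_polyC er.
  move: rx; rewrite er map_polyC rootE hornerC intr_eq0 => /eqP ->.
  by rewrite polyC_eq0.
move=> s sx; rewrite /dvdp; apply: contraT => nz.
have e := Pdiv.Idomain.divp_eq s r.
have /min_r : Q (size (s %% r)).
  apply/asboolP; exists (s %% r); split=> //.
  have -> : s %% r = lead_coef r ^+ scalp s r *: s - s %/ r * r by rewrite e addrC addKr.
  rewrite rootE rmorphB rmorphM /= map_polyZ !hornerE.
  by rewrite (rootP sx) (rootP rx) !mulr0 subrr.
by rewrite leqNgt ltn_modp nzr.
Qed.

(** If the roots are distinct, the linear factors of [q] are distinct factors of [X^h - 1].
    Otherwise a repeated root is a common root of [q], [X q'] and [X^h - 1], and its minimal integer
    polynomial [r] divides all three: a witness that does not mention the root. *)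
Lemma roots_of_unity (q : {poly int}) h : q \is monic -> (0 < h)%N ->
  (forall x, root (pC q) x -> x ^+ h = 1) ->
  q %| 'X^h - 1 \/
  exists r : {poly int}, [/\ (1 < size r)%N, r %| q, r %| 'X * q^`() & r %| 'X^h - 1].
Proof.
move=> mq h0 xh; have [rs eq sq] := monic_roots mq.
have pCX1 : pC ('X^h - 1) = 'X^h - 1 by rewrite rmorphB /= map_polyXn rmorph1.
have rootX1 x : root (pC q) x -> root (pC ('X^h - 1)) x.
  by move=> /xh e; rewrite pCX1 rootE !hornerE e subrr.
case: (boolP (uniq rs)) => [urs|nurs].
  left; apply: pC_dvdp; first exact: monic_neq0.
  rewrite [pC q]eq; apply: uniq_roots_dvdp; last by rewrite uniq_rootsE.
  by apply/allP => x xrs; apply: rootX1; rewrite eq root_prod_XsubC.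
right; have [x [s es]] : exists x s, pC q = ('X - x%:P) * (('X - x%:P) * s).
  have [x xrs cx] : exists2 x, x \in rs & (1 < count_mem x rs)%N.
    apply/hasP; apply: contraNT nurs => /hasPn small; apply: count_mem_uniq => x.
    case: (boolP (x \in rs)) => xrs; last by apply/count_memPn.
    by apply/eqP; rewrite eqn_leq leqNgt small //= -has_count has_pred1.
  have p1 := perm_to_rem xrs.
  have xrs' : x \in rem x rs.
    by move/permP/(_ (pred1 x)): p1 cx => -> /=; rewrite eqxx add1n ltnS -has_count has_pred1.
  exists x, (\prod_(y <- rem x (rem x rs)) ('X - y%:P)).
  by rewrite eq (perm_big _ p1) big_cons (perm_big _ (perm_to_rem xrs')) big_cons.
have qx : root (pC q) x by rewrite es rootE hornerM hornerXsubC subrr mul0r.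
have q'x : root (pC ('X * q^`())) x.
  rewrite rmorphM /= -deriv_map es derivM derivXsubC mul1r rootE.
  by rewrite hornerM hornerD !hornerM hornerXsubC subrr !mul0r addr0 mulr0.
have [r [sr _ rdvd]] := int_root_minimal (monic_neq0 mq) qx.
by exists r; split=> //; apply: rdvd => //; apply: rootX1.
Qed.

(* Gauss's lemma. *)
Lemma monic_associate (a M : {poly int}) : M \is monic -> a %| M ->
  exists q : {poly int}, [/\ q \is monic, a %| q & q %| a].
Proof.
move=> mM aM; pose pQ (p : {poly int}) := map_poly (intr : int -> rat) p.
have nza : a != 0 by apply: contraTneq aM => ->; rewrite dvd0p monic_neq0.
have : pQ a %| pQ M.
  have /Pdiv.Idomain.dvdpP[[c b] /= nz e] := aM.
  apply/dvdpP; exists ((c%:~R : rat)^-1 *: pQ b).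
  rewrite -scalerAl -rmorphM /= -e map_polyZ scalerA mulVf ?scale1r //.
  by rewrite intr_eq0.
move=> /dvdpP_rat_int[p1 [k nzk ek] [r eM]].
have lc1 : lead_coef p1 * lead_coef r = 1 by rewrite -lead_coefM -eM (monicP mM).
pose q := lead_coef r *: p1.
have nzr : lead_coef r != 0 by apply: contra_eq_neq lc1 => ->; rewrite mulr0 eq_sym oner_eq0.
have mq : q \is monic by rewrite monicE lead_coefZ mulrC lc1.
have p1q : (p1 %= q) by rewrite eqp_sym eqp_scale.
have ap : (a %= p1).
  have ed : (denq k)%:~R *: pQ a = (numq k)%:~R *: pQ p1.
    rewrite [pQ a]ek scalerA -{2}(divq_num_den k) mulrC divfK //.
    by rewrite intr_eq0 denq_neq0.
  have e : denq k *: a = numq k *: p1.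
    apply: (map_inj_poly (f := intr : int -> rat)) => //; first exact: intr_inj.
    by rewrite !map_polyZ.
  apply/Pdiv.Idomain.eqpP; exists (denq k, numq k) => //=.
  by rewrite denq_neq0 numq_eq0.
by exists q; case/andP: (eqp_trans ap p1q).
Qed.

(** * Bounds on the exponents *)

Definition reaches (G : seq svec) (f0 f1 : svec) (z : int) :=
  rspan G (sh z (cf f1) - cf f0).

Definition norm1 (w : svec) : nat := (\sum_(t <- w) absz t.1)%N.

Lemma norm1_cons t w : norm1 (t :: w) = (absz t.1 + norm1 w)%N.
Proof. exact: big_cons. Qed.

Lemma in_win_widen (e n : nat) w : (e <= n)%N -> in_win (- e%:Z) e w -> in_win (- n%:Z) n w.
Proof. by move=> le; apply: sub_all => t /= /andP[]; lia. Qed.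

Section Orbit.
Variables (G : seq svec) (f0 f1 : svec).
Notation N := (rspan G).

Lemma comb1_sg w f z : N (cf f0 - sh z (cf f)) ->
  N (cf (comb [:: f0] w) - sh z (cf (comb [:: f] w))).
Proof.
move=> Nf; elim: w => [|[c [k i]] w IH].
  by rewrite cf_nil (sh_eq0 z 0).2 // subrr; apply: (span_sg _ _).1.
rewrite !comb_cons !cf_cat shD opprD addrACA; apply: sgD IH; first exact: span_sg.
rewrite !cf_scl /=; case: i => [|i] /=.
  rewrite sh_mulz -mulrzBl sh_sh [z + k]addrC -sh_sh -shB; apply: sgZ; first exact: span_sg.
  exact: span_sh.
by rewrite nth_nil cf_nil !(sh_eq0 _ 0).2 ?mul0rz // subrr; apply: (span_sg _ _).1.
Qed.

Variables (w0 w1 : svec) (e : nat).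
Hypotheses (N0 : N (cf f0 - cf (comb [:: f1] w0))) (N1 : N (cf f1 - cf (comb [:: f0] w1))).
Hypotheses (we0 : in_win (- e%:Z) e w0) (we1 : in_win (- e%:Z) e w1).

Lemma orbit0 z : reaches G f0 f1 z -> N (sh z (cf f1) - cf (comb [:: f1] w0)).
Proof.
move=> oz; rewrite -(subrK (cf f0) (sh z _)) -addrA; apply: sgD => //; exact: span_sg.
Qed.

Lemma orbit1 z : reaches G f0 f1 z -> N (cf f1 - sh z (cf (comb [:: f1] w1))).
Proof.
move=> oz; rewrite -(subrK (cf (comb [:: f0] w1)) (cf f1)) -addrA; apply: sgD => //.
  exact: span_sg.
apply: comb1_sg; rewrite -opprB; apply: sgN => //; exact: span_sg.
Qed.

Lemma orbit_ann0 z n : reaches G f0 f1 z -> (e <= n)%N -> 0 <= n%:Z + z ->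
  ann G f1 ('X^`|n%:Z + z| - topoly n w0).
Proof.
move=> oz len ge0; rewrite /ann pactB pactXn pact_topoly; last exact: in_win_widen len we0.
rewrite gez0_abs // -sh_sh -shB; apply: span_sh => //; exact: orbit0.
Qed.

(** [w1] expresses [f1] through [f0], so it plays the role of [X^-z] on [f1]; this relation serves
    for negative [z], as [orbit_ann0] does for the others. *)
Lemma orbit_ann1 z n n' : reaches G f0 f1 z -> (e <= n')%N -> n'%:Z = n%:Z + z ->
  ann G f1 ('X^n - topoly n' w1).
Proof.
move=> oz len en; rewrite /ann pactB pactXn pact_topoly; last exact: in_win_widen len we1.
by rewrite en -sh_sh -shB; apply: span_sh => //; exact: orbit1.
Qed.

Lemma shift_nspan z w : in_win (- e%:Z) e w -> z < - e%:Z ->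
  nspan [:: scl 1 (- 1) f1] (sh z (cf (comb [:: f1] w))).
Proof.
move=> + lt_z; elim: w => [|[c [k i]] w IH] /=.
  by rewrite cf_nil (sh_eq0 z 0).2 //; move=> _; apply: (span_sg _ _).1.
case/andP=> /andP[le1 le2] /IH Nw; rewrite comb_cons cf_cat shD; apply: sgD Nw => //.
  exact: span_sg.
rewrite cf_scl /= sh_mulz; apply: sgZ; first exact: span_sg.
case: i => [|i] /=; last by rewrite nth_nil cf_nil !(sh_eq0 _ 0).2 //; apply: (span_sg _ _).1.
rewrite sh_sh -[z + k](subrK (- 1)) -sh_sh -[sh (- 1) (cf f1)]mulr1z -cf_scl.
by apply: span_gen; [lia | rewrite inE].
Qed.

(** For [z > e] all exponents of [X^-z w0] are negative, and [f1] is [X^-z w0] applied to itself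
    modulo [N]; for [z < -e] the same holds with [X^z w1]. Either way [f1] falls into X^-1 Z[X^-1]
    f1 modulo [N]. *)
Lemma nonarchimedean_bound z : ~ inmod G [:: scl 1 (- 1) f1] (cf f1) ->
  reaches G f0 f1 z -> (`|z| <= e)%N.
Proof.
move=> nm oz; rewrite leqNgt; apply/negP => lt_e; apply: nm.
case: (leP 0 z) => [le0|lt0].
  exists (sh (- z) (sh z (cf f1) - cf (comb [:: f1] w0))), (sh (- z) (cf (comb [:: f1] w0))).
  split; [|apply: shift_nspan => //; lia|].
    by apply: span_sh => //; apply: orbit0.
  by rewrite shB subrK sh_sh addNr sh0v.
exists (cf f1 - sh z (cf (comb [:: f1] w1))), (sh z (cf (comb [:: f1] w1))).
split; [exact: orbit1|apply: shift_nspan => //; lia|by rewrite subrK].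
Qed.

End Orbit.

(** * Bounds from the roots of the generator of the annihilator *)

Lemma qdvd_root (q p : {poly int}) x : qdvd q p -> root (pC q) x -> x != 0 -> root (pC p) x.
Proof.
move=> [m [n [b [nz e]]]] /rootP qx nzx.
have := congr1 (fun p => (pC p).[x]) e; rewrite map_polyZ !rmorphM /= map_polyXn.
rewrite hornerZ !hornerM hornerXn qx mulr0 => /eqP.
by rewrite !mulf_eq0 intr_eq0 (negPf nz) expf_eq0 (negPf nzx) andbF.
Qed.

Lemma qdvd_root_deriv (q p : {poly int}) x : qdvd q p -> root (pC q) x ->
  root (pC q^`()) x -> x != 0 -> root (pC p^`()) x.
Proof.
move=> qp qx /rootP q'x nzx; have /rootP px := qdvd_root qp qx nzx.
case: qp => [m [n [b [nz e]]]].
have := congr1 (fun p => (pC p^`()).[x]) e.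
rewrite derivZ !derivM map_polyZ !rmorphD !rmorphM /= map_polyXn.
rewrite hornerZ !hornerD !hornerM hornerXn (rootP qx) q'x px !mulr0 addr0 add0r => /eqP.
by rewrite !mulf_eq0 intr_eq0 (negPf nz) expf_eq0 (negPf nzx) andbF.
Qed.

Lemma topoly_horner n w x : (pC (topoly n w)).[x] =
  \sum_(t <- w | t.2.2 == 0%N) t.1%:~R * x ^+ `|t.2.1 + n%:Z|.
Proof.
rewrite /topoly rmorph_sum /= horner_sum; apply: eq_bigr => t _.
by rewrite map_polyZ map_polyXn hornerZ hornerXn.
Qed.

Lemma norm_intr_nat (c : int) : `|c%:~R| = `|c|%:R :> algC.
Proof. by rewrite -intr_norm -abszE. Qed.

Lemma topoly_bound (n e : nat) w x : in_win (- e%:Z) e w -> (e <= n)%N -> 1 <= `|x| ->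
  `|(pC (topoly n w)).[x]| <= (norm1 w)%:R * `|x| ^+ (n + e).
Proof.
move=> we len x1; rewrite topoly_horner.
elim: w we => [|[c [k i]] w IH] /=; first by rewrite big_nil normr0 mulr_ge0 ?exprn_ge0.
case/andP=> /andP[le1 le2] /IH {}IH; rewrite big_cons norm1_cons natrD mulrDl /=.
have h : `|c%:~R * x ^+ absz (k + n%:Z)| <= `|c|%:R * `|x| ^+ (n + e).
  rewrite normrM normrX norm_intr_nat ler_wpM2l // ler_weXn2l //; lia.
case: ifP => _; last by apply: le_trans IH _; rewrite lerDr mulr_ge0 ?exprn_ge0.
by apply: le_trans (ler_normD _ _) _; apply: lerD.
Qed.

Lemma X_derivXn (x : algC) k : x * (x ^+ k.-1 *+ k) = x ^+ k *+ k.
Proof. by case: k => [|k]; rewrite ?mulr0n ?mulr0 // mulrnAr -exprS. Qed.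

Lemma topoly_deriv n w x : x * (pC (topoly n w)^`()).[x] =
  \sum_(t <- w | t.2.2 == 0%N) t.1%:~R * (x ^+ absz (t.2.1 + n%:Z) *+ absz (t.2.1 + n%:Z)).
Proof.
rewrite /topoly; elim/big_rec2: _ => [|t y p _ IH].
  by rewrite -polyC0 derivC rmorph0 horner0 mulr0.
rewrite derivD rmorphD /= hornerD mulrDr IH derivZ derivXn map_polyZ rmorphMn /= map_polyXn.
by rewrite hornerZ hornerMn hornerXn mulrCA X_derivXn.
Qed.

Section ArchimedeanBound.
Variables (G : seq svec) (f0 f1 : svec) (w0 w1 : svec) (e H : nat) (q : {poly int}).
Hypotheses (N0 : rspan G (cf f0 - cf (comb [:: f1] w0))).
Hypotheses (N1 : rspan G (cf f1 - cf (comb [:: f0] w1))).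
Hypotheses (we0 : in_win (- e%:Z) e w0) (we1 : in_win (- e%:Z) e w1).
Hypotheses (H0 : (norm1 w0 <= H)%N) (H1 : (norm1 w1 <= H)%N).
Hypothesis Iq : forall p, ann G f1 p -> qdvd q p.

Lemma power_bound x n w j : root (pC ('X^(j + n + e) - topoly n w)) x ->
  in_win (- e%:Z) e w -> (e <= n)%N -> (norm1 w <= H)%N -> 1 <= `|x| -> `|x| ^+ j <= H%:R.
Proof.
move=> /rootP; rewrite rmorphB /= map_polyXn hornerD hornerN hornerXn => /eqP.
rewrite subr_eq0 => /eqP ex we len leH x1; have := topoly_bound we len x1.
rewrite -ex normrX -addnA exprD ler_pM2r ?exprn_gt0 ?(lt_le_trans ltr01) //.
by move/le_trans; apply; rewrite ler_nat.
Qed.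

(** At the root, [|x|^|z|] is the absolute value of [w0] or [w1] at [x], according to the sign of
    [z], hence at most [H |x|^e]. So [|x|^(|z| - e) <= H], and [power_growth] bounds [|z| - e] by
    [d * H ^ K]. *)
Lemma archimedean_bound x (d K : nat) z : (0 < d)%N -> (0 < K)%N -> root (pC q) x ->
  1 + d%:R^-1 <= `|x| ^+ K -> reaches G f0 f1 z -> (`|z| <= e + d * H ^ K)%N.
Proof.
move=> d0 K0 qx xK oz; have x1 : 1 <= `|x|.
  rewrite -(@ler_pXn2r _ K) ?nnegrE // expr1n; apply: le_trans xK.
  by rewrite lerDl invr_ge0.
have nzx : x != 0 by rewrite -normr_gt0 (lt_le_trans ltr01).
case: (leqP `|z| e) => [le_e|lt_e]; first by rewrite (leq_trans le_e) ?leq_addr.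
rewrite -leq_subLR; apply: (power_growth d0 _ xK) => //.
have rootI p : ann G f1 p -> root (pC p) x by move=> /Iq ip; apply: qdvd_root ip qx nzx.
case: (leP 0 z) => [le0|lt0].
  apply: (@power_bound x e w0) => //; apply: rootI.
  have := orbit_ann0 N0 we0 oz (leqnn e).
  rewrite (_ : absz (e%:Z + z)%R = `|z| - e + e + e)%N; last by lia.
  by apply; lia.
apply: (@power_bound x e w1) => //; apply: rootI.
apply: (orbit_ann1 N1 we1 oz) => //; lia.
Qed.

(** At a multiple root the relation [x^z = w0(x)] may be differentiated, so [z x^z] is the sum of
    [c l x^l] over the terms [c X^l] of [w0]. Since [|x| = 1], that sum is at most [H e] in absolute
    value. *)
Lemma unipotent_bound x h z : (0 < h)%N -> x ^+ h = 1 -> root (pC q) x -> root (pC q^`()) x ->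
  reaches G f0 f1 z -> (`|z| <= H * e)%N.
Proof.
clear N1 we1 H1; move=> h0 xh qx q'x oz.
have nzx : x != 0 by apply: contra_eq_neq xh => ->; rewrite expr0n gtn_eqF // eq_sym oner_eq0.
have x1 : `|x| = 1.
  apply/eqP; rewrite -(@pexpr_eq1 _ _ h) // -normrX xh normr1 //.
pose n := (e + `|z|)%N; pose k := absz (n%:Z + z).
have ge0 : 0 <= n%:Z + z by rewrite /n; lia.
have /Iq Ip : ann G f1 ('X^k - topoly n w0).
  by apply: (orbit_ann0 N0 we0 oz) => //; rewrite leq_addr.
have /rootP := qdvd_root Ip qx nzx; have /rootP := qdvd_root_deriv Ip qx q'x nzx.
rewrite derivB derivXn !rmorphB /= rmorphMn /= !map_polyXn !hornerD !hornerN hornerMn !hornerXn.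
move=> /(congr1 (fun y => x * y)); rewrite mulr0 mulrBr topoly_deriv X_derivXn => /eqP.
(* Both relations come multiplied by [X^n] to make exponents nonnegative. Subtracting [n] times the
   relation [e2] from the differentiated one [e1] restores the exponents [z] and [l] as factors. *)
rewrite subr_eq0 => /eqP e1 /eqP; rewrite subr_eq0 topoly_horner => /eqP e2.
have ez : z%:~R * x ^+ k = \sum_(t <- w0 | t.2.2 == 0%N)
    t.1%:~R * ((absz (t.2.1 + n%:Z))%:R - n%:R) * x ^+ absz (t.2.1 + n%:Z).
  have -> : z = k%:Z - n%:Z by rewrite /k; lia.
  rewrite rmorphB /= mulrBl mulr_natl e1 -mulr_natl e2 mulr_sumr -sumrB.
  by apply: eq_bigr => t _; rewrite -mulr_natr; ring.
rewrite -(ler_nat algC) natrM -norm_intr_nat.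
have -> : `|z%:~R| = `|z%:~R * x ^+ k| :> algC by rewrite normrM normrX x1 expr1n mulr1.
rewrite ez; apply: le_trans (_ : (norm1 w0)%:R * e%:R <= _); last first.
  by rewrite ler_wpM2r // ler_nat.
have len : (e <= n)%N by rewrite leq_addr.
elim: (w0) we0 => [|[c [l i]] w IH] /=; first by rewrite big_nil normr0 mulr_ge0.
case/andP=> /andP[le1 le2] /IH {}IH; rewrite big_cons norm1_cons natrD mulrDl /=.
case: ifP => _; last by apply: le_trans IH _; rewrite lerDr mulr_ge0.
apply: le_trans (ler_normD _ _) (lerD _ IH).
rewrite !normrM normrX x1 expr1n mulr1 norm_intr_nat ler_wpM2l //.
have -> : (absz (l + n%:Z))%:R - n%:R = l%:~R :> algC.
  have {2}-> : l = (absz (l + n%:Z))%:Z - n%:Z by lia.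
  by rewrite rmorphB.
by rewrite norm_intr_nat ler_nat; lia.
Qed.

End ArchimedeanBound.

(** * Certificates for the absence of solutions *)

(** The Euler operator X d/dX: it keeps positions, so it acts entry by entry on sparse vectors. *)
Definition theta (s : svec) : svec := [seq (t.1 * t.2.1, t.2) | t <- s].

Lemma cf_thetaE s p : cf (theta s) p = cf s p * p.1.
Proof.
rewrite /cf big_map mulr_suml; apply: eq_bigr => t _ /=.
by case: eqP => [->|]; rewrite ?mul0r.
Qed.

Lemma cf_theta (s : seq int) : cf (theta (psv s)) = pact ('X * (Poly s)^`()) (cf e0).
Proof.
apply: funext => -[e j]; rewrite cf_thetaE cf_psv !pact_e0 coefXM coef_deriv /=.
case: ifP => [/andP[le0 _]|]; last by rewrite mul0r.
case: e le0 => // -[|n] _; first by rewrite mulr0.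
by rewrite -mulr_natr natz.
Qed.

Lemma cf_scl1 k s : cf (scl 1 k s) = sh k (cf s).
Proof. by rewrite cf_scl mulr1z. Qed.

Definition dvds (r : seq int) (s : svec) : Prop :=
  exists m (b : seq int), (m != 0) && eqv (scl m 0 s) (comb [:: psv r] (psv b)).

Lemma dvdsP r s p : cf s = pact p (cf e0) -> dvds r s <-> Poly r %| p.
Proof.
have key m b : cf (scl m 0 s) = cf (comb [:: psv r] (psv b)) <->
    cf s *~ m = pact (Poly b * Poly r) (cf e0).
  by rewrite cf_scl sh0v comb_psv cf_psv pactM.
move=> es; split=> [[m [b /andP[nz /eqvP/key]]]|/Pdiv.Idomain.dvdpP[[m b] /= nz e]].
  rewrite es -pactZ => /pact_e0_inj e.
  by apply/Pdiv.Idomain.dvdpP; exists (m, Poly b).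
by exists m, b; rewrite nz; apply/eqvP/key; rewrite es -pactZ e polyseqK.
Qed.

(* A power sum exceeding the degree: some root lies outside the unit circle. *)
Definition expanding_cert (q : seq int) (k : nat) : Prop :=
  exists b r : seq int, (size r <= size q)%N && (size q < absz (nth 0%R r (size q).-1))%N &&
    eqv (scl 1 k%:Z (theta (psv (rcons q 1)))) (comb [:: psv (rcons q 1)] (psv b) ++ psv r).

(* A common root with the derivative that is a root of unity. *)
Definition unipotent_cert (q : seq int) : Prop :=
  exists (h : nat) (r : seq int), ((0 < h)%N && (1 < size r)%N && (nth 0 r (size r).-1 != 0)) /\
    (dvds r (psv (rcons q 1)) /\ (dvds r (theta (psv (rcons q 1))) /\
     dvds r [:: (1, (h%:Z, 0%N)); (-1, (0, 0%N))])).

Lemma size_Poly_rcons1 (q : seq int) : size (Poly (rcons q 1)) = (size q).+1.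
Proof. by rewrite (congr1 size (Poly_rcons1 q)) size_rcons. Qed.

Lemma expanding_eq (q : seq int) k (b r : seq int) :
  cf (scl 1 k%:Z (theta (psv (rcons q 1)))) = cf (comb [:: psv (rcons q 1)] (psv b) ++ psv r) <->
  'X^k * ('X * (Poly (rcons q 1))^`()) = Poly b * Poly (rcons q 1) + Poly r.
Proof.
rewrite cf_scl1 cf_theta cf_cat comb_psv !cf_psv -pactM -pactD -pact_shift.
by split=> [/pact_e0_inj|->].
Qed.

Lemma expanding_sound q k : expanding_cert q k ->
  exists2 x, root (pC (Poly (rcons q 1))) x & (0 < size q)%N /\
    1 + (size q)%:R^-1 <= `|x| ^+ k.+1.
Proof.
move=> [b [r /andP[/andP[sr lt_q] /eqvP/expanding_eq e]]].
have [rs eq sq] := monic_roots (Poly_rcons1_monic q).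
have {sq}sq : size rs = size q by move: sq; rewrite size_Poly_rcons1 => -[].
have := power_sum eq (k := k.+1) (b := Poly b) (r := Poly r).
rewrite exprSr -mulrA e sq => /(_ erefl (leq_trans (size_Poly _) sr)).
rewrite coef_Poly -sq => es; rewrite -sq in lt_q.
have [x xrs xk] := large_power_sum lt_q es.
exists x; first by rewrite eq root_prod_XsubC.
by split=> //; case: (rs) xrs.
Qed.

Lemma expanding_complete (q : seq int) k (b r : {poly int}) :
  'X^k * ('X * (Poly (rcons q 1))^`()) = b * Poly (rcons q 1) + r ->
  (size r <= size q)%N -> (size q < absz (r`_(size q).-1)%R)%N -> expanding_cert q k.
Proof.
move=> e sr lt_q; exists b, r; rewrite sr lt_q; apply/eqvP/expanding_eq.
by rewrite !polyseqK.
Qed.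

Lemma psv_Xh1 h : cf [:: (1, (h%:Z, 0%N)); (-1, (0, 0%N))] = pact ('X^h - 1) (cf e0).
Proof.
rewrite pactB pactXn pact1 cf_cons -(cf_scl1 h%:Z e0) /scl /= mulr1 add0r; congr (_ + _).
by rewrite (_ : [:: (-1, (0, 0%N))] = scl (-1) 0 e0) // cf_scl sh0v mulrNz.
Qed.

Lemma unipotent_sound q : unipotent_cert q ->
  exists x h, [/\ (0 < h)%N, x ^+ h = 1, root (pC (Poly (rcons q 1))) x &
    root (pC (Poly (rcons q 1))^`()) x].
Proof.
move=> [h [r [/andP[/andP[h0 sr] nz] [/(dvdsP r (cf_psv _)) rq]]]].
move=> [/(dvdsP r (cf_theta _)) rq' /(dvdsP r (psv_Xh1 h)) rX].
have [x rx] : exists x, root (pC (Poly r)) x.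
  have /closed_rootP[x] : size (pC (Poly r)) != 1%N; last by exists x.
  by rewrite pC_size (@PolyK _ 0) ?nth_last ?gtn_eqF // -nth_last.
have xh : x ^+ h = 1.
  have := pC_root_dvdp rX rx; rewrite rmorphB /= map_polyXn rmorph1 rootE !hornerE.
  by rewrite subr_eq0 => /eqP.
exists x, h; split=> //; first exact: pC_root_dvdp rq rx.
have := pC_root_dvdp rq' rx; rewrite rmorphM /= map_polyX rootM rootX.
case/orP=> // /eqP x0; move: xh; rewrite x0 expr0n gtn_eqF // => /eqP.
by rewrite eq_sym oner_eq0.
Qed.

Lemma unipotent_complete (q : seq int) h (r : {poly int}) : (0 < h)%N -> (1 < size r)%N ->
  r %| Poly (rcons q 1) -> r %| 'X * (Poly (rcons q 1))^`() -> r %| 'X^h - 1 ->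
  unipotent_cert q.
Proof.
move=> h0 sr rq rq' rX; exists h, r; split.
  by rewrite h0 sr -lead_coefE lead_coef_eq0 -size_poly_gt0 ltnW.
by split; [|split]; apply/dvdsP;
  [exact: cf_psv| |exact: cf_theta| |exact: psv_Xh1|]; rewrite polyseqK.
Qed.

(** [B] need not bound every solution: given a period [h], only some solution is within [B]. In the
    other cases [B] dominates the constants of [nonarchimedean_bound], [archimedean_bound] and
    [unipotent_bound]. Since [rcons q 1] lists a monic polynomial, [size q] is its degree. *)
Definition bound_cert (G : seq svec) (f0 f1 : svec) (B : nat) : Prop :=
  (exists h : nat, ((0 < h)%N && (h <= B)%N) /\
     rspan G (cf (scl 1 h%:Z f1 ++ scl (-1) 0 f1))) \/
  exists w0 w1 (e H : nat),
    (in_win (- e%:Z) e w0 && in_win (- e%:Z) e w1 && (norm1 w0 <= H)%N && (norm1 w1 <= H)%N) /\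
    (rspan G (cf (f0 ++ scl (-1) 0 (comb [:: f1] w0))) /\
    (rspan G (cf (f1 ++ scl (-1) 0 (comb [:: f0] w1))) /\
    (((e <= B)%N /\ nonmem_cert G [:: scl 1 (- 1) f1] f1) \/
     exists q, ann_cert G f1 (rcons q 1) /\
       ((exists k : nat, (e + size q * H ^ k.+1 <= B)%N /\ expanding_cert q k) \/
        ((H * e <= B)%N /\ unipotent_cert q))))).

Lemma cf_catN s t : cf (s ++ scl (-1) 0 t) = cf s - cf t.
Proof. by rewrite cf_cat cf_scl sh0v. Qed.

Lemma bound_sound G f0 f1 B z : bound_cert G f0 f1 B -> reaches G f0 f1 z ->
  exists2 z', reaches G f0 f1 z' & (`|z'| <= B)%N.
Proof.
case=> [[h [/andP[h0 leB]]]|].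
  rewrite cf_catN cf_scl1 => per oz; exists (z %% h%:Z)%Z; last first.
    by have := ltz_pmod z (d := h%:Z); have := modz_ge0 z (d := h%:Z); lia.
  have step (n : nat) k : rspan G (sh (k + (h * n)%N%:Z) (cf f1) - sh k (cf f1)).
    elim: n k => [|n IH] k; first by rewrite muln0 addr0 subrr; apply: (span_sg _ _).1.
    rewrite -(subrK (sh (k + h%:Z) (cf f1)) (sh _ _)) -addrA; apply: sgD; first exact: span_sg.
      have -> : k + (h * n.+1)%N%:Z = k + h%:Z + (h * n)%N%:Z by rewrite mulnS; lia.
      exact: IH.
    by rewrite -sh_sh -shB; apply: span_sh.
  have stepz (n : int) k : rspan G (sh (k + h%:Z * n) (cf f1) - sh k (cf f1)).
    case: n => n; first by rewrite -PoszM; apply: step.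
    rewrite -opprB; apply: sgN; first exact: span_sg.
    have {1}-> : k = k + h%:Z * Negz n + (h * n.+1)%N%:Z by rewrite NegzE PoszM; ring.
    exact: step.
  have ez : (z %% h%:Z)%Z + h%:Z * (z %/ h%:Z)%Z = z by rewrite addrC mulrC -divz_eq.
  have := stepz (z %/ h%:Z)%Z (z %% h%:Z)%Z; rewrite ez => sz.
  rewrite /reaches -(subrK (sh z (cf f1)) (sh (z %% h%:Z)%Z _)) -addrA.
  by apply: (sgD (span_sg _ _)) => //; rewrite -opprB; apply: (sgN (span_sg _ _)).
move=> [w0 [w1 [e [H [/andP[/andP[/andP[we0 we1] H0] H1] [+ [+ C]]]]]]].
rewrite !cf_catN => N0 N1 oz; exists z => //.
case: C => [[leB /nonmem_certP nm]|[q [/ann_cert_sound Iq []]]].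
- by apply: leq_trans leB; apply: (nonarchimedean_bound N0 N1 we0 we1 nm oz).
- move=> [k [leB /expanding_sound[x qx [q0 xk]]]]; apply: leq_trans leB.
  exact: (archimedean_bound N0 N1 we0 we1 H0 H1 Iq _ _ qx xk oz).
move=> [leB /unipotent_sound[x [h [h0 xh qx q'x]]]]; apply: leq_trans leB.
exact: (unipotent_bound N0 we0 H0 Iq h0 xh qx q'x oz).
Qed.

Definition yes_cert (G : seq svec) (f0 f1 : svec) : Prop :=
  exists z : int, rspan G (cf (scl 1 z f1 ++ scl (-1) 0 f0)).

(** Either one of [f0], [f1] is not a multiple of the other modulo the span of [G], or every
    candidate [i - B], running through [[-B, B]], fails. *)
Definition no_cert (G : seq svec) (f0 f1 : svec) : Prop :=
  (nonmem_cert (f1 :: G) [::] f0 \/ nonmem_cert (f0 :: G) [::] f1) \/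
  exists B : nat, bound_cert G f0 f1 B /\
    forall i, (i < B.*2.+1)%N ->
      nonmem_cert G [::] (scl 1 (i%:Z - B%:Z) f1 ++ scl (-1) 0 f0).

Lemma yes_certP G f0 f1 : yes_cert G f0 f1 <-> exists z, reaches G f0 f1 z.
Proof. by split=> -[z]; rewrite ?cf_catN ?cf_scl1 => oz; exists z; rewrite // cf_catN cf_scl1. Qed.

Lemma no_sound G f0 f1 : no_cert G f0 f1 -> forall z, ~ reaches G f0 f1 z.
Proof.
have sub f u : rspan G u -> rspan (f :: G) u.
  by apply: span_sub => k b _ bG; apply: span_gen; rewrite // inE bG orbT.
have gen f k : rspan (f :: G) (sh k (cf f)) by apply: span_gen; rewrite // inE eqxx.
have sgs f := span_sg predT (f :: G).
case=> [[/nonmem_certP nm|/nonmem_certP nm]|[B [bB nm]]] z oz.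
- apply: nm; apply/inmod_nil; rewrite -[cf f0]opprK -[- cf f0](addKr (sh z (cf f1))) opprD opprK.
  by apply: (sgs f1).2; [apply: gen | apply: sub].
- apply: nm; apply/inmod_nil; rewrite -[cf f1]sh0v -(addNr z) -sh_sh; apply: span_sh => //.
  rewrite -(subrK (cf f0) (sh z _)); apply: (sgD (sgs f0)); first exact: sub.
  by rewrite -[cf f0]sh0v; apply: gen.
have [z' oz' le_z'] := bound_sound bB oz.
have /nonmem_certP : nonmem_cert G [::] (scl 1 ((absz (z' + B%:Z))%:Z - B%:Z) f1 ++ scl (-1) 0 f0).
  by apply: nm; lia.
apply; apply/inmod_nil; rewrite cf_catN cf_scl1 gez0_abs; last by lia.
by rewrite addrK.
Qed.

(** * Existence of certificates *)

Lemma rspan_cons g G v : rspan (g :: G) v -> exists w, rspan G (v - cf (comb [:: g] w)).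
Proof.
apply: (@span_min _ _ (fun v => exists w, rspan G (v - cf (comb [:: g] w)))).
  split=> [|u u' [w Gu] [w' Gu']].
    by exists [::]; rewrite cf_nil subrr; apply: (span_sg _ _).1.
  exists (w ++ scl (-1) 0 w'); rewrite comb_cat cf_cat cf_comb_scl sh0v mulrNz mulr1z.
  have -> : u - u' - (cf (comb [:: g] w) - cf (comb [:: g] w')) =
      (u - cf (comb [:: g] w)) - (u' - cf (comb [:: g] w')).
    by apply: funext => p; rewrite !(vecD, vecN); ring.
  exact: (span_sg _ _).2.
move=> k b _; rewrite inE => /predU1P[->|bG].
  exists [:: (1, (k, 0%N))]; rewrite comb_cons cats0 cf_scl1 subrr.
  exact: (span_sg _ _).1.
by exists [::]; rewrite cf_nil subr0; apply: span_gen.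
Qed.

(** Membership reads [f = X^-1 w f] modulo the span of [G], with all exponents of [w] nonpositive.
    Multiplying by [X^(n+1)] gives the annihilator [X^(n+1) - X^n w], which is monic because [X^n w]
    has degree at most [n]. *)
Lemma monic_ann G f : inmod G [:: scl 1 (- 1) f] (cf f) ->
  exists2 M : {poly int}, M \is monic & ann G f M.
Proof.
move=> [u [y [Gu [w wle ey] ef]]].
have [n wn] := exp_bound [:: w]; have {}wn := wn w (mem_head _ _).
have st : (size (topoly n w) <= n.+1)%N.
  rewrite /topoly; apply: (leq_trans (size_sum _ _ _)); apply/bigmax_leqP_seq => -[c [k i]] tw _.
  rewrite (leq_trans (size_scale_leq _ _)) // size_polyXn ltnS.
  by have := allP wle _ tw; have := allP wn _ tw; rewrite /=; lia.
have yE : y = sh (- 1) (cf (comb [:: f] w)).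
  rewrite ey; elim: (w) => [|[c [k i]] v IH]; first by rewrite cf_nil (sh_eq0 _ 0).2.
  rewrite !comb_cons !cf_cat shD -IH !cf_scl; congr (_ + _).
  case: i => [|i] /=; last by rewrite nth_nil cf_nil !(sh_eq0 _ 0).2 ?mul0rz // (sh_eq0 _ 0).2.
  by rewrite cf_scl1 sh_mulz !sh_sh addrC.
exists ('X^(n.+1) - topoly n w).
  by rewrite monicE lead_coefDl ?lead_coefXn // size_polyXn size_polyN ltnS.
rewrite /ann pactB pactXn pact_topoly //.
have -> : sh n%:Z (cf (comb [:: f] w)) = sh n.+1%:Z y.
  by rewrite yE sh_sh; apply: eq_sh; lia.
by rewrite -shB ef addrK; apply: span_sh.
Qed.

Lemma annZ G f c p : ann G f p -> ann G f (c *: p).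
Proof. by rewrite -mul_polyC; apply: annM. Qed.

(** A nonzero annihilator [a] of least size divides all others by pseudo-division; as it divides the
    monic [M], it has a monic associate [q]. If [q] vanished at 0, so would [a], and [a / X] would
    be a smaller annihilator because [X] is invertible. *)
Lemma ann_generator G f (M : {poly int}) : M \is monic -> ann G f M ->
  exists q : {poly int}, [/\ q \is monic, q`_0 != 0, forall p, ann G f p -> q %| p &
    exists2 m, m != 0 & ann G f (m *: q)].
Proof.
move=> mM aM.
pose Q n := `[< exists a : {poly int}, [/\ a != 0, ann G f a & size a = n] >].
have exQ : exists n, Q n by exists (size M); apply/asboolP; exists M; rewrite monic_neq0.
case: (ex_minnP exQ) => m /asboolP[a [nza aa <-]] min_a.
have adiv p : ann G f p -> a %| p.
  move=> ap; rewrite /dvdp; apply: contraT => nz.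
  have e := Pdiv.Idomain.divp_eq p a.
  have /min_a : Q (size (p %% a)).
    apply/asboolP; exists (p %% a); split=> //.
    have -> : p %% a = lead_coef a ^+ scalp p a *: p - p %/ a * a by rewrite e addrC addKr.
    by apply: annB; [apply: annZ | apply: annM].
  by rewrite leqNgt ltn_modp nza.
have [q [mq aq qa]] := monic_associate mM (adiv M aM).
exists q; split=> //.
- apply: contra_eq_neq (erefl (size a)) => q0; have /rootP : root (pC q) 0.
    by rewrite rootE horner_coef0 coef_map /= q0.
  have [[c b] /= nzc e] := Pdiv.Idomain.dvdpP _ _ qa.
  have a0 : a`_0 = 0.
    have := congr1 (fun p : {poly int} => p`_0) e; rewrite coefZ coef0M q0 mulr0 => /eqP.
    by rewrite mulf_eq0 (negPf nzc) => /eqP.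
  have [a' ea] : exists a', a = a' * 'X.
    have /factor_theorem[a' ea] : root a 0 by rewrite rootE horner_coef0 a0.
    by exists a'; rewrite ea subr0.
  have nza' : a' != 0 by apply: contraNneq nza => a'0; rewrite ea a'0 mul0r.
  have /min_a : Q (size a').
    apply/asboolP; exists a'; split=> //; apply: (@annXn _ _ 1).
    by rewrite expr1 mulrC -ea.
  by rewrite ea size_mulX // ltnn.
- by move=> p /adiv; apply: dvdp_trans.
have [[c b] /= nzc e] := Pdiv.Idomain.dvdpP _ _ aq.
by exists c => //; rewrite e; apply: annM.
Qed.

(** The remainders modulo [M] of the geometric sums [S k] have finitely many residues modulo [m], so
    [S j - S i = A M + m t] for some [i < j]. Multiplied by [X^h - 1] the right side annihilates
    [f], and the left side telescopes to [X^(hi) (X^(h(j-i)) - 1)]. *)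
Lemma periodic G f (M : {poly int}) (m : int) (h : nat) : M \is monic -> ann G f M ->
  m != 0 -> ann G f (m *: ('X^h - 1)) -> (0 < h)%N ->
  exists2 h', (0 < h')%N & ann G f ('X^h' - 1).
Proof.
move=> mM aM nzm am h0.
pose S i : {poly int} := \sum_(l < i) 'X^h ^+ l.
pose c i := Pdiv.Ring.rmodp (S i) M.
have eS i : S i = Pdiv.Ring.rdivp (S i) M * M + c i by exact: Pdiv.RingMonic.rdivp_eq.
have [i [j [lt_ij e]]] := pigeonhole (fun i => [ffun l : 'I_(size M) =>
  inord `|((c i)`_l %% m)%Z| : 'I_(`|m|.+1)]).
have cij l : (m %| (c j - c i)`_l)%Z.
  rewrite coefB; case: (ltnP l (size M)) => [lt_l|le_l]; last first.
    have sc k : (size (c k) <= l)%N.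
      by apply: leq_trans le_l; apply: ltnW; rewrite Pdiv.Ring.ltn_rmodp monic_neq0.
    by rewrite !nth_default // subrr dvdz0.
  have := congr1 (fun g : {ffun 'I_(size M) -> 'I_(`|m|.+1)} => val (g (Ordinal lt_l))) e.
  have lt_m k : (`|(k %% m)%Z| < `|m|.+1)%N.
    by have := ltz_mod k nzm; have := modz_ge0 k nzm; lia.
  rewrite !ffunE /= !inordK // => /(congr1 Posz); rewrite !gez0_abs ?modz_ge0 // => eij.
  by rewrite -eqz_mod_dvd eij.
pose t := \poly_(l < size (c j - c i)) ((c j - c i)`_l %/ m)%Z.
have et : c j - c i = m *: t.
  apply/polyP => l; rewrite coefZ coef_poly; case: ltnP => [_|le_l].
    by rewrite mulrC divzK.
  by rewrite nth_default // mulr0.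
exists (h * (j - i))%N; first by rewrite muln_gt0 h0 subn_gt0.
apply: (@annXn G f (h * i)%N).
have -> : 'X^(h * i) * ('X^(h * (j - i)) - 1) = ('X^h - 1) * (S j - S i) :> {poly int}.
  rewrite mulrBr -[S j](opprK) -[S i]opprK.
  have key k : ('X^h - 1) * S k = 'X^(h * k) - 1 :> {poly int}.
    by rewrite exprM /S -subrX1.
  rewrite !opprK mulrBr mulr1 !key -exprD -mulnDr subnKC 1?ltnW //; ring.
rewrite (eS j) (eS i) opprD addrACA -mulrBl et; set A := (X in _ * (X * M + _)).
have -> : ('X^h - 1) * (A * M + m *: t) = ('X^h - 1) * A * M + t * (m *: ('X^h - 1)).
  by rewrite -!mul_polyC; ring.
by rewrite /ann pactD; apply: (sgD (span_sg _ _)); apply: annM.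
Qed.

Lemma dvdp_qdvd (q p : {poly int}) : q %| p -> qdvd q p.
Proof.
by case/Pdiv.Idomain.dvdpP=> -[c b] /= nz e; exists c, 0%N, b; rewrite expr0 mul1r.
Qed.

Lemma bound_complete G f0 f1 w0 w1 : rspan G (cf f0 - cf (comb [:: f1] w0)) ->
  rspan G (cf f1 - cf (comb [:: f0] w1)) -> exists B, bound_cert G f0 f1 B.
Proof.
move=> N0 N1; have [e we] := exp_bound [:: w0; w1].
have we0 : in_win (- e%:Z) e w0 by apply: we; rewrite inE eqxx.
have we1 : in_win (- e%:Z) e w1 by apply: we; rewrite !inE eqxx orbT.
pose H := (norm1 w0 + norm1 w1)%N.
have data B (C : Prop) : C -> (C -> ((e <= B)%N /\ nonmem_cert G [:: scl 1 (- 1) f1] f1) \/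
     exists q, ann_cert G f1 (rcons q 1) /\
       ((exists k : nat, (e + size q * H ^ k.+1 <= B)%N /\ expanding_cert q k) \/
        ((H * e <= B)%N /\ unipotent_cert q))) -> bound_cert G f0 f1 B.
  move=> c C'; right; exists w0, w1, e, H; rewrite we0 we1 leq_addr leq_addl !cf_catN.
  by split=> //; split=> //; split=> //; apply: C'.
case: (EM (inmod G [:: scl 1 (- 1) f1] (cf f1))) => [/monic_ann[M mM aM]|nm]; last first.
  by exists e; apply: (data e True) => // _; left; split=> //; apply/nonmem_certP.
have [q [mq q0 qdiv [m nzm aq]]] := ann_generator mM aM.
have [s es] := monic_rcons mq.
have eq : Poly (rcons s 1) = q by rewrite -es polyseqK.
have sq : size q = (size s).+1 by rewrite es size_rcons.
have cert : ann_cert G f1 (rcons s 1).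
  by apply: (ann_cert_complete mM aM) => p /qdiv; rewrite eq; apply: dvdp_qdvd.
case: (kronecker mq q0) => [[k [b [r [er sr lt_r]]]]|[h h0 xh]].
  exists (e + size s * H ^ k.+1)%N; apply: (data _ True) => // _; right; exists s; split=> //.
  left; exists k; split=> //; rewrite -eq in er; apply: (expanding_complete er).
    by rewrite sq ltnS in sr.
  by rewrite sq in lt_r.
case: (roots_of_unity mq h0 xh) => [/Pdiv.Idomain.dvdpP[[c b] /= nzc ec]|[r [sr rq rq' rX]]].
  (* [m *: q] annihilates [f1] and [q] divides [c *: ('X^h - 1)], so the nonzero integer [m * c]
     kills [(X^h - 1) f1]. *)
  have nzmc : m * c != 0 by rewrite mulf_neq0.
  have amc : ann G f1 ((m * c) *: ('X^h - 1)).
    by rewrite -scalerA ec scalerAr; apply: annM.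
  have [h' h'0 ah'] := periodic mM aM nzmc amc h0.
  exists h'; left; exists h'; rewrite h'0 leqnn; split=> //.
  by move: ah'; rewrite cf_catN cf_scl1 /ann pactB pactXn pact1.
exists (H * e)%N; apply: (data _ True) => // _; right; exists s; split=> //.
by right; split=> //; apply: (unipotent_complete h0 sr); rewrite ?eq.
Qed.

Lemma no_complete G f0 f1 : (forall z, ~ reaches G f0 f1 z) -> no_cert G f0 f1.
Proof.
move=> nr; case: (EM (rspan (f1 :: G) (cf f0))) => [/rspan_cons[w0 N0]|n0]; last first.
  by left; left; apply/nonmem_certP => /inmod_nil.
case: (EM (rspan (f0 :: G) (cf f1))) => [/rspan_cons[w1 N1]|n1]; last first.
  by left; right; apply/nonmem_certP => /inmod_nil.
right; have [B bB] := bound_complete N0 N1; exists B; split=> // i _.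
apply/nonmem_certP => /inmod_nil; rewrite cf_catN cf_scl1; exact: nr.
Qed.

(** * Certificates are recursively enumerable *)

Section ComputCert.
Context {E : Type} {eE : Enc E}.

Lemma comput_tri (B : E -> seq (pos * svec)) : comput B -> comput (fun e => tri (B e)).
Proof.
move=> rB; rewrite /tri.
pose nB := fun e i => nth (0, 0%N, [::]) (B e) i : pos * svec.
apply: (comput_all (p := fun e i => (cf (nB e i).2 (nB e i).1 != 0) &&
   all (fun j => (j <= i)%N || (cf (nB e j).2 (nB e i).1 == 0)) (iota 0 (size (B e))))).
  have rn D (eD : Enc D) (f : D -> E) (i : D -> nat) :
      comput f -> comput i -> comput (fun d => nB (f d) (i d)).
    by move=> rf ri; apply: comput_nth => //; apply: (comput_comp rB).
  have rB1 : comput (fun x : E * nat => B x.1) by apply: (comput_comp rB); comput_auto.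
  apply: comput_and.
    apply: comput_not; apply: comput_eq; last exact: comput_const.
    by apply: comput_cf; [apply: comput_snd | apply: comput_fst]; apply: rn; comput_auto.
  apply: (comput_all (p := fun (x : E * nat) j =>
      (j <= x.2)%N || (cf (nB x.1 j).2 (nB x.1 x.2).1 == 0))); last by comput_auto.
  apply: (comput_if (b := fun x => (x.2 <= x.1.2)%N)); first by comput_auto.
    exact: comput_const.
  apply: comput_eq; last exact: comput_const.
  by apply: comput_cf; [apply: comput_snd | apply: comput_fst]; apply: rn; comput_auto.
by comput_auto.
Qed.

Lemma comput_psv (s : E -> seq int) : comput s -> comput (fun e => psv (s e)).
Proof.
move=> rs; rewrite /psv.
apply: (comput_map (f := fun e i => ((s e)`_i, (Posz i, 0%N)))); last by comput_auto.
have rs1 : comput (fun x : E * nat => s x.1) by apply: (comput_comp rs); comput_auto.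
by comput_auto.
Qed.

Lemma comput_theta (s : E -> svec) : comput s -> comput (fun e => theta (s e)).
Proof.
move=> rs; rewrite /theta; apply: (comput_map (f := fun _ t => (t.1 * t.2.1, t.2))) rs.
by comput_auto.
Qed.

Lemma comput_norm1 (s : E -> svec) : comput s -> comput (fun e => norm1 (s e)).
Proof.
move=> rs; have r : comput (fun e => absz (\sum_(t <- s e) Posz (absz t.1))).
  by apply: comput_absz; apply: (comput_sumz (h := fun _ t => Posz (absz t.1))) rs; comput_auto.
apply: comput_ext r => e.
elim: (s e) => [|t w IH]; rewrite /norm1 ?big_nil // !big_cons -[X in (_ + X)%N]IH.
have : 0 <= \sum_(t <- w) Posz (absz t.1) by apply: sumr_ge0.
by move: (\sum_(t <- w) Posz _) => z; lia.
Qed.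

Lemma comput_in_win (lo hi : E -> int) (s : E -> svec) : comput lo -> comput hi ->
  comput s -> comput (fun e => in_win (lo e) (hi e) (s e)).
Proof.
move=> rl rh rs; rewrite /in_win.
apply: (comput_all (p := fun e t => (lo e <= t.2.1) && (t.2.1 <= hi e))) rs.
have rl1 := comput_comp rl (comput_fst comput_id).
by have rh1 := comput_comp rh (comput_fst comput_id); comput_auto.
Qed.

Lemma comput_dotp (psi s : E -> svec) : comput psi -> comput s ->
  comput (fun e => dotp (psi e) (cf (s e))).
Proof.
move=> rp rs; rewrite /dotp; apply: (comput_sumz (h := fun e t => t.1 * cf (s e) t.2)) rp.
have rs1 := comput_comp rs (comput_fst comput_id).
by apply: comput_mulz; [|apply: comput_cf]; comput_auto.
Qed.

Lemma comput_rcons1 (s : E -> seq int) : comput s -> comput (fun e => rcons (s e) 1).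
Proof.
move=> rs; apply: (comput_ext (f := fun e => s e ++ [:: 1])) => [e|]; first by rewrite cats1.
by comput_auto.
Qed.

Lemma comput_pred (m : E -> nat) : comput m -> comput (fun e => (m e).-1).
Proof.
by move=> rm; apply: (comput_ext (f := fun e => (m e - 1)%N)) => [e|]; rewrite ?subn1; comput_auto.
Qed.

End ComputCert.

(** A bounded search for the quotient: it is at most [|d|] when [m] is nonzero, and for [m = 0] the
    quotient 0 does, since then [d = 0]. *)
Lemma comput_dvdz {E} {eE : Enc E} (m d : E -> int) : comput m -> comput d ->
  comput (fun e => (m e %| d e)%Z).
Proof.
move=> rm rd.
pose t e := ~~ all (fun k => (k * absz (m e) != absz (d e))%N) (iota 0 (absz (d e)).+1).
apply: (comput_ext (f := t)) => [e|].
  rewrite dvdzE; apply/allPn/dvdnP => [[k _ /negbNE/eqP e1]|[k e1]]; first by exists k.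
  case: (posnP (absz (m e))) => [m0|m0].
    by exists 0%N; [rewrite mem_iota | rewrite e1 m0 !muln0].
  exists k; last by rewrite e1 eqxx.
  by rewrite mem_iota /= ltnS e1 leq_pmulr.
apply: comput_not.
apply: (comput_all (p := fun e k => (k * absz (m e) != absz (d e))%N)); last by comput_auto.
have rm1 := comput_comp rm (comput_fst comput_id).
have rd1 := comput_comp rd (comput_fst comput_id).
by apply: comput_not; apply: comput_eqn; comput_auto.
Qed.

Ltac comput_var := match goal with
  | H : comput ?f |- comput (fun x => ?f (@?g x)) => apply: (comput_comp H) end.
Ltac comput_svec := repeat first
  [ assumption | comput_var | apply: comput_tri | apply: comput_psv | apply: comput_theta
  | apply: comput_norm1 | apply: comput_in_win | apply: comput_dotp | apply: comput_dvdz
  | apply: comput_rcons1 | apply: comput_pred | apply: comput_cf | apply: comput_scl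
  | apply: comput_comb | apply: comput_eqv | comput_step ].

Lemma re_all_in {E} {B : eqType} {eE : Enc E} {eB : Enc B} (P : E -> B -> Prop) (s : E -> seq B) :
  comput s -> re (fun x : E * B => P x.1 x.2) -> re (fun e => forall b, b \in s e -> P e b).
Proof.
move=> rs rP; pose x0 : B := @dec _ eB 0.
apply: (re_ext (P := fun e => forall i, (i < size (s e))%N -> P e (nth x0 (s e) i))) => [e|].
  split=> H => [b /(nthP x0)[i lt_i <-]|i lt_i]; first exact: H.
  by apply: H; rewrite mem_nth.
apply: re_all; first by comput_auto.
apply: (re_comp (P := fun x => P x.1 x.2) (g := fun x => (x.1, nth x0 (s x.1) x.2))) => //.
by comput_svec.
Qed.

Section ReSpan.
Context {E : Type} {eE : Enc E}.

Lemma re_span (K : pred int) (G : E -> seq svec) (s : E -> svec) :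
  comput K -> comput G -> comput s -> re (fun e => lspan K (G e) (cf (s e))).
Proof.
move=> rK rG rs.
apply: (re_ext (P := fun e => exists w : svec,
    all (fun t => K t.2.1) w && eqv (s e) (comb (G e) w))) => [e|].
  split=> [[w /andP[Kw /eqvP ew]]|[w Kw /eqvP ew]]; first by exists w.
  by exists w; rewrite Kw.
apply: re_ex; apply: re_comput; comput_svec.
Qed.

Lemma re_rspan (G : E -> seq svec) (s : E -> svec) :
  comput G -> comput s -> re (fun e => rspan (G e) (cf (s e))).
Proof. by apply: re_span; apply: comput_const. Qed.

Lemma re_zspan (G : E -> seq svec) (s : E -> svec) :
  comput G -> comput s -> re (fun e => zspan (G e) (cf (s e))).
Proof. by apply: re_span; apply: comput_eq; comput_auto. Qed.

End ReSpan.

Ltac re_step := first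
  [ apply: re_and | apply: re_or | apply: re_ex | apply: re_all_in | apply: re_all
  | apply: re_zspan | apply: re_rspan | apply: re_comput ].

Section ReLattice.
Context {E : Type} {eE : Enc E}.

Lemma re_lattice_cert (lo hi d a : E -> int) (B1 : E -> seq (pos * svec)) (B2 : E -> seq svec) :
  comput lo -> comput hi -> comput d -> comput a -> comput B1 -> comput B2 ->
  re (fun e => lattice_cert (lo e) (hi e) (d e) (a e) (B1 e) (B2 e)).
Proof.
move=> rlo rhi rd ra rB1 rB2; apply: re_and.
  apply: re_comput; comput_svec.
apply: re_all_in => //; apply: re_zspan; comput_svec.
Qed.

End ReLattice.

Section ReWindow.
Context {E : Type} {eE : Enc E}.

Lemma re_window_cert (G F : E -> seq svec) (lo hi : E -> int) (B1 : E -> seq (pos * svec))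
  (B2 : E -> seq svec) :
  comput G -> comput F -> comput lo -> comput hi -> comput B1 -> comput B2 ->
  re (fun e => window_cert (G e) (F e) (lo e) (hi e) (B1 e) (B2 e)).
Proof.
move=> rG rF rlo rhi rB1 rB2; apply: re_ex; apply: re_ex; apply: re_and.
  by apply: re_and; apply: re_lattice_cert; comput_svec.
by repeat re_step; comput_svec.
Qed.

Lemma re_dvds (r : E -> seq int) (s : E -> svec) :
  comput r -> comput s -> re (fun e => dvds (r e) (s e)).
Proof. by move=> rr rs; repeat re_step; comput_svec. Qed.

Lemma re_qdvs (q : E -> seq int) (s : E -> svec) :
  comput q -> comput s -> re (fun e => qdvs (q e) (s e)).
Proof. by move=> rq rs; repeat re_step; comput_svec. Qed.

Lemma re_expanding_cert (q : E -> seq int) (k : E -> nat) :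
  comput q -> comput k -> re (fun e => expanding_cert (q e) (k e)).
Proof. by move=> rq rk; repeat re_step; comput_svec. Qed.

End ReWindow.

Section ReAnn.
Context {E : Type} {eE : Enc E}.

Lemma re_unipotent_cert (q : E -> seq int) :
  comput q -> re (fun e => unipotent_cert (q e)).
Proof.
move=> rq; apply: re_ex; apply: re_ex; apply: re_and.
  by apply: re_comput; comput_svec.
by apply: re_and; [|apply: re_and]; apply: re_dvds; comput_svec.
Qed.

Lemma re_nonmem_cert (G F : E -> seq svec) (v : E -> svec) :
  comput G -> comput F -> comput v -> re (fun e => nonmem_cert (G e) (F e) (v e)).
Proof.
move=> rG rF rv; do 6!apply: re_ex.
apply: (re_ext (P := fun x => (window_cert (G x.1.1.1.1.1.1) (F x.1.1.1.1.1.1) x.1.1.1.1.1.2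
   x.1.1.1.1.2 x.1.1.1.2 x.1.1.2 /\
   (in_win x.1.1.1.1.1.2 x.1.1.1.1.2 (v x.1.1.1.1.1.1) &&
    ~~ (x.2 %| dotp x.1.2 (cf (v x.1.1.1.1.1.1)))%Z)) /\
   forall b, b \in map snd x.1.1.1.2 ++ x.1.1.2 -> (x.2 %| dotp x.1.2 (cf b))%Z)) => [x|].
  by split=> [[[? /andP[? ?]] ?]|[? ? ? ->]]; [split|split=> //; split=> //; apply/andP].
apply: re_and; [apply: re_and|]; first by apply: re_window_cert; comput_svec.
  by apply: re_comput; comput_svec.
by repeat re_step; comput_svec.
Qed.

Lemma comput_graph (G : E -> seq svec) (f : E -> svec) :
  comput G -> comput f -> comput (fun e => graph (G e) (f e)).
Proof.
move=> rG rf; rewrite /graph /up; comput_svec.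
Qed.

Lemma re_ann_cert (G : E -> seq svec) (f : E -> svec) (q : E -> seq int) :
  comput G -> comput f -> comput q -> re (fun e => ann_cert (G e) (f e) (q e)).
Proof.
move=> rG rf rq; do 7!apply: re_ex; apply: re_and.
  by apply: re_window_cert; comput_svec; apply: comput_graph; comput_svec.
apply: re_and; first by apply: re_comput; comput_svec.
apply: re_and; first by repeat re_step; comput_svec.
apply: re_and; last by repeat re_step; comput_svec.
by apply: re_all_in; [|apply: re_qdvs]; comput_svec.
Qed.

End ReAnn.

Section ReBound.
Context {E : Type} {eE : Enc E}.

Lemma re_bound_cert (G : E -> seq svec) (f0 f1 : E -> svec) (B : E -> nat) :
  comput G -> comput f0 -> comput f1 -> comput B ->
  re (fun e => bound_cert (G e) (f0 e) (f1 e) (B e)).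
Proof.
move=> rG r0 r1 rB; apply: re_or; first by repeat re_step; comput_svec.
do 4!apply: re_ex; apply: re_and; first by apply: re_comput; comput_svec.
apply: re_and; first by repeat re_step; comput_svec.
apply: re_and; first by repeat re_step; comput_svec.
apply: re_or; first by apply: re_and; [apply: re_comput|apply: re_nonmem_cert]; comput_svec.
apply: re_ex; apply: re_and; first by apply: re_ann_cert; comput_svec.
apply: re_or; last by apply: re_and; [apply: re_comput|apply: re_unipotent_cert]; comput_svec.
by apply: re_ex; apply: re_and; [apply: re_comput|apply: re_expanding_cert]; comput_svec.
Qed.

End ReBound.

Lemma re_no_cert {E} {eE : Enc E} (G : E -> seq svec) (f0 f1 : E -> svec) :
  comput G -> comput f0 -> comput f1 -> re (fun e => no_cert (G e) (f0 e) (f1 e)).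
Proof.
move=> rG r0 r1; apply: re_or; first by apply: re_or; apply: re_nonmem_cert; comput_svec.
apply: re_ex; apply: re_and; first by apply: re_bound_cert; comput_svec.
apply: re_all; last by apply: re_nonmem_cert; comput_svec.
apply: (comput_ext (f := fun x => (x.2 + x.2).+1)) => [x|]; first by rewrite addnn.
by comput_svec.
Qed.

Lemma re_yes_cert {E} {eE : Enc E} (G : E -> seq svec) (f0 f1 : E -> svec) :
  comput G -> comput f0 -> comput f1 -> re (fun e => yes_cert (G e) (f0 e) (f1 e)).
Proof. by move=> rG r0 r1; repeat re_step; comput_svec. Qed.

(** * Vectors of Laurent polynomials as sparse vectors *)

Notation tF := (@tofrac {poly int}).

Lemma tofracX_neq0 : tF 'X != 0.
Proof. by rewrite tofrac_eq0 polyX_eq0. Qed.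

Lemma lXD k l : lX (k + l) = lX k * lX l.
Proof. by apply: val_inj => /=; rewrite expfzDr // tofracX_neq0. Qed.

Lemma lX0 : lX 0 = 1.
Proof. by apply: val_inj => /=; rewrite expr0z. Qed.

(** For an index [p.2] outside [[0, D)] this is the zero row, hence the condition [idx_lt] in
    [value_inj]. *)
Definition monom D (p : pos) : 'rV[laurent]_D := \row_i (lX p.1 *+ (i == p.2 :> nat)).

Definition value D (s : svec) : 'rV[laurent]_D := lin (@monom D) s.

Lemma monom_sh D e k j : monom D (e + k, j) = lX k *: monom D (e, j).
Proof. by apply/rowP => i; rewrite !mxE /= mulrnAr -lXD addrC. Qed.

Lemma value_cat D s t : value D (s ++ t) = value D s + value D t.
Proof. exact: lin_cat. Qed.

Lemma value_scl D c k s : value D (scl c k s) = (c%:~R * lX k) *: value D s.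
Proof.
rewrite /value; elim: s => [|[a [e j]] s IH]; first by rewrite !lin_nil scaler0.
rewrite !lin_cons IH scalerDr /= monom_sh; congr (_ + _).
by rewrite -!scaler_int rmorphM /= !scalerA; congr (_ *: _); ring.
Qed.

Definition flat (v : seq lpoly) : svec :=
  flatten [seq [seq (t.1, (t.2, j)) | t <- nth [::] v j] | j <- iota 0 (size v)].

Lemma value_flat D (v : D.-tuple lpoly) : value D (flat v) = vec_val v.
Proof.
rewrite /flat /value size_tuple.
have -> : lin (monom D) (flatten [seq [seq (t.1, (t.2, j)) | t <- nth [::] v j] | j <- iota 0 D])
    = \sum_(j < D) lin (monom D) [seq (t.1, (t.2, val j)) | t <- nth [::] v j].
  rewrite -(big_mkord xpredT (fun j => lin (monom D) [seq (t.1, (t.2, j)) | t <- nth [::] v j])).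
  rewrite /index_iota subn0; elim: (iota 0 D) => [|j r IH]; first by rewrite big_nil lin_nil.
  by rewrite big_cons -IH /= lin_cat.
apply/rowP => i; rewrite summxE !mxE (bigD1 i) //= big1 ?addr0 => [|j /negPf ne].
  rewrite /lpoly_val (tnth_nth [::]); elim: (nth _ _ _) => [|t s IH].
    by rewrite lin_nil big_nil mxE.
  by rewrite /= lin_cons mxE IH big_cons -scaler_int !mxE /= eqxx.
elim: (nth _ _ _) => [|t s IH]; first by rewrite lin_nil mxE.
rewrite /= lin_cons mxE IH addr0 -scaler_int !mxE /=.
by rewrite -val_eqE /= in ne; rewrite eq_sym ne mulr0n mulr0.
Qed.

Definition idx_lt D (s : svec) := all (fun t => t.2.2 < D)%N s.

Lemma flat_idx D (v : D.-tuple lpoly) : idx_lt D (flat v).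
Proof.
apply/allP => t /flatten_mapP[j]; rewrite mem_iota size_tuple => /andP[_ lt_j].
by move=> /mapP[u _ ->].
Qed.

(** Multiplying a coordinate by [X^n] makes all exponents nonnegative; the identity then holds
    between integer polynomials, by injectivity of [tofrac], and coefficients can be compared. *)
Lemma value_inj D s : idx_lt D s -> value D s = 0 -> cf s = 0.
Proof.
move=> lts s0; apply: funext => -[e j].
case: (ltnP j D) => [lt_j|le_j]; last first.
  apply: cf_notin; apply/mapP => -[t /(allP lts) + ej]; rewrite -ej /=.
  by rewrite ltnNge le_j.
(* The singleton at [e] is included so that [e + n] is nonnegative as well. *)
have [n wn] := exp_bound [:: s; [:: (1, (e, j))]].
have {}wn u : u \in [:: s; [:: (1, (e, j))]] -> forall t, t \in u -> 0 <= t.2.1 + n%:Z.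
  by move=> /wn/allP h [c [k i]] /h /=; lia.
have ws := wn s (mem_head _ _).
have we : 0 <= e + n%:Z by apply: (wn [:: (1, (e, j))] _ (1, (e, j))); rewrite !inE eqxx ?orbT.
have s0j : \sum_(t <- s | t.2.2 == j) lX t.2.1 *~ t.1 = 0.
  transitivity (value D s ord0 (Ordinal lt_j)); last by rewrite s0 mxE.
  rewrite /value /lin summxE [LHS]big_mkcond; apply: eq_bigr => t _.
  rewrite -scaler_int !mxE /= eq_sym; case: eqP => _; last by rewrite mulr0n mulr0.
  by rewrite -mulrzl mulr1n.
have p0 : \sum_(t <- s | t.2.2 == j) t.1 *: 'X^(absz (t.2.1 + n%:Z)) = 0 :> {poly int}.
  apply/eqP; rewrite -tofrac_eq0; apply/eqP; rewrite rmorph_sum /=.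
  transitivity (\val (lX n * \sum_(t <- s | t.2.2 == j) lX t.2.1 *~ t.1)); last first.
    by rewrite s0j mulr0 rmorph0.
  rewrite mulr_sumr rmorph_sum.
  rewrite big_seq_cond [RHS]big_seq_cond; apply: eq_bigr => t /andP[ts _].
  have {}ts := ws t ts.
  have -> : lX n * (lX t.2.1 *~ t.1) = lX (absz (t.2.1 + n%:Z)) *~ t.1.
    by rewrite (gez0_abs ts) lXD -mulrzAl mulrC.
  by rewrite raddfMz /= -exprnP -tofracXn -[t.1 in LHS]intz scaler_int raddfMz.
have := congr1 (fun p : {poly int} => p`_(absz (e + n%:Z))) p0.
rewrite coef0 coef_sum => e0; rewrite -[RHS]/(0 : int) -[RHS]e0 {e0} /cf.
rewrite [RHS]big_mkcond /= [LHS]big_seq [RHS]big_seq; apply: eq_bigr => -[c [k i]] ts.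
have /= ge0 := ws _ ts; rewrite xpair_eqE coefZ coefXn /=.
case: (i =P j) => _; rewrite ?andbF // andbT.
have -> : (absz (e + n%:Z) == absz (k + n%:Z)) = (k == e) by apply/eqP/eqP; lia.
by case: eqP; rewrite ?mulr1 ?mulr0.
Qed.

Lemma laurent_lpoly (a : laurent) : exists s : lpoly, a = lpoly_val s.
Proof.
case: a => x xP; have /asboolP[p [n ex]] := xP.
exists [seq (p`_i, i%:Z - n%:Z) | i <- iota 0 (size p)]; apply: val_inj.
rewrite /lpoly_val big_map rmorph_sum [LHS]/= ex.
rewrite -{1}[p]coefK poly_def rmorph_sum mulr_suml.
rewrite -(big_mkord xpredT (fun i : nat => tF (p`_i *: 'X^i) / tF 'X ^+ n)) /index_iota subn0.
apply: eq_bigr => i _; rewrite mulrzl raddfMz /= expfzDr ?tofracX_neq0 //.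
rewrite -exprnP -exprnN -tofracXn -[p`_i in LHS]intz scaler_int raddfMz /=.
by rewrite mulrzAl -tofracXn.
Qed.

(** Left to right, [laurent_lpoly] lifts the abstract coefficients to finite lists of terms, and
    [value_inj] turns equality of rows into equality of coefficients. Right to left, [lin_ext] makes
    [value] independent of the list, and the terms are collected generator by generator. *)
Lemma span_value D (G : seq (D.-tuple lpoly)) (s : svec) : idx_lt D s ->
  Defs.span (map (@vec_val D) G) (value D s) <-> rspan (map (@flat) (map val G)) (cf s).
Proof.
move=> ls; set F := map _ (map val G).
have nthF i : value D (nth [::] F i) = (map (@vec_val D) G)`_i.
  rewrite /F -map_comp; case: (ltnP i (size G)) => [lt_i|le_i]; last first.
    by rewrite !nth_default ?size_map // /value lin_nil.
  have [g0 _] : exists g0 : D.-tuple lpoly, true by exists [tuple [::] | i < D].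
  by rewrite !(nth_map g0) // value_flat.
have idxF i : idx_lt D (nth [::] F i).
  rewrite /F -map_comp; case: (ltnP i (size G)) => [lt_i|le_i]; last first.
    by rewrite nth_default ?size_map.
  have [g0 _] : exists g0 : D.-tuple lpoly, true by exists [tuple [::] | i < D].
  by rewrite (nth_map g0) // flat_idx.
have idx_comb w : idx_lt D (comb F w).
  apply/allP => t /flatten_mapP[u _] /mapP[v vF ->] /=; exact: (allP (idxF _) v vF).
have value_comb w : value D (comb F w) =
    \sum_(t <- w) (t.1%:~R * lX t.2.1) *: (map (@vec_val D) G)`_t.2.2.
  elim: w => [|t w IH]; first by rewrite big_nil /value lin_nil.
  by rewrite comb_cons value_cat value_scl IH big_cons nthF.
split=> [[c ec]|[w _ ew]].
  have /choice[l el] : forall i, exists l : lpoly, c i = lpoly_val l.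
    by move=> i; apply: laurent_lpoly.
  pose w : svec := flatten [seq [seq (t.1, (t.2, val i)) | t <- l i]
    | i <- enum 'I_(size (map (@vec_val D) G))].
  have e : value D (comb F w) = value D s.
    rewrite value_comb ec /w big_flatten big_map big_enum /=; apply: eq_bigr => i _.
    rewrite big_map el /lpoly_val scaler_suml; exact: eq_bigr.
  exists w; first exact: all_predT.
  apply/eqP; rewrite -subr_eq0; apply/eqP; rewrite -cf_catN; apply: (@value_inj D).
    by rewrite /idx_lt all_cat all_map /=; apply/andP; split=> //; exact: idx_comb.
  by rewrite value_cat value_scl lX0 mulr1 e mulrN1z scaleN1r subrr.
have -> : value D s = value D (comb F w) by exact: lin_ext.
rewrite value_comb; elim: w {ew} => [|t w [c IH]].
  by exists (fun=> 0); rewrite big_nil big1 // => i _; rewrite scale0r.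
rewrite big_cons IH; case: (ltnP t.2.2 (size (map (@vec_val D) G))) => [lt_t|le_t]; last first.
  by exists c; rewrite nth_default // scaler0 add0r.
exists (fun i => c i + (t.1%:~R * lX t.2.1) *+ (i == Ordinal lt_t)).
under [RHS]eq_bigr => i _ do rewrite scalerDl.
rewrite big_split addrC /=; congr (_ + _).
rewrite (bigD1 (Ordinal lt_t)) //= eqxx big1 ?addr0 // => i /negPf ->.
by rewrite mulr0n scale0r.
Qed.

Lemma question_reaches (x : Defs.input) : in_shift_orbit x <->
  exists z, reaches (map (@flat) (map val (gensN x))) (flat (elt0 x)) (flat (elt1 x)) z.
Proof.
have e z : lX z *: vec_val (elt1 x) - vec_val (elt0 x) =
    value (Defs.dim x) (scl 1 z (flat (elt1 x)) ++ scl (-1) 0 (flat (elt0 x))).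
  by rewrite value_cat !value_scl lX0 mulr1 mul1r mulrN1z scaleN1r !value_flat.
have idx z : idx_lt (Defs.dim x) (scl 1 z (flat (elt1 x)) ++ scl (-1) 0 (flat (elt0 x))).
  by rewrite /idx_lt all_cat !all_map /=; apply/andP; split; apply: flat_idx.
have key z : eq_mod (subN x) (lX z *: vec_val (elt1 x)) (vec_val (elt0 x)) <->
    reaches (map (@flat) (map val (gensN x))) (flat (elt0 x)) (flat (elt1 x)) z.
  by rewrite /reaches /eq_mod /subN e (span_value _ (idx z)) cf_catN cf_scl1.
by split=> -[z /key ?]; exists z.
Qed.

(** [code_lpoly] codes a term as a list of two integers, whereas [enc_prod] codes pairs by [npair];
    decoding therefore goes through lists [[:: c; e]]. *)
Definition raw_flat (v : seq (seq (seq int))) : svec :=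
  flatten [seq [seq (nth 0 t 0, (nth 0 t 1, j)) | t <- nth [::] v j] | j <- iota 0 (size v)].

Definition raw (v : seq lpoly) : seq (seq (seq int)) :=
  [seq [seq [:: t.1; t.2] | t <- s] | s <- v].

Lemma raw_flatE v : raw_flat (raw v) = flat v.
Proof.
rewrite /raw_flat /flat size_map; congr flatten; apply/eq_in_map => j.
rewrite mem_iota => /andP[_ lt_j]; rewrite (nth_map [::]) // -map_comp.
exact: eq_map.
Qed.

Lemma code_vecE D (v : D.-tuple lpoly) : code_vec v = enc (raw v).
Proof.
rewrite /code_vec /code_seq /raw /= -map_comp; congr CodeSeq.code; apply: eq_map => s /=.
by rewrite /code_lpoly /code_seq -map_comp.
Qed.

Definition input_nth (n i : nat) : nat := nth 0%N (CodeSeq.decode n) i.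

(** In the list coded by [code_input], position 2 holds the generators of N, and positions 3 and 4,
    read by [dec_vec], hold the two elements. *)
Definition dec_gens n : seq svec :=
  map raw_flat (dec (input_nth n 2) : seq (seq (seq (seq int)))).
Definition dec_vec i n : svec := raw_flat (dec (input_nth n i) : seq (seq (seq int))).

Lemma dec_gensE x : dec_gens (code_input x) = map (@flat) (map val (gensN x)).
Proof.
rewrite /dec_gens /input_nth CodeSeq.codeK.
set c := nth _ _ _; have -> : c = enc (map raw (map val (gensN x))).
  rewrite /c /= /code_seq -!map_comp; congr CodeSeq.code; apply: eq_map => v.
  exact: code_vecE.
by rewrite encK -!map_comp; apply: eq_map => v /=; rewrite raw_flatE.
Qed.

Lemma dec_vec0E x : dec_vec 3 (code_input x) = flat (elt0 x).
Proof.
rewrite /dec_vec /input_nth CodeSeq.codeK -[nth _ _ _]/(code_vec (elt0 x)).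
by rewrite code_vecE encK raw_flatE.
Qed.

Lemma dec_vec1E x : dec_vec 4 (code_input x) = flat (elt1 x).
Proof.
rewrite /dec_vec /input_nth CodeSeq.codeK -[nth _ _ _]/(code_vec (elt1 x)).
by rewrite code_vecE encK raw_flatE.
Qed.

Lemma comput_dec {A} {eA : Enc A} : comput (dec : nat -> A).
Proof. exact: rec1_encdec. Qed.

Lemma comput_input_nth i : comput (input_nth^~ i).
Proof.
have r : comput (fun n => nth 0%N (dec n : seq nat) i).
  by apply: comput_nth; [exact: comput_dec | exact: comput_const].
by apply: comput_ext r => n; rewrite /= map_id.
Qed.

Lemma comput_raw_flat : comput raw_flat.
Proof. by rewrite /raw_flat; comput_svec. Qed.

Lemma comput_dec_gens : comput dec_gens.
Proof.
have r : comput (fun n => dec (input_nth n 2) : seq (seq (seq (seq int)))).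
  exact: (comput_comp comput_dec (comput_input_nth 2)).
apply: (comput_map (f := fun _ => raw_flat)) r.
by apply: (comput_comp comput_raw_flat); comput_auto.
Qed.

Lemma comput_dec_vec i : comput (dec_vec i).
Proof. exact: (comput_comp comput_raw_flat (comput_comp comput_dec (comput_input_nth i))). Qed.

Theorem theorem1p2 : decidable_problem code_input valid_input in_shift_orbit.
Proof.
pose Yes n := yes_cert (dec_gens n) (dec_vec 3 n) (dec_vec 4 n).
pose No n := no_cert (dec_gens n) (dec_vec 3 n) (dec_vec 4 n).
have [[rG r0] r1] := (comput_dec_gens, comput_dec_vec 3, comput_dec_vec 4).
have rY : re Yes by apply: re_yes_cert.
have rN : re No by apply: re_no_cert.
(* Decoding is total, so exactly one of [Yes] and [No] holds at every number, code of an input or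
   not, as [re_decidable] requires. *)
have [n|n /yes_certP[z rz] /no_sound/(_ z)//|chi rchi chiP] := re_decidable rY rN.
  case: (EM (exists z, reaches (dec_gens n) (dec_vec 3 n) (dec_vec 4 n) z)) => [|nr].
    by move/yes_certP; left.
  by right; apply: no_complete => z rz; apply: nr; exists z.
exists (fun v => chi (thead v)) => [|x _].
  move: rchi; rewrite /rec1 /recn; congr (recursive _); apply: funext => v.
  by rewrite /thead (tnth_nth 0%N).
have -> : thead [tuple code_input x] = code_input x by [].
have [Y1 Y0] := chiP (code_input x).
have YE : Yes (code_input x) <-> in_shift_orbit x.
  by rewrite /Yes yes_certP dec_gensE dec_vec0E dec_vec1E question_reaches.
by split=> [/YE/Y1|nq] //; apply: Y0 => /YE.
Qed.
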